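(* Let $d\in\mathbb Z_+$. Consider the Abel equations $$\frac{dv}{dt}=f_1'v^2+f_2'v^3$$ on a compact interval $[a,b]$, where $f_1,f_2$ are real nonconstant Lipschitz functions on $[a,b]$ equal to zero at $a$, and $F=(f_1,f_2):[a,b]\to\mathbb R^2$ has Lipschitz triangulable image and belongs to the class $P_2(d)$ defined in the context. Then the set of universal centers of these equations is defined by vanishing of the moments $$\int_a^b f_1(t)^{d_1}\,f_2(t)^{d_2}\,f_2'(t)\,dt\quad\text{with}\quad d_1,d_2\in\mathbb Z_+,\ \max\{d_1-1,d_2\}\le d;$$ that is, for such $F$, the equation determines a universal center if and only if all these moments are equal to zero.
   Context: $\mathbb Z_+$ denotes the nonnegative integers. Universal center: the equation determines a universal center if all iterated integrals $\int\cdots\int_{a\le t_1\le\cdots\le t_k\le b}f'_{i_k}(t_k)\cdots f'_{i_1}(t_1)\,dt_k\cdots dt_1$, $k\ge1$, $i_1,\dots,i_k\in\{1,2\}$, vanish. (For Lipschitz $F$ with Lipschitz triangulable image $\Gamma_F$ this is known to be equivalent to: $F$ is a closed path contractible in $\Gamma_F$; and to: there are a finite tree $T$ and continuous maps $\tilde F:T\to\Gamma_F$, $\tilde f:[a,b]\to T$ with $\tilde f(a)=\tilde f(b)$ and $F=\tilde F\circ\tilde f$.) A compact set $\Gamma\subset\mathbb R^2$ is a Lipschitz triangulable curve if it is the union of finitely many arcs $\gamma_i$ such that for $i\ne j$ the intersection $\gamma_i\cap\gamma_j$ is either empty or consists of at most one of their endpoints, and each $\gamma_i$ is parameterized by a Lipschitz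 map $h_i:[0,1]\to\gamma_i\subset\mathbb R^2$ whose inverse is locally Lipschitz apart from the endpoints. Curves $\Gamma$ below are assumed connected. Traversable curves: an Eulerian trail in an undirected connected graph is a path that uses each edge exactly once; the graph is traversable if such a path exists, and unicursal if in addition the path is closed. A connected one-dimensional CW-complex $X$ is traversable (unicursal) if it is homeomorphic to a traversable (unicursal) graph. An Eulerian trail in such $X$ is then regarded as a continuous surjective map $\gamma:I\to X$, injective outside a finite set of points and traversing each edge exactly once, where $I$ is a closed arc of the unit circle $\mathbb S$, and $I=\mathbb S$ if and only if $X$ is unicursal. A path $\tilde\gamma:[a,b]\to X$ covers $\gamma$ if there is a path $\gamma':[a,b]\to I$ with $\tilde\gamma=\gamma\circ\gamma'$. For a compact Lipschitz triangulable curve $\Gamma\subset\mathbb R^2$, $P_2(\Gamma)$ is the set of closed Lipschitz paths $[a,b]\to\Gamma$ that cover Eulerian trails of traversable subcurves of $\Gamma$. The number $N_\Gamma$. If $\pi_1(\Gamma)=\{1\}$, put $N_\Gamma:=0$. Otherwise $\pi_1(\Gamma)$ is free with $m\ge1$ generators; let $\ell_1,\dots,\ell_m:[0,1]\to\Gamma$ be simple closed Lipschitz curves, oriented counterclockwise, whose classes generate $H_1(\Gamma)$, and let $D_j\subset\mathbb R^2$ be the bounded simply connected domain with boundary $\ell_j([0,1])$. Let $\{S_j\}_{1\le j\le m}$ be the connected components of $S=\bigl(\bigcup_jD_j\bigr)\setminus\bigl(\bigcup_j\ell_j([0,1])\bigr)$, let $r_j$ be the sidelength of the maximal open square with sides parallel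 to the coordinate axes contained in $S_j$, and $A_j$ the area of $S_j$. Put $r_\Gamma:=\min_jr_j$, $A_\Gamma:=\max_jA_j$, and let $d_\Gamma$ be half of the sidelength of the minimal closed square with sides parallel to the coordinate axes containing $S$. Then $$N_\Gamma:=\left\lfloor\frac{27\pi}{2}\cdot\frac{A_\Gamma d_\Gamma}{r_\Gamma^3}\right\rfloor+1.$$ $C_2(d)$ is the set of all compact Lipschitz triangulable curves $\Gamma\subset\mathbb R^2$ with $N_\Gamma\le d$, and $P_2(d):=\bigcup_{\Gamma\in C_2(d)}P_2(\Gamma)$. *)

(* Defs.v *)
From HB Require Import structures.
From mathcomp Require Import all_boot all_order all_algebra.
From mathcomp Require Import all_classical all_reals all_analysis.
From mathcomp.multinomials Require Import freeg.

Set Implicit Arguments.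
Unset Strict Implicit.
Unset Printing Implicit Defensive.

Import Order.TTheory GRing.Theory Num.Theory.
Import numFieldNormedType.Exports.

Local Open Scope classical_set_scope.
Local Open Scope ring_scope.

(* The plane is the product R * R.  The library norm on it is the max norm;
   Lipschitz conditions do not depend on this choice. *)

Section Equation.
Context {R : realType}.
Implicit Types (a b t : R) (f : R -> R).

(* iterated_integral f b [:: i_1; ..; i_k] t is
     \int_t^b f'_{i_1}(t_1) \int_{t_1}^b f'_{i_2}(t_2) ..
       \int_{t_{k-1}}^b f'_{i_k}(t_k) dt_k .. dt_1.
   derive1 is a total function: it is the derivative wherever that exists,
   hence almost everywhere when f is Lipschitz. *)
Fixpoint iterated_integral (f : 'I_2 -> R -> R) b (w : seq 'I_2) t : R :=
  if w is i :: w' then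
    \int[lebesgue_measure]_(s in `[t, b])
      (derive1 (f i) s * iterated_integral f b w' s)
  else 1.

Definition universal_center a b f1 f2 : Prop :=
  forall w : seq 'I_2, w != [::] ->
    iterated_integral (fun i => if i == ord0 then f1 else f2) b w a = 0.

Definition moment a b f1 f2 (d1 d2 : nat) : R :=
  \int[lebesgue_measure]_(t in `[a, b])
    (f1 t ^+ d1 * f2 t ^+ d2 * derive1 f2 t).

End Equation.

Section Curves.
Context {R : realType}.
Implicit Types (G : set (R * R)) (h : R -> R * R).

(* An arc is parameterized on `[0, 1]; values outside are irrelevant. *)
Definition arc_ends h : set (R * R) := [set h 0; h 1].

Definition lipschitz_arc h : Prop :=
  [/\ [lipschitz h t | t in `[0, 1]], set_inj `[0, 1] h &
   exists g : R * R -> R,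
     (forall t, `[0, 1]%classic t -> g (h t) = t) /\
     [locally [lipschitz g x | x in h @` `]0, 1[ ]]].

Definition lipschitz_triangulable G : Prop :=
  compact G /\
  exists (n : nat) (h : 'I_n -> R -> R * R),
    [/\ forall i, lipschitz_arc (h i),
        G = \bigcup_(i in [set: 'I_n]) (h i @` `[0, 1]) &
        forall i j, i != j ->
          h i @` `[0, 1] `&` h j @` `[0, 1] = set0 \/
          exists2 p, h i @` `[0, 1] `&` h j @` `[0, 1] = [set p] &
                     (arc_ends (h i) `&` arc_ends (h j)) p].

End Curves.

Section FundamentalGroup.
Context {R : realType} {T : topologicalType}.
Implicit Types (A : set T) (x : T) (c : R -> T).

Definition loop_in A x c : Prop :=
  [/\ {within `[0, 1], continuous c}, c @` `[0, 1] `<=` A, c 0 = x & c 1 = x].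

(* homotopy in A relative to the endpoints; the first variable is the
   deformation parameter *)
Definition path_homotopic A c c' : Prop :=
  exists H : R * R -> T,
    [/\ {within `[0, 1] `*` `[0, 1], continuous H},
        H @` (`[0, 1] `*` `[0, 1]) `<=` A,
        forall t, `[0, 1]%classic t -> H (0, t) = c t /\ H (1, t) = c' t &
        forall s, `[0, 1]%classic s -> H (s, 0) = c 0 /\ H (s, 1) = c 1].

Definition pi1_trivial A : Prop :=
  forall x c, A x -> loop_in A x c -> path_homotopic A c (cst x).

Definition path_cat c c' : R -> T :=
  fun t => if t <= 2^-1 then c (2 * t) else c' (2 * t - 1).

Definition path_rev c : R -> T := fun t => c (1 - t).

(* A word in the free group on 'I_m: (i, false) stands for the i-th generator
   and (i, true) for its inverse. *)
Definition word_eval m (g : 'I_m -> R -> T) x (w : seq ('I_m * bool)) : R -> T :=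
  foldr (fun l c => path_cat (if l.2 then path_rev (g l.1) else g l.1) c)
        (cst x) w.

Definition reduced_word m (w : seq ('I_m * bool)) : bool :=
  sorted (fun l l' => ~~ ((l.1 == l'.1) && (l.2 != l'.2))) w.

(* for path-connected A *)
Definition pi1_free_of_rank m A : Prop :=
  exists (x : T) (g : 'I_m -> R -> T),
    [/\ A x, forall i, loop_in A x (g i),
        forall c, loop_in A x c ->
          exists w, path_homotopic A c (word_eval g x w) &
        forall w, reduced_word w -> w != [::] ->
          ~ path_homotopic A (word_eval g x w) (cst x)].

End FundamentalGroup.

Section SingularHomology.
Context (R : realType).

Definition std_simplex n : set 'rV[R]_n.+1 :=
  [set x | (forall i, 0 <= x 0 i) /\ \sum_i x 0 i = 1].

Definition face_row n (i : 'I_n.+2) (x : 'rV[R]_n.+1) : 'rV[R]_n.+2 :=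
  \row_j (if unlift i j is Some k then x 0 k else 0).

Lemma face_row_std n (i : 'I_n.+2) (x : 'rV[R]_n.+1) :
  std_simplex x -> std_simplex (face_row i x).
Proof.
move=> [x0 x1]; split.
  by move=> j; rewrite mxE; case: unlift.
rewrite (bigD1_ord i)//= mxE unlift_none add0r -[RHS]x1.
by apply: eq_bigr => j _; rewrite mxE liftK.
Qed.

Definition face n (i : 'I_n.+2) (x : std_simplex (n := n)) :
    std_simplex (n := n.+1) :=
  SigSub (mem_set (face_row_std i (set_mem (valP x)))).

Lemma face_row_continuous n (i : 'I_n.+2) : continuous (@face_row n i).
Proof.
move=> x A [P nP sPA].
have xF : Filter (nbhs x) by exact: nbhs_filter.
have Pnear k j : nbhs x [set y | P k j (face_row i y k j)].
  have := nP k j; rewrite mxE; case E: (unlift i j) => [k'|] Pj.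
    apply: (@filterS _ _ xF _ _ _ (@coord_continuous R 1 n.+1 0 k' x _ Pj)).
    by move=> y; rewrite /= mxE E.
  apply: (@filterS _ _ xF _ _ _ filterT) => y _ /=.
  by rewrite mxE E; exact: nbhs_singleton Pj.
have Pnear_row k : nbhs x [set y | forall j, P k j (face_row i y k j)].
  exact: (filter_forall xF (Pnear k)).
apply: (@filterS _ _ xF _ _ _ (filter_forall xF Pnear_row)) => y Py.
exact: sPA.
Qed.

Lemma face_continuous n (i : 'I_n.+2) : continuous (@face n i).
Proof.
apply: continuous_comp_initial => x.
apply: (@continuous_comp _ _ _ set_val (@face_row n i)).
  exact: initial_continuous.
exact: face_row_continuous.
Qed.

HB.instance Definition _ n (i : 'I_n.+2) :=
  isContinuous.Build _ _ (@face n i) (@face_continuous n i).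

Section Chains.
Variable X : topologicalType.

Definition singular_simplex n : choiceType :=
  continuousType (std_simplex (n := n)) X.

Definition simplex_face n (i : 'I_n.+2) (s : singular_simplex n.+1) :
    singular_simplex n :=
  s \o face i.

Definition singular_boundary n :
    {freeg (singular_simplex n.+1)} -> {freeg (singular_simplex n)} :=
  fglift (fun s => \sum_(i < n.+2) (-1) ^+ i *: << simplex_face i s >>).

(* the classes of the 1-cycles s_j generate H_1(X) *)
Definition generate_H1 m (s : 'I_m -> singular_simplex 1) : Prop :=
  (forall j, singular_boundary << s j >> = 0) /\
  forall z : {freeg (singular_simplex 1)}, singular_boundary z = 0 ->
    exists (k : 'I_m -> int) (w : {freeg (singular_simplex 2)}),
      z = \sum_j k j *: << s j >> + singular_boundary w.

End Chains.
End SingularHomology.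

Section NGamma.
Context {R : realType}.
Implicit Types (G C D S : set (R * R)) (l : R -> R * R).

Definition simple_closed_lipschitz_curve G l : Prop :=
  [/\ [lipschitz l t | t in `[0, 1]], l @` `[0, 1] `<=` G,
      l 0 = l 1 & set_inj `[0, 1[ l].

(* l seen as a singular 1-simplex of the subspace G; the parameter t
   corresponds to the point (1 - t, t) of the standard simplex *)
Definition singular_simplex_of G l (s : singular_simplex R G 1) : Prop :=
  forall x, set_val (s x) = l (set_val x 0 ord_max).

Definition jordan_domain l D : Prop :=
  [/\ open D /\ connected D, bounded_set D, pi1_trivial (R := R) D &
      closure D `\` D° = l @` `[0, 1]].

(* l has winding number 1 around every point of D *)
Definition counterclockwise l D : Prop :=
  forall p, D p -> exists theta : R -> R,
    [/\ {within `[0, 1], continuous theta},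
        forall t, `[0, 1]%classic t -> exists2 rho : R, 0 < rho &
          l t = p + (rho * cos (theta t), rho * sin (theta t)) &
        theta 1 - theta 0 = 2 * pi].

Definition max_square_side C : R :=
  sup [set s | 0 < s /\
    exists x y, `]x, x + s[ `*` `]y, y + s[ `<=` C].

Definition min_square_side S : R :=
  inf [set s | 0 <= s /\
    exists x y, S `<=` `[x, x + s] `*` `[y, y + s]].

Definition area C : R := fine ((lebesgue_measure \x lebesgue_measure)%E C).

(* The possible values of N_Gamma for all choices of the curves l_j (it does
   not depend on them).  The rank of the fundamental group is written m.+1. *)
Definition is_N_Gamma G (N : int) : Prop :=
  (pi1_trivial (R := R) G /\ N = 0) \/
  ~ pi1_trivial (R := R) G /\
  exists (m : nat) (l : 'I_m.+1 -> R -> R * R) (D : 'I_m.+1 -> set (R * R))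
         (s : 'I_m.+1 -> singular_simplex R G 1) (C : 'I_m.+1 -> set (R * R)),
    let S := (\bigcup_(j in [set: 'I_m.+1]) D j) `\`
             (\bigcup_(j in [set: 'I_m.+1]) (l j @` `[0, 1])) in
    let r := \big[Num.min/max_square_side (C ord0)]_j max_square_side (C j) in
    let A := \big[Num.max/area (C ord0)]_j area (C j) in
    let d := min_square_side S / 2 in
    [/\ pi1_free_of_rank (R := R) m.+1 G,
        forall j, simple_closed_lipschitz_curve G (l j),
        forall j, jordan_domain (l j) (D j) /\ counterclockwise (l j) (D j),
        (forall j, singular_simplex_of (l j) (s j)) /\ generate_H1 s &
        [/\ injective C, range C = connected_component S @` S &
            N = Num.floor (27 * pi / 2 * (A * d / r ^+ 3)) + 1]].

Definition C2 (d : nat) G : Prop :=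
  [/\ connected G, lipschitz_triangulable G &
      exists2 N : int, is_N_Gamma G N & N <= d%:Z].

End NGamma.

Section Eulerian.
Context {R : realType}.
Implicit Types (X I G : set (R * R)) (F : R -> R * R).

(* X is the union of the edges e_i, which are arcs meeting only at common
   endpoints: a homeomorphism of X with a finite graph. *)
Definition graph_structure n (e : 'I_n -> R -> R * R) X : Prop :=
  [/\ forall i, {within `[0, 1], continuous (e i)} /\ set_inj `[0, 1] (e i),
      X = \bigcup_(i in [set: 'I_n]) (e i @` `[0, 1]) &
      forall i j, i != j ->
        e i @` `[0, 1] `&` e j @` `[0, 1] `<=`
          arc_ends (e i) `&` arc_ends (e j)].

(* An oriented edge: (i, false) goes from e_i(0) to e_i(1), (i, true) back. *)
Definition dart_source n (e : 'I_n -> R -> R * R) (l : 'I_n * bool) : R * R :=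
  e l.1 (if l.2 then 1 else 0).

Definition dart_target n (e : 'I_n -> R -> R * R) (l : 'I_n * bool) : R * R :=
  e l.1 (if l.2 then 0 else 1).

Definition is_eulerian_trail n (e : 'I_n -> R -> R * R)
    (w : seq ('I_n * bool)) : bool :=
  perm_eq (map fst w) (enum 'I_n) &&
  sorted (fun l l' => dart_target e l == dart_source e l') w.

Definition is_eulerian_circuit n (e : 'I_n -> R -> R * R)
    (w : seq ('I_n * bool)) : bool :=
  perm_eq (map fst w) (enum 'I_n) &&
  cycle (fun l l' => dart_target e l == dart_source e l') w.

Definition traversable X : Prop :=
  connected X /\ exists n (e : 'I_n -> R -> R * R),
    graph_structure e X /\ exists w, is_eulerian_trail e w.

Definition unicursal X : Prop :=
  connected X /\ exists n (e : 'I_n -> R -> R * R),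
    graph_structure e X /\ exists w, is_eulerian_circuit e w.

Definition unit_circle : set (R * R) := [set z | z.1 ^+ 2 + z.2 ^+ 2 = 1].

Definition circle_arc I : Prop :=
  exists alpha beta : R, alpha < beta /\
    I = (fun theta => (cos theta, sin theta)) @` `[alpha, beta].

Definition eulerian_trail X I (gamma : R * R -> R * R) : Prop :=
  [/\ traversable X, circle_arc I /\ (I = unit_circle <-> unicursal X),
      {within I, continuous gamma} /\ gamma @` I = X,
      exists2 P : set (R * R), finite_set P & set_inj (I `\` P) gamma &
      exists n (e : 'I_n -> R -> R * R), graph_structure e X /\
        forall i, set_bij (I `&` gamma @^-1` (e i @` `]0, 1[))
                          (e i @` `]0, 1[) gamma].

Definition covers a b F I (gamma : R * R -> R * R) : Prop :=
  exists delta : R -> R * R,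
    [/\ {within `[a, b], continuous delta}, delta @` `[a, b] `<=` I &
        forall t, `[a, b]%classic t -> F t = gamma (delta t)].

Definition P2_Gamma G a b F : Prop :=
  [/\ [lipschitz F t | t in `[a, b]], F a = F b, F @` `[a, b] `<=` G &
      exists X I gamma,
        [/\ X `<=` G, eulerian_trail X I gamma & covers a b F I gamma]].

Definition P2 (d : nat) a b F : Prop :=
  exists2 G, C2 d G & P2_Gamma G a b F.

End Eulerian.

(* Main.v *)
(** A polynomial in f1, f2 times f2' is a combination of iterated integrals, so
    universal centers have vanishing moments.  Conversely, by Green's formula the
    moments are the integrals of monomials of degree at most d in each variable
    against the winding number w of F.  This function vanishes outside the
    components S_j and is constant on each of them.  If it is not zero, a product
    of two Fejer-type kernels of degree at most d in each variable, centered in a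
    square contained in a component where |w| is maximal, has more than half of
    its mass there (this is what N_Gamma <= d is for), and its integral against w
    cannot vanish.  Hence w = 0 off Gamma, and Green's formula, localized to
    quadrants, gives that dF annihilates the indicator of every Borel set of the
    plane: F traverses each edge of the trail with total multiplicity 0.
    Therefore the lift to the line of the path in the circle arc is closed, and a
    path that factors through a closed path in an interval has vanishing iterated
    integrals, since the passages above and below each level cancel. *)
Require Import Defs.
From HB Require Import structures.
From mathcomp Require Import all_boot all_order all_algebra.
From mathcomp Require Import all_classical all_reals all_analysis.
From mathcomp Require Import measurable_realfun ring lra.
From mathcomp.multinomials Require Import freeg.
Import Order.TTheory GRing.Theory Num.Theory.
Import numFieldNormedType.Exports.
Set Implicit Arguments.
Unset Strict Implicit.
Unset Printing Implicit Defensive.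
Local Open Scope classical_set_scope.
Local Open Scope ring_scope.

(** Since F is only Lipschitz, Green's formula is proved one vertical line at a time: for almost
    every x the slice of Gamma is null, and the integral of v(F2) dF2 over the times with F1 > x
    equals the integral of w(x, y) v(y) in y. Integrating against p(x) puts an antiderivative of p
    at F1; this raises the degree in the first variable by one, which is why d1 - 1, and not d1, is
    compared with d. The kernels have order k = floor(d/2) + 1 and degree 2k - 2 <= d. Once 3 s <= k
    rho, with s the side of a box around S and 2 rho that of the chosen square, each variable keeps
    at least 8/11 of its mass near the center, and (8/11)^2 > 1/2. The definition of N_Gamma, with A
    >= r^2 and pi >= 2, yields this inequality with a small margin. The Eulerian trail is only
    continuous, so its edges carry no tangent and no length; passages are counted by integrating dF
    over the times when F lies in the compact image of a short arc of the parameter circle. *)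

(** * Integrals of functions that agree off a null set *)

Section IntegralOffNull.
Local Open Scope ereal_scope.
Import HBNNSimple.
Context d (T : measurableType d) (R : realType).
Variable mu : {measure set T -> \bar R}.

(** The integral of a nonnegative function is the supremum of the integrals of the simple functions
    below it, and cutting such a simple function off on [N] leaves its integral unchanged. The
    argument thus covers integrands built from [derive1], whose measurability is not established. *)
Let le_integral_off_null (N : set T) (f g : T -> \bar R) :
  measurable N -> mu N = 0 -> (forall x, 0 <= f x) -> (forall x, 0 <= g x) ->
  (forall x, ~ N x -> f x = g x) -> \int[mu]_x f x <= \int[mu]_x g x.
Proof.
move=> mN N0 f0 g0 fg; rewrite !ge0_integralTE//.
apply/ge_ereal_sup => /= _ -[h /= hf <-].
pose h' := mul_nnsfun h (indic_nnsfun R (measurableC mN)).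
have h'E x : h' x = (h x * \1_(~` N) x)%R by [].
apply: ereal_sup_ubound; exists h'.
  move=> x; rewrite h'E indicE; have [Nx|Nx] := pselect (N x).
    by rewrite memNset ?mulr0//; exact.
  by rewrite mem_set// mulr1 -fg.
rewrite -!integralT_nnsfun; apply: ge0_ae_eq_integral => //.
- exact/measurable_EFinP.
- exact/measurable_EFinP.
- by move=> x _; rewrite lee_fin.
- by move=> x _; rewrite lee_fin.
exists N; split => // x /= hx; apply: contrapT => Nx; apply: hx => _.
transitivity (h x * \1_(~` N) x)%:E => //.
by rewrite indicE mem_set// mulr1.
Qed.

Lemma integral_off_null (N D : set T) (f g : T -> \bar R) :
  measurable N -> mu N = 0 -> (forall x, D x -> ~ N x -> f x = g x) ->
  \int[mu]_(x in D) f x = \int[mu]_(x in D) g x.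
Proof.
move=> mN N0 fg.
have pn (h k : T -> \bar R) : (forall x, 0 <= h x) -> (forall x, 0 <= k x) ->
    (forall x, D x -> ~ N x -> h x = k x) ->
    \int[mu]_(x in D) h x = \int[mu]_(x in D) k x.
  move=> h0 k0 hk; rewrite integral_mkcond [RHS]integral_mkcond.
  apply/eqP; rewrite eq_le; apply/andP; split; apply: le_integral_off_null mN N0 _ _ _.
  1,2,4,5: by move=> x; rewrite patchE; case: ifP.
  - by move=> x Nx; rewrite !patchE; case: ifP => // /set_mem Dx; apply: hk.
  - by move=> x Nx; rewrite !patchE; case: ifP => // /set_mem Dx; rewrite hk.
rewrite integralE [RHS]integralE; congr (_ - _); apply: pn => // x Dx Nx.
  by rewrite !funeposE fg.
by rewrite !funenegE fg.
Qed.

End IntegralOffNull.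

(** * Lipschitz functions as integrals of bounded densities *)

Section Density.
Context {R : realType}.
Notation mu := (@lebesgue_measure R).
Implicit Types (f g : R -> R) (a b x y L : R).

Definition lip L f := forall x y, `|f x - f y| <= L * `|x - y|.

(** For a <= b this is the retraction of the line onto [a, b]; composing with it extends data on an
    interval to continuous or Lipschitz data on the line. *)
Definition clamp a b x : R := Num.max a (Num.min b x).

Lemma clamp_id a b x : a <= x <= b -> clamp a b x = x.
Proof. by move=> /andP[ax xb]; rewrite /clamp (min_idPr xb) (max_idPr ax). Qed.

Lemma clamp_itv a b x : a <= b -> a <= clamp a b x <= b.
Proof.
by move=> ab; rewrite /clamp le_max lexx/= ge_max ab ge_min lexx.
Qed.

Lemma clamp_le a b x : x <= a -> a <= b -> clamp a b x = a.
Proof.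
move=> xa ab; rewrite /clamp (min_idPr (le_trans xa ab)).
by apply/max_idPl.
Qed.

Lemma clamp_ge a b x : b <= x -> a <= b -> clamp a b x = b.
Proof. by move=> bx ab; rewrite /clamp (min_idPl bx); apply/max_idPr. Qed.

Lemma clamp_idem a b x : a <= b -> clamp a b (clamp a b x) = clamp a b x.
Proof. by move=> ab; rewrite clamp_id// clamp_itv. Qed.

Lemma clamp_mono a b x y : x <= y -> clamp a b x <= clamp a b y.
Proof.
move=> xy; rewrite /clamp; have [] := leP b x; have [] := leP b y;
rewrite ge_max !le_max lexx /=; lra.
Qed.

Lemma clampB a b x y : x <= y -> clamp a b y - clamp a b x <= y - x.
Proof.
move=> xy; rewrite /clamp; have [] := leP b x; have [] := leP b y; move=> h1 h2.
- by rewrite subrr; lra.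
- lra.
- have [] := leP a b; have [] := leP a x; lra.
- have [] := leP a x; have [] := leP a y; lra.
Qed.

Lemma lip_clamp a b : lip 1 (clamp a b).
Proof.
move=> x y; rewrite mul1r; wlog xy : x y / x <= y => [H|].
  by have [/H//|/ltW/H] := leP x y; rewrite distrC [X in _ <= X]distrC.
rewrite distrC ger0_norm ?subr_ge0 ?clamp_mono//.
by rewrite distrC ger0_norm ?subr_ge0// clampB.
Qed.

Lemma lip_continuous L f : lip L f -> continuous f.
Proof.
move=> lf x; apply/cvgrPdist_lt => e e0.
have L1 : 0 < `|L| + 1 by rewrite ltr_wpDl.
have d0 : 0 < e / (`|L| + 1) by rewrite divr_gt0.
apply/nbhs_ballP; exists (e / (`|L| + 1)) => //= y xy.
apply: (le_lt_trans (lf x y)).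
apply: (@le_lt_trans _ _ ((`|L| + 1) * `|x - y|)).
  by rewrite ler_wpM2r// (le_trans (ler_norm L))// lerDl.
by rewrite mulrC -ltr_pdivlMr.
Qed.

(** A representative of the derivative that is measurable and bounded everywhere, so that products
    with it are integrable, whereas [derive1 f] is controlled only almost everywhere. *)
Definition density a b f g L := [/\ measurable_fun [set: R] g,
  forall x, `|g x| <= L,
  forall x y, a <= x -> x <= y -> y <= b ->
     f y - f x = \int[mu]_(t in `[x, y]) g t &
  {ae mu, forall x, a < x -> x < b -> derivable f x 1 /\ derive1 f x = g x}].

Section Stieltjes.
Variables (h : R -> R) (M : R).
Hypotheses (M0 : 0 < M) (hnd : {homo h : x y / x <= y})
  (hM : forall x y, x <= y -> h y - h x <= M * (y - x)).

(** Both [h] and [h'] are nondecreasing, and their Stieltjes measures add up to [M] times Lebesgue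
    measure; hence the measure of [h] is dominated by [M] times Lebesgue measure and has a
    Radon-Nikodym density. *)
Let h' x := M * x - h x.

Let h'nd : {homo h' : x y / x <= y}.
Proof. by move=> x y /hM; rewrite /h'; lra. Qed.

Let lip_h : lip M h.
Proof.
move=> x y; wlog xy : x y / x <= y => [H|].
  by have [/H//|/ltW/H] := leP x y; rewrite distrC [X in _ <= _ * X]distrC.
rewrite distrC ger0_norm ?subr_ge0 ?hnd//.
by rewrite distrC ger0_norm ?subr_ge0// hM.
Qed.

Let ch : continuous h := lip_continuous lip_h.

Let ch' : continuous h'.
Proof.
move=> x; apply: cvgB; last exact: ch.
by apply: cvgMr; exact: cvg_id.
Qed.

HB.instance Definition _ :=
  isCumulative.Build R _ R h hnd (right_continuousW ch).
HB.instance Definition _ :=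
  isCumulative.Build R _ R h' h'nd (right_continuousW ch').

Let nu : {measure set (measurableTypeR R) -> \bar R} :=
  lebesgue_stieltjes_measure h.
Let nu' : {measure set (measurableTypeR R) -> \bar R} :=
  lebesgue_stieltjes_measure h'.

Let nu_itv (k : cumulative R R) x y : x <= y ->
  lebesgue_stieltjes_measure k `]x, y] = (k y - k x)%:E.
Proof.
move=> xy; rewrite /lebesgue_stieltjes_measure /measure_extension.
rewrite measurable_mu_extE//=; last exact: is_ocitv.
by rewrite wlength_itv_bnd.
Qed.

Let nuE x y : x <= y -> nu (`]x, y]%classic : set R) = (h y - h x)%:E.
Proof. exact: (nu_itv h). Qed.

Let nuM A : measurable A -> (nu A <= M%:E * mu A)%E.
Proof.
move=> mA.
have sE X : mscale (NngNum (ltW (divr_gt0 ltr01 M0))) (measure_add nu nu') X =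
    ((1 / M)%:E * (nu X + nu' X))%E by rewrite /mscale -measure_addE.
pose s : {nonneg R} := NngNum (ltW (divr_gt0 ltr01 M0)).
have -> : mu A = mscale s (measure_add nu nu') A.
  apply: lebesgue_measure_unique mA => X /ocitvP[->|[[x y] /= xy ->]].
    by rewrite !measure0.
  rewrite sE lebesgue_measure_itv/= lte_fin xy.
  rewrite /nu /nu' (nu_itv h (ltW xy)) (nu_itv h' (ltW xy)) -!EFinD -EFinM; congr EFin.
  have -> : h y - h x + (h' y - h' x) = M * (y - x) by rewrite /h'; ring.
  by rewrite mul1r mulKf// gt_eqF.
rewrite sE muleA -EFinM.
by rewrite mul1r divff ?gt_eqF// mul1e leeDl.
Qed.

Lemma nondecreasing_lip_density a b : a <= b ->
  exists g : R -> R, [/\ measurable_fun [set: R] g, mu.-integrable setT (EFin \o g) &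
  forall x y, a <= x -> x <= y -> y <= b ->
     h y - h x = \int[mu]_(t in `[x, y]) g t].
Proof.
move=> ab; have mI : measurable (`]a, b]%classic : set (measurableTypeR R)) by exact: measurable_itv.
have fI : (nu `]a, b]%classic < +oo)%E by rewrite nuE// ltry.
pose rho : {finite_measure set (measurableTypeR R) -> \bar R} := mfrestr mI fI.
have rmu : rho `<< (mu : {sigma_finite_measure set (measurableTypeR R) -> \bar R}).
  apply/null_content_dominatesP => A mA A0; apply/eqP; rewrite eq_le measure_ge0 andbT.
  apply: (@le_trans _ _ (nu A)).
    have -> : rho A = nu (A `&` `]a, b]%classic) by [].
    by rewrite le_measure// inE//; exact: measurableI.
  by apply: (le_trans (nuM mA)); rewrite A0 mule0.
pose g := Radon_Nikodym_SigmaFinite.f rho mu.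
have ig : mu.-integrable setT g by exact: Radon_Nikodym_SigmaFinite.f_integrable.
have gfin x : g x \is a fin_num by exact: Radon_Nikodym_SigmaFinite.f_fin_num.
have gE : EFin \o (fine \o g) = g by apply/funext => x /=; rewrite fineK.
exists (fine \o g); split.
- by apply/measurable_EFinP; rewrite gE; exact: (measurable_int _ ig).
- by rewrite gE.
move=> x y ax xy yb.
rewrite -Rintegral_itv_obnd_cbnd; last first.
  by rewrite gE; apply: integrableS ig => //; exact: measurable_itv.
rewrite /Rintegral -[X in integral _ _ X]/(EFin \o (fine \o g)) gE.
rewrite -(Radon_Nikodym_SigmaFinite.f_integral rmu (measurable_itv _)).
rewrite /rho /= /mfrestr /mrestr setIidl; last first.
  move=> z /=; rewrite !in_itv/= => /andP[xz zy].
  by rewrite (le_lt_trans ax xz) (le_trans zy yb).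
by rewrite nuE.
Qed.

End Stieltjes.

Lemma bounded_integrable x y g L : measurable_fun setT g ->
  (forall t, `|g t| <= L) -> mu.-integrable `[x, y] (EFin \o g).
Proof.
move=> mg gL; apply: measurable_bounded_integrable.
- exact: measurable_itv.
- by rewrite /= lebesgue_measure_itv/=; case: ifP => // _; rewrite -EFinD ltry.
- exact: measurable_funTS.
- exists L; split; first by rewrite num_real.
  by move=> M LM t _; apply: le_trans (gL t) (ltW LM).
Qed.

Lemma ae_imply (P Q : R -> Prop) : (forall x, P x -> Q x) ->
  {ae mu, forall x, P x} -> {ae mu, forall x, Q x}.
Proof. by move=> PQ; apply: filterS; first exact: (ae_filter_ringOfSetsType mu). Qed.

Lemma ae_conj (P Q : R -> Prop) :
  {ae mu, forall x, P x} -> {ae mu, forall x, Q x} -> {ae mu, forall x, P x /\ Q x}.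
Proof. by move=> aP aQ; apply: filterI; first exact: (ae_filter_ringOfSetsType mu). Qed.

Lemma derive_lip_bound f L x : lip L f -> derivable f x 1 ->
  `|derive1 f x| <= L.
Proof.
move=> lf df; rewrite derive1E.
have : `|h^-1 *: (f (h *: 1 + x) - f x)| @[h --> 0^'] --> `|'D_1 f x|.
  by apply: cvg_norm; exact: df.
move/cvg_lim => <- //; apply: limr_le.
  by apply/cvg_ex; eexists; apply: cvg_norm; exact: df.
near=> h; rewrite normrZ normfV.
have h0 : 0 < `|h| by rewrite normr_gt0; near: h; exact: nbhs_dnbhs_neq.
rewrite ler_pdivrMl// mulrC; apply: (le_trans (lf _ _)).
by rewrite addrK [h *: 1]mulr1.
Unshelve. all: by end_near. Qed.

Lemma ae_clamp_derive L f g a b : a <= b -> lip L f -> 0 <= L ->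
  {ae mu, forall x, a < x -> x < b -> derivable f x 1 /\ derive1 f x = g x} ->
  {ae mu, forall x, a < x -> x < b -> derivable f x 1 /\ derive1 f x = clamp (- L) L (g x)}.
Proof.
move=> ab lf L0; apply: ae_imply => x H ax xb; have [df dE] := H ax xb.
split => //; rewrite -dE clamp_id//.
by have := derive_lip_bound lf df; rewrite ler_norml.
Qed.

Lemma Rintegral_ae a b g k :
  {ae mu, forall x, a < x -> x < b -> g x = k x} ->
  forall x y, a <= x -> y <= b ->
  \int[mu]_(t in `[x, y]) g t = \int[mu]_(t in `[x, y]) k t.
Proof.
move=> -[N [mN N0 NP]] x y ax yb; rewrite /Rintegral; congr fine.
have m1 (z : R) : measurable ([set z] : set (measurableTypeR R)) by exact: measurable_set1.
apply: (@integral_off_null _ _ _ _ (N `|` [set a] `|` [set b])).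
- by apply: measurableU; first exact: measurableU.
- apply: null_set_setU; [exact: measurableU|exact: m1| |exact: lebesgue_measure_set1].
  by apply: null_set_setU; [exact: mN|exact: m1|exact: N0|exact: lebesgue_measure_set1].
move=> z /=; rewrite in_itv/= => /andP[xz zy] /not_orP[] /not_orP[] Nz za zb.
congr EFin; apply: contrapT => gk; apply: Nz; apply: NP => /= H; apply: gk.
apply: H; rewrite lt_neqAle.
  by rewrite (le_trans ax xz) andbT; apply/eqP => /esym.
by rewrite (le_trans zy yb) andbT; apply/eqP.
Qed.

(** Adding [L * x] makes [f] nondecreasing, so a Radon-Nikodym density exists. Subtracting [L] and
    clamping to [-L, L] gives a bound at every point, and Lebesgue differentiation identifies the
    result with the derivative. *)
Lemma lip_density a b f L : a <= b -> 0 <= L -> lip L f ->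
  exists g, density a b f g L.
Proof.
move=> ab L0 lf; pose h x := f x + L * x.
have hnd : {homo h : x y / x <= y}.
  move=> x y xy; have := lf x y; rewrite distrC ler_norml => /andP[].
  by rewrite distrC ger0_norm ?subr_ge0// /h; lra.
(* The slope is at most 2L; the added 1 keeps the constant positive when L = 0. *)
have hM x y : x <= y -> h y - h x <= (2 * L + 1) * (y - x).
  move=> xy; have := lf y x; rewrite ler_norml => /andP[].
  by rewrite ger0_norm ?subr_ge0// /h; lra.
have M0 : 0 < 2 * L + 1 by lra.
have [g0 [mg0 ig0 g0E]] := nondecreasing_lip_density M0 hnd hM ab.
pose g x := clamp (- L) L (g0 x - L).
have mg : measurable_fun setT g.
  apply: (@measurableT_comp _ _ _ _ _ _ (clamp (- L) L)).
    exact: continuous_measurable_fun (lip_continuous (@lip_clamp _ _)).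
  by apply: measurable_funB => //; exact: measurable_cst.
have aeD0 : {ae mu, forall x, a < x -> x < b ->
    derivable f x 1 /\ derive1 f x = g0 x - L}.
  have ig y : mu.-integrable [set` Interval (BLeft a) (BRight y)] (EFin \o g0).
    by apply: integrableS ig0 => //; exact: measurable_itv.
  have lg : locally_integrable [set: R] g0.
    by have := integrable_locally measurableT ig0; rewrite patch_setT.
  have := FTC1 ig lg; apply: ae_imply => x H ax xb.
  have [] := H ax.
  set F := (fun x : R => _) => dF dFE.
  have fE : \forall z \near x, h a + F z - L * z = f z.
    have : x \in `]a, b[ by rewrite in_itv/= ax.
    move/near_in_itvoo; apply: filterS => z; rewrite in_itv/= => /andP[az zb].
    by rewrite /F -g0E ?(ltW az) ?(ltW zb)// /h; ring.
  have df : is_derive x 1 (fun z => h a + F z - L * z) (g0 x - L).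
    have dF' : is_derive x 1 F (g0 x).
      by apply: DeriveDef; [exact: dF|rewrite -derive1E; exact: dFE].
    have dL : is_derive x 1 ( *%R L : R -> R) L.
      by have := is_deriveZ L (is_derive_id x (1 : R)); rewrite /GRing.scale/= mulr1.
    have := is_deriveB (is_deriveD (is_derive_cst (h a) x 1) dF') dL.
    by rewrite add0r.
  have df' : is_derive x 1 f (g0 x - L).
    apply: near_eq_is_derive df => //; exact: oner_neq0.
  by rewrite derive1E; split; [exact: ex_derive | rewrite derive_val].
have aeD := ae_clamp_derive ab lf L0 aeD0.
exists g; split => //.
- move=> x; have := @clamp_itv (- L) L (g0 x - L); rewrite -ler_norml => -> //.
  by rewrite lerNl; lra.
move=> x y ax xy yb.
have aeg : {ae mu, forall x, a < x -> x < b -> g x = g0 x - L}.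
  apply: ae_imply (ae_conj aeD0 aeD) => z [H1 H2] az zb.
  by rewrite /g -(H2 az zb).2 (H1 az zb).2.
have igxy : mu.-integrable `[x, y] (EFin \o g0).
  by apply: integrableS ig0 => //; exact: measurable_itv.
have icxy : mu.-integrable `[x, y] (EFin \o (cst L)).
  by apply: (@bounded_integrable _ _ _ `|L|).
rewrite (Rintegral_ae aeg ax yb) RintegralB//.
rewrite -g0E// Rintegral_cst//.
rewrite /= lebesgue_measure_itv/= lte_fin -EFinB.
case: ltP => [_|yx] /=; rewrite /h; first by ring.
by have -> : x = y; [apply/eqP; rewrite eq_le xy yx|ring].
Qed.

End Density.

(** * Bounded convergence, and the distance to a closed set *)

Lemma bounded_cvg_Rintegral d (T : measurableType d) (R : realType)
    (m : {measure set T -> \bar R}) (D : set T) (k_ : nat -> T -> R) (k : T -> R) (M : R) :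
  measurable D -> (m D < +oo)%E -> (forall n, measurable_fun D (k_ n)) ->
  (forall n t, D t -> `|k_ n t| <= M) ->
  (forall t, D t -> k_ n t @[n --> \oo] --> k t) ->
  \int[m]_(t in D) k_ n t @[n --> \oo] --> \int[m]_(t in D) k t.
Proof.
move=> mD mDoo mk kM kk.
have mk' : measurable_fun D k by exact: measurable_fun_cvg mk kk.
have iM : m.-integrable D (EFin \o cst M).
  apply: measurable_bounded_integrable => //.
  by exists `|M|; split; rewrite ?num_real// => N MN t _ /=; exact: ltW.
have [] := @dominated_convergence _ _ _ m D mD (fun n => EFin \o k_ n) (EFin \o k) (EFin \o cst M).
- by move=> n; apply/measurable_EFinP.
- exact/measurable_EFinP.
- by apply: aeW => t Dt; apply: cvg_EFin; [exact: nearW|exact: kk].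
- by [].
- by apply: aeW => t n Dt; rewrite /= lee_fin kM.
move=> ik _ cI; apply: fine_cvg; rewrite fineK; first exact: cI.
exact: integrable_fin_num.
Qed.

Section Distance.
Context {R : realType}.
Implicit Types (K : set R) (x y z : R).

Definition dist_to K z := inf [set `|z - k| | k in K].

Lemma dist_to_has_inf K z : K !=set0 -> has_inf [set `|z - k| | k in K].
Proof.
move=> [k Kk]; split; first by exists `|z - k|, k.
by exists 0 => _ [y _ <-].
Qed.

Lemma dist_to_ge0 K z : K !=set0 -> 0 <= dist_to K z.
Proof.
by move=> K0; apply: lb_le_inf => [|_ [y _ <-]//]; exact: (dist_to_has_inf z K0).1.
Qed.

Lemma dist_to_le K z k : K k -> dist_to K z <= `|z - k|.
Proof.
move=> Kk; apply: ge_inf; last by exists k.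
by exists 0 => _ [y _ <-].
Qed.

Lemma dist_to_lip K : K !=set0 -> lip 1 (dist_to K).
Proof.
move=> K0 x y; rewrite mul1r.
have H u v : dist_to K u - dist_to K v <= `|u - v|.
  rewrite lerBlDr -lerBlDl; apply: lb_le_inf; first exact: (dist_to_has_inf v K0).1.
  move=> _ [k Kk <-]; rewrite lerBlDl; apply: (le_trans (dist_to_le u Kk)).
  have -> : u - k = (u - v) + (v - k) by ring.
  exact: ler_normD.
by rewrite ler_norml H andbT lerNl opprB distrC H.
Qed.

Lemma dist_to_gt0 K z : closed K -> ~ K z -> K !=set0 -> 0 < dist_to K z.
Proof.
move=> cK Kz K0; rewrite lt_neqAle dist_to_ge0// andbT; apply/eqP => d0.
apply: Kz; apply: cK => B /nbhs_ballP[e /= e0 eB].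
have : inf [set `|z - k| | k in K] < e by rewrite -/(dist_to K z) -d0.
move/(inf_lt (dist_to_has_inf z K0).1) => [_ [k Kk <-] kz].
by exists k; split => //; exact: eB.
Qed.

Lemma dist_to_eq0 K z : K z -> dist_to K z = 0.
Proof.
move=> Kz; apply/eqP; rewrite eq_le dist_to_ge0; last by exists z.
by rewrite (le_trans (dist_to_le z Kz))// subrr normr0.
Qed.

End Distance.

(** * Calculus with densities: change of variables and null preimages *)

Section Toolbox.
Context {R : realType}.
Notation mu := (@lebesgue_measure R).
Implicit Types (f g h k phi : R -> R) (a b x y L M B m : R).

Lemma lebesgue_itv_fin x y : (mu `[x, y]%classic < +oo)%E.
Proof. by rewrite /= lebesgue_measure_itv/=; case: ifP => // _; rewrite -EFinB ltry. Qed.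

Lemma density_local a b f g L h k M (O : set R) :
  density a b f g L -> density a b h k M ->
  (forall t, a < t -> t < b -> O t -> exists c, \forall z \near t, f z = h z + c) ->
  {ae mu, forall x, a < x -> x < b -> O x -> g x = k x}.
Proof.
move=> [_ _ _ Df] [_ _ _ Dh] H.
apply: ae_imply (ae_conj Df Dh) => x [Hf Hh] ax xb Ox.
have [df <-] := Hf ax xb; have [dh <-] := Hh ax xb.
have [c fh] := H x ax xb Ox.
rewrite !derive1E; apply: derive_val.
have dhc : is_derive x 1 (fun z => h z + c) ('D_1 h x).
  have := is_deriveD (DeriveDef dh erefl) (is_derive_cst c x 1).
  by rewrite addr0.
by apply: near_eq_is_derive dhc; apply: filterS fh => z ->.
Qed.

Lemma null_integrand a b k M : measurable_fun setT k -> (forall t, `|k t| <= M) ->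
  (forall x y, a <= x -> x <= y -> y <= b -> \int[mu]_(t in `[x, y]) k t = 0) ->
  {ae mu, forall x, a < x -> x < b -> k x = 0}.
Proof.
(* Cut off outside [a, b], the function is integrable on the whole line and Lebesgue differentiation
   applies to its primitive, which vanishes on [a, b]. *)
move=> mk kM k0; pose kab t := k t * \1_(`[a, b]%classic) t.
have kE t : a <= t -> t <= b -> kab t = k t.
  by move=> at_ tb; rewrite /kab indicE mem_set ?mulr1//= in_itv/= at_.
have mkab : measurable_fun setT kab.
  by apply: measurable_funM => //; exact: measurable_indic.
have ikab : mu.-integrable setT (EFin \o kab).
  have -> : kab = k \_ `[a, b].
    by apply/funext => t; rewrite patch_indic.
  rewrite -restrict_EFin; apply: (iffLR (integrable_mkcond _ _)) => //.
  exact: bounded_integrable mk kM.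
have iy y : mu.-integrable [set` Interval (BLeft a) (BRight y)] (EFin \o kab).
  by apply: integrableS ikab => //; exact: measurable_itv.
have lk : locally_integrable [set: R] kab.
  by have := integrable_locally measurableT ikab; rewrite patch_setT.
apply: ae_imply (FTC1 iy lk) => x H ax xb.
have [] := H ax; set F := (fun x : R => _) => dF dFE.
rewrite -kE ?ltW// -dFE derive1E; apply: derive_val.
apply: (@near_eq_is_derive _ _ _ (cst 0)) => //.
  have : x \in `]a, b[ by rewrite in_itv/= ax.
  move/near_in_itvoo; apply: filterS => z; rewrite in_itv/= => /andP[az zb].
  rewrite /F -(k0 a z) ?lexx ?ltW//; apply: eq_Rintegral => t.
  by rewrite inE/= in_itv/= => /andP[at_ tz]; rewrite kE// (le_trans tz (ltW zb)).
Qed.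

Lemma lip_mul f h L M B : 0 <= L -> 0 <= M -> lip L f -> lip M h ->
  (forall x, `|f x| <= B) -> (forall x, `|h x| <= B) ->
  lip (B * (L + M)) (f \* h).
Proof.
move=> L0 M0 lf lh fB hB x y.
have -> : (f \* h) x - (f \* h) y = (f x - f y) * h x + f y * (h x - h y).
  by rewrite /=; ring.
apply: (le_trans (ler_normD _ _)); rewrite !normrM.
rewrite mulrDr mulrDl; apply: lerD.
  rewrite [B * L]mulrC -mulrA [B * _]mulrC mulrA; apply: ler_pM => //; exact: lf.
by rewrite -mulrA; apply: ler_pM => //; exact: lh.
Qed.

Lemma density_ae f g k L a b : density a b f g L ->
  {ae mu, forall x, a < x -> x < b -> derivable f x 1 -> derive1 f x = k x} ->
  forall x y, a <= x -> x <= y -> y <= b -> f y - f x = \int[mu]_(t in `[x, y]) k t.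
Proof.
move=> [mg gL gE gD] kD x y ax xy yb; rewrite gE//; apply: Rintegral_ae ax yb.
apply: ae_imply (ae_conj kD gD) => z [H1 H2] az zb.
by have [dz <-] := H2 az zb; exact: H1.
Qed.

(** Change of variables along a path that may go back and forth: a primitive of [phi] composed with
    [f] is Lipschitz, hence the integral of its derivative, which the chain rule gives almost
    everywhere. *)
Lemma density_chain a b f g L phi M m : 0 <= L -> a <= b ->
  density a b f g L -> lip L f -> (forall t, m < f t) ->
  continuous phi -> (forall z, `|phi z| <= M) ->
  forall x y, a <= x -> x <= y -> y <= b ->
  \int[mu]_(z in `[m, f y]) phi z - \int[mu]_(z in `[m, f x]) phi z =
  \int[mu]_(t in `[x, y]) (phi (f t) * g t).
Proof.
move=> L0 ab Df lf mf cphi phiM.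
have M0 : 0 <= M by apply: le_trans (phiM 0).
have mphi : measurable_fun setT phi by exact: continuous_measurable_fun.
pose P z := \int[mu]_(t in `[m, z]) phi t.
have iphi z : mu.-integrable `[m, z] (EFin \o phi) by exact: bounded_integrable phiM.
have PB u v : m <= u -> u <= v -> `|P v - P u| <= M * (v - u).
  move=> mu_ uv; rewrite /P Rintegral_itvB ?bnd_simp//.
  have ib : mu.-integrable `]u, v] (EFin \o phi).
    apply: integrableS (iphi v) => // z; rewrite /= !in_itv/= => /andP[uz ->].
    by rewrite (le_trans mu_ (ltW uz)).
  apply: (le_trans (le_normr_Rintegral _ ib)) => //.
  have icst : mu.-integrable `]u, v] (EFin \o cst M).
    have : mu.-integrable `[u, v] (EFin \o cst M).
      by apply: (@bounded_integrable _ _ _ _ `|M|).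
    by apply: integrableS => // z; rewrite /= !in_itv/= => /andP[/ltW-> ->].
  apply: (@le_trans _ _ (\int[mu]_(t in `]u, v]) cst M t)).
    apply: le_Rintegral => //.
    exact: integrable_norm.
  rewrite Rintegral_cst//= lebesgue_measure_itv/= lte_fin.
  case: ltP => [_|vu] /=; first by [].
  by rewrite mulr0 mulr_ge0// subr_ge0.
have lP : lip (M * L) (P \o f).
  move=> x y /=; wlog fxy : x y / f x <= f y.
    by move=> H; have [/H//|/ltW/H] := leP (f x) (f y); rewrite distrC [X in _ <= _ * X]distrC.
  rewrite distrC; apply: (le_trans (PB _ _ (ltW (mf x)) fxy)).
  rewrite -mulrA ler_wpM2l//; apply: le_trans (lf x y).
  by rewrite distrC ler_norm.
have [|p Dp] := lip_density ab _ lP; first by rewrite mulr_ge0.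
apply: (density_ae Dp); case: Df => _ _ _; apply: ae_imply => z H az zb _.
have [df <-] := H az zb.
have [dP PE] : derivable P (f z) 1 /\ derive1 P (f z) = phi (f z).
  apply: (@continuous_FTC1 _ phi (BLeft m) _ (f z + 1)) => //; first by rewrite ltrDl.
  by rewrite /= lte_fin mf.
  exact: cphi.
rewrite !derive1E in PE *; rewrite -PE; apply: derive_val.
exact: (is_derive1_comp (DeriveDef dP erefl) (DeriveDef df erefl)).
Qed.

Lemma null_preimage a b f g L B (K : set R) : 0 <= L -> a <= b ->
  density a b f g L -> lip L f -> (forall t, `|f t| <= B) ->
  closed K -> mu K = 0%E ->
  {ae mu, forall x, a < x -> x < b -> K (f x) -> g x = 0}.
Proof.
move=> L0 ab Df lf fB cK K0.
have [KE|/set0P Kn] := eqVneq K set0.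
  by apply: aeW => x _ _; rewrite KE.
pose phi n z : R := Num.max 0 (1 - n%:R * dist_to K z).
have phi01 n z : 0 <= phi n z <= 1.
  rewrite /phi le_max lexx ge_max ler01 /= lerBlDl lerDr mulr_ge0//.
  exact: dist_to_ge0.
have cphi n : continuous (phi n).
  move=> z; apply: (@continuous_max _ _ (cst 0) (fun z => 1 - n%:R * dist_to K z)).
    exact: cst_continuous.
  apply: cvgB; first exact: cvg_cst.
  by apply: cvgMr; exact: (lip_continuous (dist_to_lip Kn)).
have phiK z : phi n z @[n --> \oo] --> (\1_K z : R).
  rewrite indicE; have [Kz|Kz] := pselect (K z).
    rewrite mem_set//; rewrite (_ : (fun n => _) = cst 1); first exact: cvg_cst.
    apply/funext => n; rewrite /phi dist_to_eq0// mulr0 subr0.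
    by apply/max_idPr.
  rewrite memNset//; apply: cvg_near_cst.
  have d0 := dist_to_gt0 cK Kz Kn.
  near=> n; apply/max_idPl; rewrite subr_le0 -ler_pdivrMr//.
  by near: n; exact: nbhs_infty_ger.
have mg : measurable_fun setT g by case: Df.
have gL t : `|g t| <= L by case: Df.
have mf : measurable_fun setT f.
  exact: continuous_measurable_fun (lip_continuous lf).
have mK : measurable K by exact: closed_measurable.
have mk : measurable_fun setT (fun t => \1_K (f t) * g t).
  apply: measurable_funM => //.
  have mi : measurable_fun setT (\1_K : R -> R) by exact: measurable_indic.
  exact: measurableT_comp mi mf.
apply: ae_imply (null_integrand (M := L) mk _ _).
- move=> x H ax xb Kfx; have := H ax xb.
  by rewrite indicE mem_set// mul1r.
- move=> t; rewrite normrM -[leRHS]mul1r ler_pM// indicE.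
  by case: (_ \in _); rewrite ?normr1 ?normr0.
move=> x y ax xy yb; pose m := - B - 1.
have mf' t : m < f t by have := fB t; rewrite ler_norml /m => /andP[]; lra.
have C1 := @bounded_cvg_Rintegral _ _ R mu `[x, y]%classic
  (fun n t => phi n (f t) * g t) (fun t => \1_K (f t) * g t) L.
have {}C1 : \int[mu]_(t in `[x, y]) (phi n (f t) * g t) @[n --> \oo] -->
    \int[mu]_(t in `[x, y]) (\1_K (f t) * g t).
  apply: C1 => //.
  - exact: lebesgue_itv_fin.
  - move=> n; apply: measurable_funTS; apply: measurable_funM => //.
    apply: (@measurableT_comp _ _ _ _ _ _ (phi n)) => //.
    exact: continuous_measurable_fun.
  - move=> n t _; rewrite normrM -[leRHS]mul1r ler_pM//.
    by have /andP[p0 p1] := phi01 n (f t); rewrite ger0_norm.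
  - by move=> t _; apply: cvgM; [exact: phiK|exact: cvg_cst].
have C2 v : \int[mu]_(t in `[m, v]) phi n t @[n --> \oo] --> 0.
  have -> : 0 = \int[mu]_(t in `[m, v]) (\1_K t : R).
    rewrite /Rintegral (@integral_off_null _ _ _ mu K _ _ (cst 0%E))// ?integral0//.
    by move=> t _ Kt; rewrite indicE memNset.
  apply: (@bounded_cvg_Rintegral _ _ _ _ _ _ _ 1) => //.
  - exact: lebesgue_itv_fin.
  - by move=> n; apply: measurable_funTS; exact: continuous_measurable_fun.
  - by move=> n t _; have /andP[p0 p1] := phi01 n t; rewrite ger0_norm.
apply: (cvg_unique _ C1) => //.
rewrite (_ : (fun n => _) = fun n => \int[mu]_(z in `[m, f y]) phi n z - \int[mu]_(z in `[m, f x]) phi n z).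
  by have := cvgB (C2 (f y)) (C2 (f x)); rewrite subrr; exact.
apply/funext => n; rewrite (density_chain (M := 1) L0 ab Df lf mf' (cphi n))//.
by move=> z; have /andP[p0 p1] := phi01 n z; rewrite ger0_norm.
Unshelve. all: by end_near. Qed.

End Toolbox.

(** * Slicing a path by the levels of its parameter *)

Section Levels.
Context {R : realType}.
Notation mu := (@lebesgue_measure R).
Implicit Types (f g h k d gam : R -> R) (a b x y L M B C m : R).

Definition above d y : set R := [set t | y < d t].

Lemma open_above d y : continuous d -> open (above d y).
Proof.
move=> cd; rewrite (_ : above d y = d @^-1` `]y, +oo[); last first.
  by apply/seteqP; split => t /=; rewrite in_itv/= andbT.
by apply: open_comp => // t _; exact: cd.
Qed.

Lemma measurable_above d y : continuous d -> measurable (above d y).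
Proof. by move=> cd; apply: open_measurable; exact: open_above. Qed.

Lemma indic_bound (A : set R) x : `|\1_A x : R| <= 1.
Proof. by rewrite indicE; case: (_ \in _); rewrite ?normr1 ?normr0. Qed.

Lemma mul_bound (u v M N : R) : `|u| <= M -> `|v| <= N -> `|u * v| <= M * N.
Proof. by move=> uM vN; rewrite normrM ler_pM. Qed.

(* Truncating the parameter at a level [y] keeps the path Lipschitz: a passage
   below the level starts and ends at the same point. *)
Lemma lip_truncate d gam f L y : continuous d -> lip L f ->
  (forall t, f t = gam (d t)) -> lip L (fun t => gam (Num.max (d t) y)).
Proof.
move=> cd lf fE.
have L0 : 0 <= L.
  have := lf 0 1; rewrite sub0r normrN1 mulr1; exact: le_trans.
have key s t : d s <= y -> y < d t -> `|gam y - f t| <= L * `|s - t|.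
  move=> sy yt.
  have [u dus ust] : exists2 u, d u = y & `|u - t| <= `|s - t|.
    have cw u v : {within `[u, v], continuous d}.
      by apply: continuous_subspaceT.
    have [st|/ltW ts] := leP s t.
      have [|u + duy] := IVT st (cw s t) (v := y).
        by rewrite ge_min sy /= le_max (ltW yt) orbT.
      rewrite in_itv/= => /andP[su ut]; exists u => //.
      by rewrite !ler0_norm ?subr_le0//; lra.
    have [|u + duy] := IVT ts (cw t s) (v := y).
      by rewrite ge_min sy orbT /= le_max (ltW yt).
    rewrite in_itv/= => /andP[su ut]; exists u => //.
    by rewrite !ger0_norm ?subr_ge0//; lra.
  rewrite -dus -fE; apply: (le_trans (lf u t)).
  by rewrite ler_wpM2l.
move=> s t; have [ds|ds] := leP (d s) y; have [dt|dt] := leP (d t) y.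
- by rewrite subrr normr0 mulr_ge0.
- by rewrite -fE; exact: key.
- by rewrite -fE distrC [`|s - t|]distrC; exact: key.
- by rewrite -!fE; exact: lf.
Qed.

(** The density of the truncated path is [g] where d > y, since the two paths agree there locally.
    Where d <= y the truncated path sits at the single value [gam y], so its density vanishes there
    almost everywhere. *)
Lemma level_density a b d gam f g L B y : 0 <= L -> a <= b -> continuous d ->
  lip L f -> (forall t, `|f t| <= B) -> density a b f g L ->
  (forall t, f t = gam (d t)) ->
  forall x z, a <= x -> x <= z -> z <= b ->
  \int[mu]_(t in `[x, z]) (\1_(above d y) t * g t) =
  gam (Num.max (d z) y) - gam (Num.max (d x) y).
Proof.
move=> L0 ab cd lf fB Df fE x z ax xz zb.
pose c t := gam (Num.max (d t) y).
have lc : lip L c by exact: lip_truncate lf fE.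
have [p Dp] := lip_density ab L0 lc.
case: (Dp) => _ _ pE _; rewrite -/(c z) -/(c x) pE//; apply: Rintegral_ae ax zb.
have cB t : `|c t| <= Num.max B `|gam y|.
  rewrite /c le_max; have [_|_] := leP (d t) y; rewrite ?lexx ?orbT//.
  by rewrite -fE fB.
have cK : closed [set gam y] by apply: compact_closed; [exact: Rhausdorff|exact: compact_set1].
have H1 := null_preimage L0 ab Dp lc cB cK (lebesgue_measure_set1 _).
have H2 : {ae mu, forall x, a < x -> x < b -> above d y x -> p x = g x}.
  apply: (density_local Dp Df) => t at_ tb dt; exists 0.
  have : nbhs t (above d y) by apply: open_nbhs_nbhs; split => //; exact: open_above.
  apply: filterS => s ds; rewrite addr0 /c fE.
  by congr gam; apply/max_idPl; exact: ltW.
apply: ae_imply (ae_conj H1 H2) => t [h1 h2] at_ tb.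
rewrite indicE; have [dt|dt] := ltP y (d t).
  by rewrite mem_set// mul1r h2.
rewrite memNset /above/= ?mul0r; last by apply/negP; rewrite -leNgt.
rewrite h1//= /c; congr gam; exact/max_idPr.
Qed.

(** The pairs at which [h] differs by at least [e] form a compact set on which [d] takes distinct
    values, so the difference of [d] has a positive lower bound there. *)
Lemma level_uniform a b d h : continuous d -> continuous h ->
  (forall s t, s \in `[a, b] -> t \in `[a, b] -> d s = d t -> h s = h t) ->
  forall e, 0 < e -> exists2 n, 0 < n & forall s t, s \in `[a, b] -> t \in `[a, b] ->
    `|d s - d t| < n -> `|h s - h t| < e.
Proof.
move=> cd ch dh e e0.
pose A := [set p : R * R | e <= `|h p.1 - h p.2|].
pose I := `[a, b]%classic `*` `[a, b]%classic.
have cfst (u : R -> R) : continuous u -> continuous (fun p : R * R => u p.1).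
  by move=> cu p; apply: (@continuous_comp _ _ _ fst u); [exact: cvg_fst|exact: cu].
have csnd (u : R -> R) : continuous u -> continuous (fun p : R * R => u p.2).
  by move=> cu p; apply: (@continuous_comp _ _ _ snd u); [exact: cvg_snd|exact: cu].
have cD (u : R -> R) : continuous u -> continuous (fun p : R * R => `|u p.1 - u p.2|).
  move=> cu p; apply: (@cvg_norm _ R^o); apply: cvgB; [exact: cfst|exact: csnd].
have cI : compact I by apply: compact_setX; exact: segment_compact.
have clA : closed A.
  have -> : A = (fun p : R * R => `|h p.1 - h p.2|) @^-1` `[e, +oo[.
    by apply/seteqP; split => p; rewrite /A/= in_itv/= andbT.
  by apply: preimage_closed => [p _|]; [exact: cD|exact: interval_closed].
have cAI : compact (I `&` A) by exact: compact_closedI.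
pose E := (fun p : R * R => `|d p.1 - d p.2|) @` (I `&` A).
have cE : compact E.
  by apply: continuous_compact => //; apply: continuous_subspaceT; exact: cD.
have clE : closed E by apply: compact_closed => //; exact: Rhausdorff.
have E0 : ~ E 0.
  move=> [[s t] [[/= sI tI] Ast]] /eqP; rewrite normr_eq0 subr_eq0 => /eqP dst.
  by move: Ast; rewrite /A/= (dh s t)// subrr normr0 leNgt e0.
have : nbhs (0 : R) (~` E).
  by apply: open_nbhs_nbhs; split => //; exact: closed_openC.
move=> /nbhs_ballP[n /= n0 nE]; exists n => // s t sI tI dn.
rewrite ltNge; apply/negP => hst.
apply: (nE `|d s - d t|); first by rewrite /ball/= sub0r normrN normr_id.
by exists (s, t).
Qed.

(** On a thin layer of levels [h] is nearly constant and [g] integrates to 0, because the truncated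
    path returns to its starting point. Summing over the layers bounds the integral by a small
    multiple of the integral of |g|. *)
Lemma level_zero a b d gam f g h L B C : 0 <= L -> a <= b -> continuous d ->
  lip L f -> (forall t, `|f t| <= B) -> density a b f g L ->
  (forall t, f t = gam (d t)) ->
  continuous h -> (forall t, `|h t| <= C) ->
  (forall s t, s \in `[a, b] -> t \in `[a, b] -> d s = d t -> h s = h t) ->
  forall x z, a <= x -> x <= z -> z <= b -> d x = d z ->
  \int[mu]_(t in `[x, z]) (h t * g t) = 0.
Proof.
move=> L0 ab cd lf fB Df fE ch hC dh x z ax xz zb dxz.
have C0 : 0 <= C by exact: le_trans (hC 0).
have [mg gL _ _] := Df.
have mh : measurable_fun setT h by exact: continuous_measurable_fun.
have mA y : measurable_fun setT (\1_(above d y) : R -> R).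
  by apply: measurable_indic; exact: measurable_above.
pose cell y y' t : R := \1_(above d y) t - \1_(above d y') t.
have cell01 y y' t : y <= y' -> (cell y y' t = 1 /\ y < d t <= y') \/ cell y y' t = 0.
  move=> yy; rewrite /cell !indicE /above; have [dt|dt] := ltP y' (d t).
    by right; rewrite !mem_set ?subrr//= (le_lt_trans yy).
  have [dt'|dt'] := ltP y (d t).
    left; rewrite mem_set// memNset ?subr0//=.
    by apply/negP; rewrite -leNgt.
  by right; rewrite !memNset ?subrr//=; apply/negP; rewrite -leNgt// (le_trans dt').
have mcell y y' : measurable_fun setT (cell y y') by exact: measurable_funB.
have int (q : R -> R) N : measurable_fun setT q -> (forall t, `|q t| <= N) ->
  mu.-integrable `[x, z] (EFin \o q) by exact: bounded_integrable.
have cellB y y' t : `|cell y y' t| <= 2.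
  apply: (le_trans (ler_normB _ _)).
  by have := indic_bound (above d y) t; have := indic_bound (above d y') t; lra.
have mhg : measurable_fun setT (fun t => h t * g t) by exact: measurable_funM.
have cell0 y y' : \int[mu]_(t in `[x, z]) (cell y y' t * g t) = 0.
  under eq_Rintegral do rewrite /cell mulrBl.
  rewrite RintegralB//.
  - by rewrite !(level_density _ L0 ab cd lf fB Df fE)// dxz !subrr.
  - apply: (int _ (1 * L)); first exact: measurable_funM.
    by move=> t; apply: mul_bound => //; exact: indic_bound.
  - apply: (int _ (1 * L)); first exact: measurable_funM.
    by move=> t; apply: mul_bound => //; exact: indic_bound.
(* The parts of the integral and of the total variation that lie above level y; a layer contributes
   a difference of two values. *)
pose E y := \int[mu]_(t in `[x, z]) (\1_(above d y) t * (h t * g t)).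
pose V y := \int[mu]_(t in `[x, z]) (\1_(above d y) t * `|g t|).
have mng : measurable_fun setT (fun t => `|g t|) by exact: measurableT_comp.
have EB y y' : E y - E y' = \int[mu]_(t in `[x, z]) (cell y y' t * (h t * g t)).
  under [RHS]eq_Rintegral do rewrite /cell mulrBl.
  rewrite RintegralB//.
  - apply: (int _ (1 * (C * L))); first exact: measurable_funM.
    by move=> t; apply: mul_bound; [exact: indic_bound|exact: mul_bound].
  - apply: (int _ (1 * (C * L))); first exact: measurable_funM.
    by move=> t; apply: mul_bound; [exact: indic_bound|exact: mul_bound].
have VB y y' : V y - V y' = \int[mu]_(t in `[x, z]) (cell y y' t * `|g t|).
  under [RHS]eq_Rintegral do rewrite /cell mulrBl.
  rewrite RintegralB//.
  - apply: (int _ (1 * L)); first exact: measurable_funM.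
    by move=> t; apply: mul_bound; [exact: indic_bound|rewrite normr_id].
  - apply: (int _ (1 * L)); first exact: measurable_funM.
    by move=> t; apply: mul_bound; [exact: indic_bound|rewrite normr_id].
suff key e : 0 < e -> `|\int[mu]_(t in `[x, z]) (h t * g t)| <= e * (L * (z - x)).
  apply/eqP; rewrite -normr_le0; apply/ler_addgt0Pl => e e0; rewrite addr0.
  have N0 : 0 < L * (z - x) + 1 by rewrite ltr_wpDl// mulr_ge0// subr_ge0.
  apply: (le_trans (key (e / (L * (z - x) + 1)) _)); first by rewrite divr_gt0.
  rewrite -mulrA ler_piMr ?(ltW e0)// mulrC ler_pdivrMr// mul1r.
  by rewrite lerDl.
move=> e0.
have [n n0 nE] := level_uniform cd ch dh e0.
have step y y' : y <= y' -> y' - y < n -> `|E y - E y'| <= e * (V y - V y').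
  move=> yy yn; rewrite EB VB.
  have [[tau tauI tauc]|none] :=
      pselect (exists2 tau, tau \in `[a, b] & y < d tau <= y').
    (* Subtracting a value that [h] takes in the layer is free, as [g] has integral 0 over the
       layer. *)
    have -> : \int[mu]_(t in `[x, z]) (cell y y' t * (h t * g t)) =
        \int[mu]_(t in `[x, z]) (cell y y' t * ((h t - h tau) * g t)).
      transitivity (\int[mu]_(t in `[x, z]) (cell y y' t * ((h t - h tau) * g t) +
          h tau * (cell y y' t * g t))).
        by apply: eq_Rintegral => t _; ring.
      rewrite RintegralD//.
      - rewrite RintegralZl// ?cell0 ?mulr0 ?addr0//.
        apply: (int _ (2 * L)); first exact: measurable_funM.
        by move=> t; exact: mul_bound.
      - apply: (int _ (2 * ((C + C) * L))).
          apply: measurable_funM => //; apply: measurable_funM => //.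
          by apply: measurable_funB => //; exact: measurable_cst.
        move=> t; apply: mul_bound => //; apply: mul_bound => //.
        by rewrite (le_trans (ler_normB _ _))// lerD.
      - apply: (int _ (C * (2 * L))).
          apply: measurable_funM; first exact: measurable_cst.
          exact: measurable_funM.
        by move=> t; apply: mul_bound => //; exact: mul_bound.
    have iL : mu.-integrable `[x, z] (EFin \o (fun t => cell y y' t * ((h t - h tau) * g t))).
      apply: (int _ (2 * ((C + C) * L))).
        apply: measurable_funM => //; apply: measurable_funM => //.
        by apply: measurable_funB => //; exact: measurable_cst.
      move=> t; apply: mul_bound => //; apply: mul_bound => //.
      by rewrite (le_trans (ler_normB _ _))// lerD.
    have iR : mu.-integrable `[x, z] (EFin \o (fun t => cell y y' t * `|g t|)).
      apply: (int _ (2 * L)); first exact: measurable_funM.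
      by move=> t; apply: mul_bound => //; rewrite normr_id.
    apply: (le_trans (le_normr_Rintegral _ iL)) => //.
    rewrite -RintegralZl//; apply: le_Rintegral => //.
    - exact: integrable_norm.
    - apply: (int _ (e * (2 * L))).
        apply: measurable_funM; first exact: measurable_cst.
        exact: measurable_funM.
      move=> t; apply: mul_bound; first by rewrite ger0_norm// ltW.
      by apply: mul_bound => //; rewrite normr_id.
    move=> t; rewrite /= in_itv/= => /andP[xt tz].
    have [[-> /andP[h1 h2]]|->] := cell01 y y' t yy; last by rewrite !mul0r normr0 mulr0.
    rewrite !mul1r normrM ler_wpM2r// ltW// nE//.
      by rewrite in_itv/= (le_trans ax xt) (le_trans tz zb).
    case/andP: tauc => h3 h4; rewrite ltr_norml.
    by clear -h1 h2 h3 h4 yn; apply/andP; split; lra.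
  have c0 t : t \in `[x, z]%classic -> cell y y' t = 0.
    rewrite inE/= in_itv/= => /andP[xt tz].
    have [[_ h1]|//] := cell01 y y' t yy; exfalso; apply: none; exists t => //.
    by rewrite in_itv/= (le_trans ax xt) (le_trans tz zb).
  rewrite (@eq_Rintegral _ _ _ _ _ (cst 0)); last by move=> t tI; rewrite c0//= mul0r.
  rewrite [X in e * X](@eq_Rintegral _ _ _ _ _ (cst 0)); last by move=> t tI; rewrite c0//= mul0r.
  by rewrite Rintegral_cst// mul0r normr0 mulr0.
have [m mP] : exists m, forall t, t \in `[x, z] -> m < d t.
  have [c _ cP] := EVT_min xz (continuous_subspaceT cd (A := `[x, z]%classic)).
  by exists (d c - 1) => t /cP; lra.
have [M MP] : exists M, forall t, t \in `[x, z] -> d t <= M.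
  have [c _ cP] := EVT_max xz (continuous_subspaceT cd (A := `[x, z]%classic)).
  by exists (d c).
(* Layers of thickness n / 2, starting below all values of [d] on [x, z], are stacked until they
   pass the largest one. *)
have iter N : `|E m - E (m + N%:R * (n / 2))| <= e * (V m - V (m + N%:R * (n / 2))).
  elim: N => [|N IH]; first by rewrite mul0r addr0 !subrr normr0 mulr0.
  have -> : m + N.+1%:R * (n / 2) = m + N%:R * (n / 2) + n / 2 by rewrite -natr1; ring.
  set y := m + N%:R * (n / 2) in IH *.
  have st : `|E y - E (y + n / 2)| <= e * (V y - V (y + n / 2)) by apply: step; lra.
  have -> : E m - E (y + n / 2) = (E m - E y) + (E y - E (y + n / 2)) by ring.
  have -> : V m - V (y + n / 2) = (V m - V y) + (V y - V (y + n / 2)) by ring.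
  by rewrite mulrDr (le_trans (ler_normD _ _))// lerD.
have [N NP] : exists N : nat, M <= m + N%:R * (n / 2).
  have [N NP] : exists N : nat, (M - m) / (n / 2) <= N%:R.
    by exists (Num.truncn ((M - m) / (n / 2))).+1; exact/ltW/truncnS_gt.
  by exists N; move: NP; rewrite ler_pdivrMr ?divr_gt0//; lra.
have above0 t : t \in `[x, z]%classic -> \1_(above d (m + N%:R * (n / 2))) t = 0 :> R.
  rewrite inE => tI; rewrite indicE memNset//= /above/=; apply/negP; rewrite -leNgt.
  by rewrite (le_trans _ NP)// MP.
have above1 t : t \in `[x, z]%classic -> \1_(above d m) t = 1 :> R.
  by rewrite inE => tI; rewrite indicE mem_set//= /above/= mP.
have EmE : E m = \int[mu]_(t in `[x, z]) (h t * g t).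
  by apply: eq_Rintegral => t tI; rewrite above1// mul1r.
have VmE : V m = \int[mu]_(t in `[x, z]) `|g t|.
  by apply: eq_Rintegral => t tI; rewrite above1// mul1r.
have z0 q : \int[mu]_(t in `[x, z]) (\1_(above d (m + N%:R * (n / 2))) t * q t) = 0.
  rewrite (@eq_Rintegral _ _ _ _ _ (cst 0)) ?Rintegral_cst ?mul0r// => t tI.
  by rewrite above0// mul0r.
have := iter N; rewrite EmE VmE /E /V !z0 !subr0 => H; apply: (le_trans H).
rewrite ler_wpM2l ?(ltW e0)//.
apply: (@le_trans _ _ (\int[mu]_(t in `[x, z]) cst L t)).
  apply: le_Rintegral => //.
  - by apply: (int _ L) => // t; rewrite normr_id.
  - by apply: (int _ `|L|).
rewrite Rintegral_cst//= lebesgue_measure_itv/= lte_fin.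
case: ltP => [_|zx] /=; first by [].
by rewrite mulr0 mulr_ge0// subr_ge0.
Qed.

End Levels.

(** * Iterated integrals and moments *)

Section Iterated.
Context {R : realType}.
Notation mu := (@lebesgue_measure R).
Implicit Types (h k d : R -> R) (a b x y t L M N B C m : R).

Lemma Rintegral_itv_bound k N x y : x <= y -> measurable_fun setT k ->
  (forall t, `|k t| <= N) -> `|\int[mu]_(t in `[x, y]) k t| <= N * (y - x).
Proof.
move=> xy mk kN; have N0 : 0 <= N by exact: le_trans (kN 0).
have ik : mu.-integrable `[x, y] (EFin \o k) by exact: bounded_integrable kN.
apply: (le_trans (le_normr_Rintegral _ ik)) => //.
apply: (@le_trans _ _ (\int[mu]_(t in `[x, y]) cst N t)).
  apply: le_Rintegral => //; first exact: integrable_norm.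
  by apply: (@bounded_integrable _ _ _ _ `|N|).
rewrite Rintegral_cst//= lebesgue_measure_itv/= lte_fin.
case: ltP => [_|yx] /=; first by [].
by rewrite mulr0 mulr_ge0// subr_ge0.
Qed.

Lemma Rintegral_itv_split k N x y z : x <= y -> y <= z -> measurable_fun setT k ->
  (forall t, `|k t| <= N) ->
  \int[mu]_(t in `[x, z]) k t =
  \int[mu]_(t in `[x, y]) k t + \int[mu]_(t in `[y, z]) k t.
Proof.
move=> xy yz mk kN.
have ik u v : mu.-integrable `[u, v] (EFin \o k) by exact: bounded_integrable kN.
have ik' : mu.-integrable `]y, z] (EFin \o k).
  by apply: integrableS (ik y z) => // t; rewrite /= !in_itv/= => /andP[/ltW-> ->].
rewrite -(@Rintegral_itv_obnd_cbnd _ y (BRight z))//.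
by rewrite -(@Rintegral_itvB _ k (BLeft x) (BRight z) y)// addrC subrK.
Qed.

Lemma primitive_lip a b k N : a <= b -> measurable_fun setT k ->
  (forall t, `|k t| <= N) ->
  lip N (fun t => \int[mu]_(s in `[clamp a b t, b]) k s).
Proof.
move=> ab mk kN x y; have N0 : 0 <= N by exact: le_trans (kN 0).
wlog xy : x y / x <= y => [H|].
  by have [/H//|/ltW/H] := leP x y; rewrite distrC [X in _ <= _ * X]distrC.
have cxy := clamp_mono a b xy.
have [/andP[ax xb] /andP[ay yb]] := (clamp_itv x ab, clamp_itv y ab).
rewrite (Rintegral_itv_split cxy yb mk kN) addrK.
apply: (le_trans (Rintegral_itv_bound cxy mk kN)).
by rewrite ler_wpM2l// distrC ger0_norm ?subr_ge0// clampB.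
Qed.

(** The recursion of [iterated_integral], meant for everywhere bounded densities in place of
    [derive1]. *)
Fixpoint iterg (g : 'I_2 -> R -> R) b (w : seq 'I_2) t : R :=
  if w is i :: w' then \int[mu]_(s in `[t, b]) (g i s * iterg g b w' s) else 1.

Lemma iterated_integralE a b (f g : 'I_2 -> R -> R) w t : a <= t ->
  (forall i, {ae mu, forall x, a < x -> x < b -> derive1 (f i) x = g i x}) ->
  iterated_integral f b w t = iterg g b w t.
Proof.
move=> at_ fg; elim: w t at_ => [//|i w IH] t at_ /=.
apply: (@Rintegral_ae _ a b) => //.
by apply: ae_imply (fg i) => s H as_ sb; rewrite H// IH// ltW.
Qed.

Section Fixed.
Variables (a b L B : R) (f g : 'I_2 -> R -> R).
Hypotheses (ab : a <= b) (L0 : 0 <= L) (lf : forall i, lip L (f i)).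
Hypotheses (fB : forall i t, `|f i t| <= B)
  (Df : forall i, density a b (f i) (g i) L).

Let mg i : measurable_fun setT (g i). Proof. by case: (Df i). Qed.
Let gL i t : `|g i t| <= L. Proof. by case: (Df i). Qed.

Lemma iterg_lip w : exists2 M, lip M (fun t => iterg g b w (clamp a b t)) &
  exists C, forall t, `|iterg g b w (clamp a b t)| <= C.
Proof.
elim: w => [|i w [M lM [C hC]]].
  exists 0; first by move=> x y; rewrite subrr normr0 mul0r.
  by exists 1 => t; rewrite normr1.
pose k s := g i s * iterg g b w (clamp a b s).
have mk : measurable_fun setT k.
  by apply: measurable_funM => //; exact: continuous_measurable_fun (lip_continuous lM).
have kN s : `|k s| <= L * C by exact: mul_bound.
have E t : iterg g b (i :: w) (clamp a b t) = \int[mu]_(s in `[clamp a b t, b]) k s.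
  apply: eq_Rintegral => s; rewrite inE/= in_itv/= => /andP[ts sb].
  by rewrite /k clamp_id// sb (le_trans _ ts)//; case/andP: (clamp_itv t ab).
exists (L * C).
  by under eq_fun do rewrite E; exact: primitive_lip.
exists (L * C * (b - a)) => t; have /andP[at_ tb] := clamp_itv t ab.
rewrite E; apply: (le_trans (Rintegral_itv_bound tb mk kN)).
by rewrite ler_wpM2l ?lerB// (le_trans _ (kN 0)).
Qed.

Lemma iterg_cons_split i w s t : a <= s -> s <= t -> t <= b ->
  iterg g b (i :: w) s = iterg g b (i :: w) t +
    \int[mu]_(u in `[s, t]) (iterg g b w (clamp a b u) * g i u).
Proof.
move=> as_ st tb; have [M lM [C hC]] := iterg_lip w.
pose k s := iterg g b w (clamp a b s) * g i s.
have mk : measurable_fun setT k.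
  by apply: measurable_funM => //; exact: continuous_measurable_fun (lip_continuous lM).
have kN u : `|k u| <= C * L by exact: mul_bound.
have E t' : a <= t' -> iterg g b (i :: w) t' = \int[mu]_(u in `[t', b]) k u.
  move=> at'; apply: eq_Rintegral => u; rewrite inE/= in_itv/= => /andP[tu ub].
  by rewrite /k clamp_id 1?mulrC// ub (le_trans at' tu).
rewrite !E ?(le_trans as_ st)//.
by rewrite (Rintegral_itv_split st tb mk kN) addrC.
Qed.

Lemma iterg_end i w : iterg g b (i :: w) b = 0.
Proof. by rewrite /= set_itv1 Rintegral_set1. Qed.

(** By induction on the word the inner integral depends on the time only through [d]; the
    contribution to the outer integral of a stretch between two times with equal [d] then vanishes
    by [level_zero]. *)
Lemma iterg_level (d : R -> R) (gam : 'I_2 -> R -> R) w s t :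
  continuous d -> (forall i u, f i u = gam i (d u)) ->
  a <= s <= b -> a <= t <= b -> d s = d t ->
  iterg g b w s = iterg g b w t.
Proof.
move=> cd fE; elim: w s t => [//|i w IH] s t sI tI dst.
wlog st : s t sI tI dst / s <= t => [H|].
  by have [/H->//|/ltW/H->] := leP s t.
have [M lM [C hC]] := iterg_lip w.
case/andP: sI => as_ sb; case/andP: tI => at_ tb.
rewrite (iterg_cons_split _ _ as_ st tb).
rewrite (level_zero L0 ab cd (lf i) (fB i) (Df i) (fE i) (lip_continuous lM) hC)//.
  by rewrite addr0.
move=> u v; rewrite !in_itv/= => uI vI duv.
by rewrite !clamp_id//; exact: IH.
Qed.

Lemma iterg_closed (d : R -> R) (gam : 'I_2 -> R -> R) w :
  continuous d -> (forall i u, f i u = gam i (d u)) -> d a = d b ->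
  w != [::] -> iterg g b w a = 0.
Proof.
case: w => [//|i w] cd fE dab _.
by rewrite (iterg_level (i :: w) cd fE _ _ dab) ?iterg_end ?lexx ?ab.
Qed.

Definition iter_span (u : R -> R) := exists c : seq (R * seq 'I_2),
  forall t, a <= t <= b -> u t = \sum_(p <- c) p.1 * iterg g b p.2 t.

Lemma iter_span_cst r : iter_span (cst r).
Proof. by exists [:: (r, [::])] => t _; rewrite big_seq1 /= mulr1. Qed.

Lemma iter_spanD u v : iter_span u -> iter_span v -> iter_span (fun t => u t + v t).
Proof.
move=> [c cE] [c' cE']; exists (c ++ c') => t tI.
by rewrite big_cat/= cE// cE'.
Qed.

Lemma iter_spanZ r u : iter_span u -> iter_span (fun t => r * u t).
Proof.
move=> [c cE]; exists [seq (r * p.1, p.2) | p <- c] => t tI.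
by rewrite big_map cE// big_distrr/=; apply: eq_bigr => p _; rewrite mulrA.
Qed.

Lemma eq_iter_span u v : (forall t, a <= t <= b -> u t = v t) -> iter_span u -> iter_span v.
Proof. by move=> uv [c cE]; exists c => t tI; rewrite -uv// cE. Qed.

Lemma iterg_sum_int i (c : seq (R * seq 'I_2)) t : a <= t <= b ->
  \int[mu]_(s in `[t, b]) ((\sum_(p <- c) p.1 * iterg g b p.2 s) * g i s) =
  \sum_(p <- c) p.1 * iterg g b (i :: p.2) t.
Proof.
move=> /andP[at_ tb].
pose kc c s := (\sum_(p <- c) p.1 * iterg g b p.2 (clamp a b s)) * g i s.
have kcP c' : measurable_fun setT (kc c') /\ exists N, forall s, `|kc c' s| <= N.
  elim: c' => [|[r w] c' [mk [N kN]]].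
    rewrite (_ : kc _ = cst 0); first by split => //; exists 0 => s; rewrite normr0.
    by apply/funext => s; rewrite /kc big_nil mul0r.
  have -> : kc ((r, w) :: c') = fun s => r * iterg g b w (clamp a b s) * g i s + kc c' s.
    by apply/funext => s; rewrite /kc big_cons mulrDl.
  have [M lM [C hC]] := iterg_lip w; split.
    apply: measurable_funD => //; apply: measurable_funM => //.
    apply: measurable_funM => //; exact: continuous_measurable_fun (lip_continuous lM).
  exists (`|r| * C * L + N) => s; apply: (le_trans (ler_normD _ _)).
  by apply: lerD => //; apply: mul_bound => //; exact: mul_bound.
have kcE c' s : s \in `[t, b]%classic ->
    (\sum_(p <- c') p.1 * iterg g b p.2 s) * g i s = kc c' s.
  rewrite inE/= in_itv/= => /andP[ts sb].
  by rewrite /kc; congr (_ * _); apply: eq_bigr => p _; rewrite clamp_id// sb (le_trans at_).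
transitivity (\int[mu]_(s in `[t, b]) kc c s).
  by apply: eq_Rintegral => s; exact: kcE.
have ikc c' : mu.-integrable `[t, b] (EFin \o kc c').
  by have [mk [N kN]] := kcP c'; exact: bounded_integrable kN.
elim: c => [|[r w] c IH].
  rewrite big_nil; transitivity (\int[mu]_(s in `[t, b]) cst (0 : R) s).
    by apply: eq_Rintegral => s _; rewrite /kc big_nil mul0r.
  by rewrite Rintegral_cst ?mul0r.
rewrite big_cons/= -IH.
have kE s : kc ((r, w) :: c) s = r * kc [:: (1, w)] s + kc c s.
  by rewrite /kc big_seq1 big_cons/= mulrDl mul1r mulrA.
transitivity (\int[mu]_(s in `[t, b]) (r * kc [:: (1, w)] s + kc c s)).
  by apply: eq_Rintegral => s _; exact: kE.
rewrite RintegralD//; last first.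
  have [mk [N kN]] := kcP [:: (1, w)].
  apply: (@bounded_integrable _ _ _ _ (`|r| * N)); first exact: measurable_funM.
  by move=> s; exact: mul_bound.
rewrite RintegralZl//; congr (_ * _ + _); apply: eq_Rintegral => s sI.
by rewrite -kcE// big_seq1/= mul1r mulrC.
Qed.

Lemma iter_span_int i u : iter_span u ->
  iter_span (fun t => \int[mu]_(s in `[t, b]) (u s * g i s)).
Proof.
move=> [c cE]; exists [seq (p.1, i :: p.2) | p <- c] => t tI.
rewrite big_map -iterg_sum_int//; case/andP: tI => at_ tb.
apply: eq_Rintegral => s; rewrite inE/= in_itv/= => /andP[ts sb].
by rewrite cE// sb (le_trans at_).
Qed.

Definition tame (u : R -> R) := exists2 M, 0 <= M & lip M u /\ exists C, forall t, `|u t| <= C.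

Lemma tame_mul u v : tame u -> tame v -> tame (u \* v).
Proof.
move=> [M M0 [lu [C uC]]] [N N0 [lv [C' vC]]].
have C0 : 0 <= Num.max C C' by rewrite le_max (le_trans _ (uC 0)).
exists (Num.max C C' * (M + N)); first by rewrite mulr_ge0// addr_ge0.
split.
  by apply: lip_mul => // t; rewrite le_max ?uC ?vC ?orbT.
by exists (C * C') => t; exact: mul_bound.
Qed.

Let tame_f i : tame (f i).
Proof. by exists L => //; split => //; exists B => t; exact: fB. Qed.

Lemma tame_exp u n : tame u -> tame (fun t => u t ^+ n).
Proof.
move=> tu; elim: n => [|n IH].
  exists 0 => //; split; first by move=> x y; rewrite !expr0 subrr normr0 mul0r.
  by exists 1 => t; rewrite expr0 normr1.
by under eq_fun do rewrite exprS; exact: tame_mul.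
Qed.

Variables (o p : 'I_2).

Let pw i j t := f o t ^+ i * f p t ^+ j.

Let pw_tame i j : tame (pw i j).
Proof. by apply: tame_mul; exact: tame_exp. Qed.

Let pw_meas i j : measurable_fun setT (pw i j).
Proof.
by case: (pw_tame i j) => M _ [lM _]; exact: continuous_measurable_fun (lip_continuous lM).
Qed.

Lemma pw_density i j x y : a <= x -> x <= y -> y <= b ->
  pw i j y - pw i j x = \int[mu]_(t in `[x, y])
    (i%:R * pw i.-1 j t * g o t + j%:R * pw i j.-1 t * g p t).
Proof.
have [M M0 [lM _]] := pw_tame i j.
have [q Dq] := lip_density ab M0 lM.
apply: (density_ae Dq); case: (Df o) => _ _ _ Do; case: (Df p) => _ _ _ Dp.
apply: ae_imply (ae_conj Do Dp) => z [H1 H2] az zb _.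
have [d1 <-] := H1 az zb; have [d2 <-] := H2 az zb.
have D1 := is_deriveX i (DeriveDef d1 erefl).
have D2 := is_deriveX j (DeriveDef d2 erefl).
rewrite !derive1E.
have -> : pw i j = (f o ^+ i) * (f p ^+ j).
  by apply/funext => t; rewrite /pw !fctE.
transitivity ((f o ^+ i) z *: ((j%:R * f p z ^+ j.-1) *: 'D_1 (f p) z) +
    (f p ^+ j) z *: ((i%:R * f o z ^+ i.-1) *: 'D_1 (f o) z)).
  by apply: derive_val; exact: is_deriveM.
rewrite /pw /GRing.scale/= !fctE !mulr_natl; ring.
Qed.

(** Induction on the degree: a monomial of positive degree vanishes at [b], so it is minus the
    integral from t to b of its derivative, whose coefficients are monomials of lower degree. *)
Lemma pw_span i j : (forall l, f l b = 0) -> iter_span (pw i j).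
Proof.
move=> fb; move En : (i + j)%N => n; elim: n i j En => [|n IH] i j.
  move=> /eqP; rewrite addn_eq0 => /andP[/eqP-> /eqP->].
  by apply: eq_iter_span (iter_span_cst 1) => t _; rewrite /pw !expr0 mulr1.
move=> ijn.
have pb : pw i j b = 0.
  rewrite /pw !fb !expr0n; case: i ijn => [|i] ijn; last by rewrite mul0r.
  by case: j ijn => [|j] // _; rewrite mulr0.
have S1 : iter_span (fun t => i%:R * pw i.-1 j t).
  case: i ijn {pb} => [|i] ijn.
    by apply: eq_iter_span (iter_span_cst 0) => t _; rewrite mul0r.
  by apply: iter_spanZ; apply: IH; move: ijn; rewrite addSn => -[].
have S2 : iter_span (fun t => j%:R * pw i j.-1 t).
  case: j ijn {pb S1} => [|j] ijn.
    by apply: eq_iter_span (iter_span_cst 0) => t _; rewrite mul0r.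
  by apply: iter_spanZ; apply: IH; move: ijn; rewrite addnS => -[].
have := iter_spanZ (-1) (iter_spanD (iter_span_int o S1) (iter_span_int p S2)).
apply: eq_iter_span => t /andP[at_ tb].
have int (r : R) i' j' l : mu.-integrable `[t, b] (EFin \o (fun s => r * pw i' j' s * g l s)).
  have [_ _ [_ [C pC]]] := pw_tame i' j'.
  apply: (@bounded_integrable _ _ _ _ (`|r| * C * L)).
    by apply: measurable_funM => //; exact: measurable_funM.
  by move=> s; apply: mul_bound => //; exact: mul_bound.
rewrite -RintegralD//; try exact: int.
have := pw_density i j at_ tb (lexx b); rewrite pb sub0r => H.
by rewrite -H; ring.
Qed.

(** Words of length one show that the functions vanish at [b] as well, so monomials lie in the span;
    one more integration turns the moment into a combination over nonempty words. *)
Lemma iterg_moment i j : (forall w, w != [::] -> iterg g b w a = 0) ->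
  (forall l, f l a = 0) ->
  \int[mu]_(t in `[a, b]) (pw i j t * g p t) = 0.
Proof.
move=> H fa.
have fb l : f l b = 0.
  have [_ _ E _] := Df l; have := E _ _ (lexx a) ab (lexx b).
  have := H [:: l] isT => /=; under eq_Rintegral do rewrite mulr1.
  by move=> ->; rewrite fa subr0.
have [c cE] := pw_span i j fb.
transitivity (\int[mu]_(t in `[a, b]) ((\sum_(q <- c) q.1 * iterg g b q.2 t) * g p t)).
  by apply: eq_Rintegral => t; rewrite inE/= in_itv/= => tI; rewrite cE.
by rewrite iterg_sum_int ?lexx// big1// => q _; rewrite H// mulr0.
Qed.

End Fixed.
End Iterated.

(** * Angles and their continuous lifts *)

Section Angles.
Context {R : realType}.
Implicit Types (x y z t th : R) (n : int).

Lemma trig_int n x : cos (x + n%:~R * (2 * pi)) = cos x /\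
  sin (x + n%:~R * (2 * pi)) = sin x.
Proof.
have H (m : nat) y : cos (y + m%:R * (2 * pi)) = cos y /\ sin (y + m%:R * (2 * pi)) = sin y.
  elim: m y => [|m IH] y; first by rewrite mul0r addr0.
  have -> : y + m.+1%:R * (2 * pi) = (y + m%:R * (2 * pi)) + pi *+ 2.
    by rewrite -natr1 -(mulr_natl pi); ring.
  by rewrite cosD2pi sinD2pi.
case: n => m; first exact: H.
have := H m.+1 (x + (Negz m)%:~R * (2 * pi)).
rewrite NegzE mulrNz -addrA -mulrDl addNr mul0r addr0.
by move=> [-> ->].
Qed.

Lemma cos_eq1 z : cos z = 1 -> exists n, z = n%:~R * (2 * pi).
Proof.
move=> cz; have p0 : 0 < 2 * pi :> R by rewrite mulr_gt0 ?pi_gt0.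
pose n := Num.floor (z / (2 * pi)); exists n.
have n1 : n%:~R * (2 * pi) <= z by rewrite -ler_pdivlMr// floor_le.
have n2 : z < (n%:~R + 1) * (2 * pi).
  by rewrite -ltr_pdivrMr// (_ : n%:~R + 1 = (n + 1)%:~R) ?floorD1_gt// intrD.
apply/eqP; rewrite eq_le n1 andbT leNgt; apply/negP => nz.
pose r := z - n%:~R * (2 * pi).
have r1 : 0 < r / 2 < pi.
  by rewrite /r; apply/andP; split; [rewrite divr_gt0// subr_gt0|rewrite ltr_pdivrMr//; lra].
have cr : cos r = 1.
  by rewrite -cz -(trig_int n r).1 /r subrK.
have := sin_gt0_pi r1.
have rr : r = (r / 2) *+ 2 by rewrite -mulr_natl; field.
move: cr; rewrite rr cosD -rr -!expr2 => cr.
have := cos2Dsin2 (r / 2) => c2.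
have : sin (r / 2) ^+ 2 = 0 by move: cr c2; rewrite -?expr2; lra.
by move/eqP; rewrite sqrf_eq0 => /eqP ->; rewrite ltxx.
Qed.

(** [th] is an argument of the vector (u, v), which is thereby nonzero. *)
Definition ang (u v th : R) := exists2 rho, 0 < rho & u = rho * cos th /\ v = rho * sin th.

Lemma ang_trig u v th th' : ang u v th -> ang u v th' -> cos th = cos th' /\ sin th = sin th'.
Proof.
move=> [r r0 [ur vr]] [s s0 [us vs]].
have E q h : u = q * cos h -> v = q * sin h -> 0 < q -> q = Num.sqrt (u ^+ 2 + v ^+ 2).
  move=> -> -> q0; have -> : (q * cos h) ^+ 2 + (q * sin h) ^+ 2 = q ^+ 2.
    by rewrite !exprMn -mulrDr cos2Dsin2 mulr1.
  by rewrite sqrtr_sqr ger0_norm// ltW.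
have rs : r = s by rewrite (E _ _ ur vr)// -(E _ _ us vs).
have r00 : r != 0 by rewrite gt_eqF.
split; apply: (mulfI r00); first by rewrite -ur [in RHS]rs -us.
by rewrite -vr [in RHS]rs -vs.
Qed.

Lemma trig_eq x y : cos x = cos y -> sin x = sin y ->
  exists n, x = y + n%:~R * (2 * pi).
Proof.
move=> cxy sxy; have [|n E] := @cos_eq1 (x - y).
  by rewrite cosB cxy sxy -!expr2 cos2Dsin2.
by exists n; rewrite -E addrC subrK.
Qed.

Lemma ang_uniq u v th th' : ang u v th -> ang u v th' ->
  exists n, th = th' + n%:~R * (2 * pi).
Proof. by move=> h h'; have [] := ang_trig h h'; exact: trig_eq. Qed.

Lemma polar_exists u v : 0 < u ^+ 2 + v ^+ 2 -> exists th, ang u v th.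
Proof.
move=> uv0; pose r := Num.sqrt (u ^+ 2 + v ^+ 2).
have r0 : 0 < r by rewrite sqrtr_gt0.
have r2 : r ^+ 2 = u ^+ 2 + v ^+ 2 by rewrite sqr_sqrtr// ltW.
have rn : r != 0 by rewrite gt_eqF.
have E : (u / r) ^+ 2 + (v / r) ^+ 2 = 1.
  by rewrite !expr_div_n -mulrDl r2 divff// -r2 expf_neq0.
have u1 : -1 <= u / r <= 1.
  rewrite -ler_norml -(@ler_pXn2r _ 2)// ?nnegrE// expr1n -normrX ger0_norm ?sqr_ge0//.
  by rewrite -E lerDl sqr_ge0.
have sE : sin (acos (u / r)) = `|v / r|.
  by rewrite sin_acos// -E addrC addKr sqrtr_sqr.
have [v0|v0] := leP 0 (v / r).
  exists (acos (u / r)), r => //; rewrite acosK ?in_itv//= sE ger0_norm//.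
  by rewrite !(mulrC r) !divfK.
exists (- acos (u / r)), r => //; rewrite cosN sinN acosK ?in_itv//= sE ltr0_norm// opprK.
by rewrite !(mulrC r) !divfK.
Qed.

(** Otherwise the intermediate value theorem yields a value halfway between two consecutive
    multiples of 2 pi. *)
Lemma int_valued_const (h : R -> R) x y : continuous h -> x <= y ->
  (forall t, x <= t <= y -> exists n, h t = n%:~R * (2 * pi)) -> h x = h y.
Proof.
move=> ch xy hn; have p0 : 0 < 2 * pi :> R by rewrite mulr_gt0 ?pi_gt0.
have ax : x <= x <= y by rewrite lexx.
have ay : x <= y <= y by rewrite lexx xy.
have [n nE] := hn x ax; have [m mE] := hn y ay.
have noval (k : int) : Num.min (h x) (h y) <= (k%:~R + 2^-1) * (2 * pi) <= Num.max (h x) (h y) -> False.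
  move=> kI; have [t] := IVT xy (continuous_subspaceT ch (A := `[x, y]%classic)) kI.
  rewrite in_itv/= => tI tE; have [l lE] := hn t tI.
  have : k%:~R + 2^-1 = l%:~R :> R by apply: (mulIf (lt0r_neq0 p0)); rewrite -lE.
  have [kl|lk] := leP l k.
    have : l%:~R <= k%:~R :> R by rewrite ler_int.
    lra.
  have : (k + 1)%:~R <= l%:~R :> R by rewrite ler_int lezD1.
  by rewrite intrD; lra.
rewrite nE mE in noval *; have [nm|mn|->//] := ltgtP n m.
  exfalso; apply: (noval n); rewrite ge_min le_max !ler_pM2r// lerDl invr_ge0 ler0n/=.
  apply/orP; right; have : (n + 1)%:~R <= m%:~R :> R by rewrite ler_int lezD1.
  by rewrite intrD; lra.
exfalso; apply: (noval m); rewrite ge_min le_max !ler_pM2r// (lerDl m%:~R) invr_ge0 ler0n/= orbT/=.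
apply/orP; left; have : (m + 1)%:~R <= n%:~R :> R by rewrite ler_int lezD1.
by rewrite intrD; lra.
Qed.

Lemma lift_unique (u v th th' : R -> R) x y : x <= y -> continuous th -> continuous th' ->
  (forall t, x <= t <= y -> ang (u t) (v t) (th t)) ->
  (forall t, x <= t <= y -> ang (u t) (v t) (th' t)) ->
  th y - th x = th' y - th' x.
Proof.
move=> xy cth cth' H H'.
have := @int_valued_const (fun t => th t - th' t) x y.
rewrite /= => E; suff : th x - th' x = th y - th' y by lra.
apply: E => //.
  by move=> t; apply: cvgB; [exact: cth|exact: cth'].
move=> t tI; have [n ->] := ang_uniq (H t tI) (H' t tI).
by exists n; rewrite addrAC subrr add0r.
Qed.

Definition unit_clamp (p : R * R) : R * R := (clamp 0 1 p.1, clamp 0 1 p.2).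

Lemma continuous_clamp (a b : R) : continuous (clamp a b).
Proof. exact: lip_continuous (@lip_clamp _ a b). Qed.

Lemma continuous_fst_comp (T : topologicalType) (f : R -> T) : continuous f -> continuous (fun p : R * R => f p.1).
Proof. by move=> cf p; apply: (@continuous_comp _ _ _ fst f); [exact: cvg_fst|exact: cf]. Qed.

Lemma continuous_snd_comp (T : topologicalType) (f : R -> T) : continuous f -> continuous (fun p : R * R => f p.2).
Proof. by move=> cf p; apply: (@continuous_comp _ _ _ snd f); [exact: cvg_snd|exact: cf]. Qed.

Lemma continuous_pair (T : topologicalType) (f g : T -> R) :
  continuous f -> continuous g -> continuous (fun x : T => (f x, g x) : R * R).
Proof. by move=> cf cg x; exact: (cvg_pair (cf x) (cg x)). Qed.

Lemma continuous_unit_clamp : continuous unit_clamp.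
Proof.
apply: continuous_pair; [apply: continuous_fst_comp|apply: continuous_snd_comp];
exact: continuous_clamp.
Qed.

Let I2 : set (R * R) := `[0, 1]%classic `*` `[0, 1]%classic.

Lemma unit_clampP p : I2 (unit_clamp p).
Proof. by split; rewrite /= in_itv/=; exact: clamp_itv. Qed.

Lemma unit_clamp_id p : I2 p -> unit_clamp p = p.
Proof.
by case: p => x y [/=]; rewrite !in_itv/= => xI yI; rewrite /unit_clamp/= !clamp_id.
Qed.

Let scale (r : R) (p : R * R) : R * R := (r * p.1, r * p.2).

Let continuous_scale r : continuous (scale r).
Proof.
apply: continuous_pair => p; (apply: cvgM; first exact: cvg_cst).
  exact: cvg_fst.
exact: cvg_snd.
Qed.

(** The lift is built along the segments from the corner (0, 0). By compactness there is a number
    [N] of equal steps after which consecutive values make an acute angle on every segment; the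
    angle is then a sum of [N] arctangents, continuous in the endpoint. *)
Lemma lift_square (u v : R * R -> R) : continuous u -> continuous v ->
  (forall p, I2 p -> 0 < u p ^+ 2 + v p ^+ 2) ->
  exists2 Th : R * R -> R, continuous Th & forall p, I2 p -> ang (u p) (v p) (Th p).
Proof.
move=> cu cv uv0.
(* Pairs whose values do not make an acute angle; within the square they keep a positive distance
   from the diagonal. *)
pose A := [set q : (R * R) * (R * R) | u q.1 * u q.2 + v q.1 * v q.2 <= 0].
have cI : compact I2 by apply: compact_setX; exact: segment_compact.
have cII : compact (I2 `*` I2) by exact: compact_setX.
have c1 (w : R * R -> R) : continuous w -> continuous (fun q : (R * R) * (R * R) => w q.1).
  by move=> cw q; apply: (@continuous_comp _ _ _ fst w); [exact: cvg_fst|exact: cw].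
have c2 (w : R * R -> R) : continuous w -> continuous (fun q : (R * R) * (R * R) => w q.2).
  by move=> cw q; apply: (@continuous_comp _ _ _ snd w); [exact: cvg_snd|exact: cw].
have clA : closed A.
  have -> : A = (fun q : (R * R) * (R * R) => u q.1 * u q.2 + v q.1 * v q.2) @^-1` `]-oo, 0].
    by apply/seteqP; split => p; rewrite /A/= in_itv/=.
  apply: preimage_closed => [p _|]; last exact: interval_closed.
  by apply: cvgD; apply: cvgM; [exact: c1|exact: c2|exact: c1|exact: c2].
pose dst (q : (R * R) * (R * R)) := `|q.1.1 - q.2.1| + `|q.1.2 - q.2.2|.
have cdst : continuous dst.
  have cf : continuous (fst : R * R -> R) by move=> x; exact: cvg_fst.
  have cs : continuous (snd : R * R -> R) by move=> x; exact: cvg_snd.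
  move=> q; apply: cvgD; apply: (@cvg_norm _ R^o); apply: cvgB;
  [exact: (c1 _ cf)|exact: (c2 _ cf)|exact: (c1 _ cs)|exact: (c2 _ cs)].
pose E := dst @` ((I2 `*` I2) `&` A).
have cE : compact E.
  apply: continuous_compact; first exact: continuous_subspaceT.
  exact: compact_closedI.
have clE : closed E by apply: compact_closed => //; exact: Rhausdorff.
have E0 : ~ E 0.
  move=> [[[x1 x2] [y1 y2]] [[Ix Iy] Aq]] /eqP.
  rewrite /dst/= paddr_eq0// !normr_eq0 !subr_eq0 => /andP[/eqP xy1 /eqP xy2].
  by move: Aq; rewrite /A/= xy1 xy2 -!expr2 leNgt uv0.
have : nbhs (0 : R) (~` E).
  by apply: open_nbhs_nbhs; split => //; exact: closed_openC.
move=> /nbhs_ballP[e /= e0 eE].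
have near_pos p q : I2 p -> I2 q -> dst (p, q) < e -> 0 < u p * u q + v p * v q.
  move=> Ip Iq pq; rewrite ltNge; apply/negP => Apq.
  apply: (eE (dst (p, q))); last by exists (p, q).
  by rewrite /ball/= sub0r normrN ger0_norm// addr_ge0.
(* One step changes each coordinate by at most 1/N, hence [dst] by at most 2/N < e. *)
pose N := (Num.truncn (2 / e)).+1.
have Ne : 2 / N%:R < e.
  by rewrite ltr_pdivrMr ?ltr0n// mulrC -ltr_pdivrMr//; exact: truncnS_gt.
have N0 : 0 < N%:R :> R by rewrite ltr0n.
pose z k p := scale (k%:R / N%:R) (unit_clamp p).
have zI k p : (k <= N)%N -> I2 (z k p).
  move=> kN; have [/=] := unit_clampP p; rewrite !in_itv/= => /andP[a1 a2] /andP[b1 b2].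
  have k0 : 0 <= k%:R / N%:R :> R by rewrite divr_ge0.
  have k1 : k%:R / N%:R <= 1 :> R by rewrite ler_pdivrMr// mul1r ler_nat.
  by split => /=; rewrite in_itv/= mulr_ge0//= mulr_ile1.
have cz k : continuous (z k).
  move=> p; apply: (@continuous_comp _ _ _ unit_clamp (scale _)).
    exact: continuous_unit_clamp.
  exact: continuous_scale.
(* Real and imaginary part of the value after step k + 1 times the conjugate of the value after step
   k. *)
pose re k p := u (z k.+1 p) * u (z k p) + v (z k.+1 p) * v (z k p).
pose im k p := v (z k.+1 p) * u (z k p) - u (z k.+1 p) * v (z k p).
have cwz (w : R * R -> R) k : continuous w -> continuous (w \o z k).
  by move=> cw p; apply: continuous_comp; [exact: cz|exact: cw].
have cre k : continuous (re k).
  by move=> p; apply: cvgD; apply: cvgM; exact: cwz.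
have cim k : continuous (im k).
  by move=> p; apply: cvgB; apply: cvgM; exact: cwz.
have re0 k p : (k < N)%N -> 0 < re k p.
  move=> kN; apply: near_pos; [exact: zI|exact/zI/ltnW|].
  apply: le_lt_trans Ne; rewrite /dst /z /scale/=.
  have [/=] := unit_clampP p; rewrite !in_itv/= => /andP[a1 a2] /andP[b1 b2].
  have dE c : 0 <= c -> `|k.+1%:R / N%:R * c - k%:R / N%:R * c| = c / N%:R.
    move=> c0; rewrite (_ : _ - _ = c / N%:R); first by rewrite ger0_norm// divr_ge0.
    by rewrite -natr1; ring.
  by rewrite !dE// -mulrDl ler_wpM2r ?invr_ge0//; lra.
pose step k p := atan (im k p / re k p).
have cstep k : (k < N)%N -> continuous (step k).
  move=> kN p; apply: (@continuous_comp _ _ _ (fun q => im k q / re k q) atan); last exact: continuous_atan.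
  apply: cvgM; first exact: cim.
  by apply: cvgV; [rewrite gt_eqF// re0|exact: cre].
have [th0 th0P] : exists th, ang (u (0, 0)) (v (0, 0)) th.
  by apply: polar_exists; apply: uv0; split; rewrite /= in_itv/= lexx ler01.
pose Th m p := th0 + \sum_(k < m) step k p.
have ThP m p : (m <= N)%N -> ang (u (z m p)) (v (z m p)) (Th m p).
  elim: m => [|m IH] mN.
    by rewrite /Th big_ord0 addr0 /z /scale !mul0r.
  have [r r0 [ur vr]] := IH (ltnW mN).
  have r1 := re0 m p mN.
  rewrite /Th big_ord_recr/= addrA -/(Th m p) /step.
  set x := im m p / re m p.
  have c0 : 0 < cos (atan x).
    by rewrite cos_gt0_pihalf// atan_gtNpi2 atan_ltpi2.
  have tx : x = sin (atan x) / cos (atan x) by rewrite -/(tan (atan x)) atanK.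
  (* multiplying by the conjugate of the previous point rotates back *)
  exists (re m p / (r * cos (atan x))).
    by rewrite divr_gt0// mulr_gt0.
  have imE : im m p = re m p * (sin (atan x) / cos (atan x)).
    by rewrite -tx /x mulrC divfK// gt_eqF.
  have cs : cos (Th m p) ^+ 2 + sin (Th m p) ^+ 2 = 1 by exact: cos2Dsin2.
  have rn : r != 0 by rewrite gt_eqF.
  have cn : cos (atan x) != 0 by rewrite gt_eqF.
  have uE : u (z m.+1 p) = (re m p * cos (Th m p) - im m p * sin (Th m p)) / r.
    rewrite /re /im ur vr; apply: (mulIf rn); rewrite divfK//.
    rewrite -[LHS]mulr1 -[in LHS]cs; ring.
  have vE : v (z m.+1 p) = (re m p * sin (Th m p) + im m p * cos (Th m p)) / r.
    rewrite /re /im ur vr; apply: (mulIf rn); rewrite divfK//.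
    rewrite -[LHS]mulr1 -[in LHS]cs; ring.
  rewrite uE vE imE (cosD (Th m p)) (sinD (Th m p)); move: rn cn; clear.
  move: (re m p) (cos (Th m p)) (sin (Th m p)) (cos (atan x)) (sin (atan x)).
  by move=> A B C D E rn cn; split; field; rewrite ?cn ?rn.
exists (Th N).
  have cTh m : (m <= N)%N -> continuous (Th m).
    elim: m => [|m IH] mN p.
      by rewrite /Th; under eq_fun do rewrite big_ord0; exact: cvg_cst.
    have -> : Th m.+1 = fun q => Th m q + step m q.
      by apply/funext => q; rewrite /Th big_ord_recr/= addrA.
    by apply: cvgD; [exact: (IH (ltnW mN))|exact: cstep].
  exact: cTh.
move=> p Ip; have := ThP N p (leqnn N).
by rewrite /z divff ?gt_eqF// /scale unit_clamp_id// !mul1r -surjective_pairing.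
Qed.

End Angles.

(** * Winding numbers of paths in the plane *)

Section Winding.
Context {R : realType}.
Implicit Types (c : R -> R * R) (p : R * R) (G : set (R * R)).

(* [n] is the total variation, in radians, of the argument of [c - p] over
   [0, 1]. *)
Definition winds c p (n : R) := exists th : R -> R,
  [/\ continuous th,
      forall t, 0 <= t <= 1 -> ang ((c t).1 - p.1) ((c t).2 - p.2) (th t) &
      th 1 - th 0 = n].

Lemma winds_uniq c p n m : winds c p n -> winds c p m -> n = m.
Proof.
by move=> [th [cth H <-]] [th' [cth' H' <-]]; exact: lift_unique cth cth' H H'.
Qed.

Lemma eq_winds c c' p n : (forall t, 0 <= t <= 1 -> c t = c' t) ->
  winds c p n -> winds c' p n.
Proof.
move=> cc' [th [cth H E]]; exists th; split => // t tI.
by rewrite -cc'//; exact: H.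
Qed.

Lemma off_center_pos (x p : R * R) : x <> p -> 0 < (x.1 - p.1) ^+ 2 + (x.2 - p.2) ^+ 2.
Proof.
move=> xp; rewrite lt_neqAle addr_ge0 ?sqr_ge0// andbT; apply/eqP => /esym/eqP.
rewrite paddr_eq0 ?sqr_ge0// !sqrf_eq0 !subr_eq0 => /andP[/eqP e1 /eqP e2].
by apply: xp; rewrite (surjective_pairing x) (surjective_pairing p) e1 e2.
Qed.

Lemma continuous_fst1 (T : topologicalType) (f : T -> R * R) : continuous f ->
  continuous (fun t => (f t).1).
Proof. by move=> cf t; apply: (@continuous_comp _ _ _ f fst); [exact: cf|exact: cvg_fst]. Qed.

Lemma continuous_snd1 (T : topologicalType) (f : T -> R * R) : continuous f ->
  continuous (fun t => (f t).2).
Proof. by move=> cf t; apply: (@continuous_comp _ _ _ f snd); [exact: cf|exact: cvg_snd]. Qed.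

Lemma square_lift_at (H : R * R -> R * R) p : continuous H ->
  (forall z, H (unit_clamp z) <> p) ->
  exists2 Th : R * R -> R, continuous Th &
    forall s t, 0 <= s <= 1 -> 0 <= t <= 1 ->
      ang ((H (s, t)).1 - p.1) ((H (s, t)).2 - p.2) (Th (s, t)).
Proof.
move=> cH Hp.
have [||z Iz|Th cTh ThP] := @lift_square R (fun z => (H z).1 - p.1) (fun z => (H z).2 - p.2).
- by move=> z; apply: cvgB; [exact: continuous_fst1|exact: cvg_cst].
- by move=> z; apply: cvgB; [exact: continuous_snd1|exact: cvg_cst].
- by apply: off_center_pos; rewrite -(unit_clamp_id Iz); exact: Hp.
by exists Th => // s t sI tI; apply: ThP; split; rewrite /= in_itv.
Qed.

Lemma continuous_const_pair (T : topologicalType) (u v : R) (f : R * R -> T) : continuous f ->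
  continuous (fun t => f (u, t)) /\ continuous (fun t => f (t, v)).
Proof.
have cu : continuous (fun t : R => (u, t) : R * R).
  by apply: continuous_pair => t; [exact: cvg_cst|exact: cvg_id].
have cv : continuous (fun t : R => (t, v) : R * R).
  by apply: continuous_pair => t; [exact: cvg_id|exact: cvg_cst].
by move=> cf; split => t; [apply: (continuous_comp (cu t))|apply: (continuous_comp (cv t))]; exact: cf.
Qed.

Lemma lift_const (th : R -> R) (u v : R) : continuous th ->
  (forall t, 0 <= t <= 1 -> ang u v (th t)) -> th 1 = th 0.
Proof.
move=> cth H; apply/eqP; rewrite -subr_eq0; apply/eqP.
rewrite (@lift_unique R (cst u) (cst v) th (cst (th 0)) 0 1)//= ?subrr//.
  exact: cst_continuous.
by move=> t _; apply: H; rewrite lexx ler01.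
Qed.

Lemma winds_exists c p : continuous c -> (forall t, c t <> p) -> exists n, winds c p n.
Proof.
move=> cc cp; have [|z|Th cTh ThP] := @square_lift_at (fun z => c z.2) p.
- exact: continuous_snd_comp.
- exact: cp.
exists (Th (0, 1) - Th (0, 0)), (fun t => Th (0, t)); split => //.
  by have [] := continuous_const_pair 0 0 cTh.
by move=> t tI; have := ThP 0 t; rewrite /= lexx ler01; exact.
Qed.

Lemma continuous_within_clamp (T : topologicalType) (H : R * R -> T) :
  {within `[0, 1]%classic `*` `[0, 1]%classic, continuous H} -> continuous (H \o unit_clamp).
Proof.
move=> /subspace_continuousP cH z U HU.
have := cH (unit_clamp z) (unit_clampP z) U HU.
rewrite /= /within/= => W.
have W' : nbhs z (unit_clamp @^-1` [set t | (`[0, 1]%classic `*` `[0, 1]%classic) t -> U (H t)]).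
  exact: continuous_unit_clamp W.
have : nbhs z ((H \o unit_clamp) @^-1` U); last exact.
by apply: filterS W' => y; apply; exact: unit_clampP.
Qed.

Lemma continuous_within_clamp1 (T : topologicalType) (f : R -> T) (a b : R) : a <= b ->
  {within `[a, b], continuous f} -> continuous (f \o clamp a b).
Proof.
move=> ab /subspace_continuousP cf z U fU.
have cI t : `[a, b]%classic (clamp a b t) by rewrite /= in_itv/= clamp_itv.
have := cf (clamp a b z) (cI z) U fU.
rewrite /= /within/= => W.
have W' : nbhs z (clamp a b @^-1` [set t | `[a, b]%classic t -> U (f t)]).
  exact: continuous_clamp W.
have : nbhs z ((f \o clamp a b) @^-1` U); last exact.
by apply: filterS W' => y; apply; exact: cI.
Qed.

(** The angle lifts over the whole homotopy square. It is constant on the side of the constant loop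
    and on the two sides where the endpoints are fixed, so it has no variation on the fourth
    side. *)
Lemma winds_null_homotopic G c x p n : ~ G p -> continuous c ->
  path_homotopic G c (cst x) -> winds c p n -> n = 0.
Proof.
move=> Gp cc [H [cH HG H01 Hs]] wn.
have cH' := continuous_within_clamp cH.
have HE s t : 0 <= s <= 1 -> 0 <= t <= 1 -> (H \o unit_clamp) (s, t) = H (s, t).
  by move=> sI tI; rewrite /= unit_clamp_id//; split; rewrite /= in_itv.
have i0 : 0 <= (0 : R) <= 1 by rewrite lexx ler01.
have i1 : 0 <= (1 : R) <= 1 by rewrite lexx ler01.
have [z|Th cTh ThP] := square_lift_at cH' (p := p).
  move=> Hz; apply: Gp; rewrite -Hz; apply: HG.
  by exists (unit_clamp (unit_clamp z)) => //; exact: unit_clampP.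
have cst1 (f : R -> R * R) (th : R -> R) : (forall t, 0 <= t <= 1 -> f t = f 0) -> continuous th ->
    (forall t, 0 <= t <= 1 -> ang ((f t).1 - p.1) ((f t).2 - p.2) (th t)) -> th 1 = th 0.
  move=> fE cth A; apply: (@lift_const th ((f 0).1 - p.1) ((f 0).2 - p.2)) => // t tI.
  by rewrite -(fE t tI); exact: A.
have e1 : Th (1, 1) = Th (1, 0).
  apply: (cst1 (fun t => (H \o unit_clamp) (1, t)) (fun t => Th (1, t))).
  - move=> t tI; rewrite !HE//.
    by rewrite (H01 t _).2 ?(H01 0 _).2//= in_itv.
  - by have [] := continuous_const_pair 1 1 cTh.
  - by move=> t tI; exact: ThP.
have e2 v : v = 0 \/ v = 1 -> Th (1, v) = Th (0, v).
  move=> v01; have vI : 0 <= v <= 1 by case: v01 => ->.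
  apply: (cst1 (fun t => (H \o unit_clamp) (t, v)) (fun t => Th (t, v))).
  - move=> t tI; rewrite !HE//.
    have tI' : `[0, 1]%classic t by rewrite /= in_itv.
    have oI' : `[0, 1]%classic (0 : R) by rewrite /= in_itv.
    by case: v01 => ->; [rewrite (Hs t tI').1 (Hs 0 oI').1|rewrite (Hs t tI').2 (Hs 0 oI').2].
  - by have [] := continuous_const_pair v v cTh.
  - by move=> t tI; exact: ThP.
apply: (winds_uniq wn); exists (fun t => Th (0, t)); split.
- by have [] := continuous_const_pair 0 0 cTh.
- move=> t tI; have := ThP 0 t i0 tI; rewrite HE//.
  by rewrite (H01 t _).1//= in_itv.
by rewrite -!e2 ?e1 ?subrr//; [left|right].
Qed.

End Winding.

(** * Winding numbers and singular homology *)

HB.instance Definition _ (K : choiceType) (M : lmodType int) (f : K -> M) :=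
  GRing.isZmodMorphism.Build {freeg K / int} M (fglift f) (lift_is_additive f).

Lemma fgliftZ (K : choiceType) (M : lmodType int) (f : K -> M) (k : int) (D : {freeg K}) :
  fglift f (k *: D) = k *: fglift f D.
Proof. by rewrite -[k]intz !scaler_int raddfMz. Qed.

Section Homology.
Context {R : realType}.
Implicit Types (p : R * R) (G : set (R * R)).

Lemma row_continuous (T : topologicalType) n (f : T -> 'rV[R]_n) :
  (forall j, continuous (fun x => f x 0 j)) -> continuous f.
Proof.
move=> cf x A [P nP sPA].
have xF : Filter (nbhs x) by exact: nbhs_filter.
have Pnear k : nbhs x [set y | forall j, P k j (f y k j)].
  apply: (filter_forall xF) => j; rewrite (ord1 k).
  by apply: (cf j x); have := nP ord0 j; rewrite ord1.
apply: (@filterS _ _ xF _ _ _ (filter_forall xF Pnear)) => y Py.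
exact: sPA.
Qed.

Definition edge_row (t : R) : 'rV[R]_2 :=
  \row_j (if j == ord0 then 1 - clamp 0 1 t else clamp 0 1 t).

Lemma edge_row_std t : std_simplex (edge_row t).
Proof.
have /andP[c0 c1] : 0 <= clamp 0 1 t <= 1 by exact: clamp_itv.
split; first by move=> j; rewrite mxE; case: ifP => _ //; rewrite subr_ge0.
by rewrite big_ord_recl big_ord1 !mxE/= subrK.
Qed.

Definition edge (t : R) : std_simplex (R := R) (n := 1) := SigSub (mem_set (edge_row_std t)).

Lemma edge_continuous : continuous edge.
Proof.
apply: continuous_comp_initial; apply: row_continuous => j.
case: (eqVneq j ord0) => [->|j0].
  rewrite (_ : (fun _ => _) = fun t : R => 1 - clamp 0 1 t); last first.
    by apply/funext => t; rewrite /= mxE.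
  by move=> t; apply: cvgB; [exact: cvg_cst|exact: continuous_clamp].
rewrite (_ : (fun _ => _) = clamp 0 1); first exact: continuous_clamp.
by apply/funext => t; rewrite /= mxE (negbTE j0).
Qed.

(** The square collapsed onto the triangle: the side s = 0 goes to vertex 0, and the sides s = 1, t
    = 1, t = 0 become the faces opposite to the vertices 0, 1, 2. *)
Definition tri_row (z : R * R) : 'rV[R]_3 :=
  let s := clamp 0 1 z.1 in let t := clamp 0 1 z.2 in
  \row_j nth 0 [:: 1 - s; s * (1 - t); s * t] j.

Lemma tri_row_std z : std_simplex (tri_row z).
Proof.
have /andP[c0 c1] : 0 <= clamp 0 1 z.1 <= 1 by exact: clamp_itv.
have /andP[d0 d1] : 0 <= clamp 0 1 z.2 <= 1 by exact: clamp_itv.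
split.
  move=> j; rewrite mxE; case: j => [[|[|[|//]]] ?] /=.
  - by rewrite subr_ge0.
  - by rewrite mulr_ge0// subr_ge0.
  - by rewrite mulr_ge0.
by rewrite !big_ord_recl big_ord0 !mxE/=; ring.
Qed.

Definition tri (z : R * R) : std_simplex (R := R) (n := 2) := SigSub (mem_set (tri_row_std z)).

Lemma tri_continuous : continuous tri.
Proof.
have cs : continuous (fun z : R * R => clamp 0 1 z.1).
  by apply: continuous_fst_comp; exact: continuous_clamp.
have ct : continuous (fun z : R * R => clamp 0 1 z.2).
  by apply: continuous_snd_comp; exact: continuous_clamp.
apply: continuous_comp_initial; apply: row_continuous => j.
rewrite (_ : (fun _ => _) = fun z : R * R => nth 0 [:: 1 - clamp 0 1 z.1;
    clamp 0 1 z.1 * (1 - clamp 0 1 z.2); clamp 0 1 z.1 * clamp 0 1 z.2] j); last first.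
  by apply/funext => z; rewrite /= mxE.
case: j => [[|[|[|//]]] ?] /= z.
- by apply: cvgB; [exact: cvg_cst|exact: cs].
- by apply: cvgM; [exact: cs|apply: cvgB; [exact: cvg_cst|exact: ct]].
- by apply: cvgM; [exact: cs|exact: ct].
Qed.

Lemma simplex_eq n (x y : std_simplex (R := R) (n := n)) : set_val x = set_val y -> x = y.
Proof. exact: val_inj. Qed.

Lemma face_row_eq n (i : 'I_n.+2) (x : 'rV[R]_n.+1) (y : 'rV[R]_n.+2) :
  y 0 i = 0 -> (forall k, y 0 (fintype.lift i k) = x 0 k) -> face_row i x = y.
Proof.
move=> yi yk; apply/rowP => j; rewrite mxE.
by case: unliftP => [k ->|->]; rewrite ?yk ?yi.
Qed.

Lemma face_edge (t : R) : 0 <= t <= 1 ->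
  [/\ face ord0 (edge t) = tri (1, t), face (fintype.lift ord0 ord0) (edge t) = tri (t, 1) &
      face ord_max (edge t) = tri (t, 0)].
Proof.
move=> tI; have i0 : 0 <= (0 : R) <= 1 by rewrite lexx ler01.
have i1 : 0 <= (1 : R) <= 1 by rewrite lexx ler01.
split; apply: simplex_eq; apply: face_row_eq; rewrite ?mxE/= ?clamp_id//; try ring;
  by case=> [[|[|//]]] ?; rewrite !mxE/= !clamp_id//; ring.
Qed.

Lemma tri_vertex (t : R) : tri (0, t) = tri (0, 0).
Proof.
have i0 : 0 <= (0 : R) <= 1 by rewrite lexx ler01.
apply: simplex_eq; apply/rowP => -[[|[|[|//]]] ?] /=; rewrite !mxE/= !(@clamp_id R 0 1 0)//; ring.
Qed.

Section Class.
Variable G : set (R * R).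

Definition path_of (s : singular_simplex R G 1) (t : R) : R * R := set_val (s (edge t)).

Lemma set_val_continuous : continuous (set_val : G -> R * R).
Proof. by move=> x; exact: initial_continuous. Qed.

Lemma path_of_continuous s : continuous (path_of s).
Proof.
move=> t; apply: (@continuous_comp _ _ _ (fun t => s (edge t)) set_val); last exact: set_val_continuous.
by apply: (@continuous_comp _ _ _ edge s); [exact: edge_continuous|exact: cts_fun].
Qed.

Lemma path_of_in s t : G (path_of s t).
Proof. exact: (set_mem (valP (s (edge t)))). Qed.

(** The angle cochain around [p]; for [p] off [G] the default 0 never occurs. The type [zmodule R]
    carries the module structure over the integers that [fglift] expects. *)
Definition angle_class p (s : singular_simplex R G 1) : zmodule R :=
  xget 0 [set v | winds (path_of s) p v].

Lemma angle_classP p s : ~ G p -> winds (path_of s) p (angle_class p s).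
Proof.
move=> Gp; have [|n wn] := @winds_exists R (path_of s) p (@path_of_continuous s).
  by move=> t st; apply: Gp; rewrite -st; exact: path_of_in.
exact: (xgetI 0 wn).
Qed.

(** The angle lifts over the whole triangle, parametrized by the square. The variations along the
    three faces telescope to the variation along the side collapsed to a vertex, which is 0. *)
Lemma angle_boundary p (s : singular_simplex R G 2) : ~ G p ->
  angle_class p (simplex_face ord0 s) - angle_class p (simplex_face (fintype.lift ord0 ord0) s) +
  angle_class p (simplex_face ord_max s) = 0.
Proof.
move=> Gp; pose H z : R * R := set_val (s (tri z)).
have cH : continuous H.
  move=> z; apply: (@continuous_comp _ _ _ (fun z => s (tri z)) set_val); last exact: set_val_continuous.
  by apply: (@continuous_comp _ _ _ tri s); [exact: tri_continuous|exact: cts_fun].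
have [z|Th cTh ThP] := square_lift_at cH (p := p).
  by move=> Hz; apply: Gp; rewrite -Hz; exact: (set_mem (valP (s (tri _)))).
have i0 : 0 <= (0 : R) <= 1 by rewrite lexx ler01.
have i1 : 0 <= (1 : R) <= 1 by rewrite lexx ler01.
have W i (a : R -> R * R) : continuous (fun t => Th (a t)) ->
    (forall t, 0 <= t <= 1 -> 0 <= (a t).1 <= 1 /\ 0 <= (a t).2 <= 1) ->
    (forall t, 0 <= t <= 1 -> face i (edge t) = tri (a t)) ->
    angle_class p (simplex_face i s) = Th (a 1) - Th (a 0).
  move=> ca aI aE; apply: (winds_uniq (angle_classP _ Gp)).
  exists (fun t => Th (a t)); split => // t tI.
  rewrite /path_of /simplex_face /= aE//.
  have [h1 h2] := aI t tI; have := ThP _ _ h1 h2.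
  by rewrite -surjective_pairing.
have [c1 _] := continuous_const_pair 1 0 cTh.
have [_ c2] := continuous_const_pair 1 0 cTh.
have [_ c3] := continuous_const_pair 1 1 cTh.
rewrite (W ord0 (fun t => (1, t)))//; last by move=> t /face_edge[].
rewrite (W (fintype.lift ord0 ord0) (fun t => (t, 1)))//; last by move=> t /face_edge[].
rewrite (W ord_max (fun t => (t, 0)))//; last by move=> t /face_edge[].
have [c4 _] := continuous_const_pair 0 0 cTh.
have -> : Th (0, 1) = Th (0, 0).
  apply: (@lift_const R (fun t => Th (0, t)) ((H (0, 0)).1 - p.1) ((H (0, 0)).2 - p.2)) => // t tI.
  by have := ThP 0 t i0 tI; rewrite /H tri_vertex.
by rewrite /=; ring.
Qed.

Lemma angle_chain_boundary p (w : {freeg (singular_simplex R G 2)}) : ~ G p ->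
  fglift (angle_class p) (singular_boundary w) = 0.
Proof.
move=> Gp; rewrite -[w]freeg_sumE /singular_boundary !raddf_sum/= big1// => s _.
rewrite liftU fgliftZ raddf_sum/=.
under eq_bigr do rewrite fgliftZ liftU scale1r scalezrE.
rewrite 3!big_ord_recl big_ord0 expr0 expr1 addr0.
have -> : fintype.lift ord0 (fintype.lift ord0 ord0) = ord_max :> 'I_3 by exact: val_inj.
rewrite sqrrN expr1n !mulr1z mulrNz mulr1z addrA.
by have /= -> := angle_boundary s Gp; rewrite scaler0.
Qed.

Lemma simplex_of_loop (c : R -> R * R) : continuous c -> (forall t, G (c t)) ->
  exists s : singular_simplex R G 1, singular_simplex_of c s.
Proof.
move=> cc cG.
pose f (x : std_simplex (R := R) (n := 1)) : G := SigSub (mem_set (cG (set_val x 0 ord_max))).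
have cf : continuous f.
  apply: continuous_comp_initial => x.
  apply: (@continuous_comp _ _ _ (fun x : std_simplex (R := R) (n := 1) => set_val x 0 ord_max) c).
    apply: (@continuous_comp _ _ _ set_val (fun M : 'rV[R]_2 => M 0 ord_max)).
      exact: initial_continuous.
    exact: coord_continuous.
  exact: cc.
by exists (mkcts cf : continuousType (std_simplex (R := R) (n := 1)) G).
Qed.

Lemma loop_boundary (c : R -> R * R) (s : singular_simplex R G 1) :
  singular_simplex_of c s -> c 0 = c 1 -> singular_boundary << s >> = 0.
Proof.
move=> sc c01; rewrite /singular_boundary liftU scale1r big_ord_recl big_ord1.
rewrite expr0 expr1 scale1r scaleN1r.
suff -> : simplex_face (fintype.lift ord0 ord0) s = simplex_face ord0 s by rewrite subrr.
have oE : fintype.lift ord0 ord0 = ord_max :> 'I_2 by exact: val_inj.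
apply/continuousEP => x; apply: val_inj; rewrite /= -[LHS]/(set_val _) -[RHS]/(set_val _) !sc /=.
have x1 : set_val x 0 0 = 1.
  by have [_] := set_mem (valP x); rewrite big_ord1.
by rewrite -oE !mxE unlift_none liftK -[\val x]/(set_val x) x1 c01.
Qed.

Lemma path_of_loop (c : R -> R * R) (s : singular_simplex R G 1) t :
  singular_simplex_of c s -> 0 <= t <= 1 -> path_of s t = c t.
Proof. by move=> sc tI; rewrite /path_of sc /= mxE/= clamp_id. Qed.

(** The coefficients come from the homology class of [c], so the same ones serve every [p] off [G];
    this is what makes the winding function of the path a fixed combination of those of the
    generators. *)
Lemma homologous_winding m (l : 'I_m -> R -> R * R) (s : 'I_m -> singular_simplex R G 1)
    (c : R -> R * R) :
  (forall j, singular_simplex_of (l j) (s j)) -> generate_H1 s ->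
  continuous c -> (forall t, G (c t)) -> c 0 = c 1 ->
  exists k : 'I_m -> int, forall p, ~ G p ->
    exists n : 'I_m -> R, (forall j, winds (l j) p (n j)) /\
      winds c p (\sum_j n j *~ k j).
Proof.
move=> sl [_ gen] cc cG c01.
have [sc scP] := simplex_of_loop cc cG.
have [k [w wE]] := gen _ (loop_boundary scP c01).
exists k => p Gp; exists (fun j => angle_class p (s j)); split.
  move=> j; apply: eq_winds (angle_classP _ Gp) => t tI.
  exact: path_of_loop.
have -> : \sum_j (angle_class p (s j) : R) *~ k j = angle_class p sc.
  have : fglift (angle_class p) << sc >> = angle_class p sc by rewrite liftU scale1r.
  rewrite wE raddfD/= angle_chain_boundary// addr0 raddf_sum/= => <-.
  by apply: eq_bigr => j _; rewrite fgliftZ liftU scale1r scalezrE.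
by apply: eq_winds (angle_classP _ Gp) => t tI; exact: path_of_loop.
Qed.

End Class.

End Homology.

(** * Winding number around a point outside a Jordan domain *)

Section Exterior.
Context {R : realType}.
Implicit Types (l : R -> R * R) (p q : R * R) (D : set (R * R)).

Lemma lipschitz_on_itv (V : normedModType R) (f : R -> V) (a b : R) :
  [lipschitz f t | t in `[a, b]] ->
  exists2 L, 0 <= L & forall x y, a <= x <= b -> a <= y <= b -> `|f x - f y| <= L * `|x - y|.
Proof.
move=> [M [Mr HM]]; exists (`|M| + 1); first by rewrite addr_ge0.
move=> x y xI yI.
have MM : M < `|M| + 1 by rewrite (le_lt_trans (ler_norm M))// ltrDl.
by apply: (HM _ MM (x, y)); split; rewrite /= in_itv.
Qed.

Lemma winds_int c p n : c 0 = c 1 -> winds c p n -> exists k : int, n = k%:~R * (2 * pi).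
Proof.
move=> c01 [th [_ H <-]].
have i0 : 0 <= (0 : R) <= 1 by rewrite lexx ler01.
have i1 : 0 <= (1 : R) <= 1 by rewrite lexx ler01.
have := H 1 i1; rewrite -c01 => H1.
have [k ->] := ang_uniq H1 (H 0 i0); exists k; ring.
Qed.

(* If the loop had winding number n around the exterior point p, the direction
   field of z - p on D, continued to the exterior by the n-th power of the
   direction of z - q twisted by a single-valued angle (Tietze), would be a
   continuous map from the plane to the circle of degree n on large circles. *)
Lemma winds_exterior l D q p n : continuous l -> l 0 = l 1 -> set_inj `[0, 1[ l ->
  open D -> bounded_set D -> closure D `\` D = l @` `[0, 1] ->
  D q -> winds l q (2 * pi) -> ~ closure D p -> winds l p n -> n = 0.
Proof.
move=> cl l01 il oD bD Dl Dq [be [cbe beP beE]] Dp wp.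
have [k nE] := winds_int l01 wp.
case: wp => [al [cal alP alE]].
have lK t : 0 <= t <= 1 -> (closure D `\` D) (l t).
  by move=> tI; rewrite Dl; exists t => //; rewrite /= in_itv.
(* The turns seen from p and k times those seen from q cancel, so [h] takes the same value at both
   ends and descends to the curve. *)
pose h t := al t - k%:~R * be t.
have ch : continuous h.
  by move=> t; apply: cvgB; [exact: cal|apply: cvgMr; exact: cbe].
have h01 : h 0 = h 1.
  by rewrite /h; move: alE; rewrite nE => alE; nra.
have hE s t : 0 <= s <= 1 -> 0 <= t <= 1 -> l s = l t -> h s = h t.
  have hinj s' t' : 0 <= s' < 1 -> 0 <= t' < 1 -> l s' = l t' -> s' = t'.
    by move=> sI tI lst; apply: il => //; rewrite inE/= in_itv.
  have red s' : 0 <= s' <= 1 -> exists2 s2, 0 <= s2 < 1 & h s2 = h s' /\ l s2 = l s'.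
    move=> /andP[s0]; rewrite le_eqVlt => /orP[/eqP->|s1].
      by exists 0; rewrite ?lexx ?ltr01.
    by exists s'; rewrite ?s0.
  move=> /red[s2 s2I [<- <-]] /red[t2 t2I [<- <-]] /(hinj _ _ s2I t2I) ->.
  by [].
pose K := closure D `\` D.
pose u z := h (xget 0 [set t | 0 <= t <= 1 /\ l t = z]).
have uE t : 0 <= t <= 1 -> u (l t) = h t.
  move=> tI; have [sI st] := @xgetPex _ 0 [set s | 0 <= s <= 1 /\ l s = l t] (ex_intro _ t (conj tI erefl)).
  exact: hE.
have cK : compact K.
  rewrite /K Dl; apply: continuous_compact; last exact: segment_compact.
  exact: continuous_subspaceT.
have clK : closed K by apply: compact_closed => //; exact: norm_hausdorff.
(* Near [z]: the times at which [h] is at least e away from [u z] have a compact image that misses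
   [z]. *)
have cu : {within K, continuous u}.
  apply/subspace_continuousP => z Kz; apply/cvgrPdist_lt => e e0.
  pose T := `[0, 1]%classic `&` [set t | e <= `|u z - h t|].
  have cT : compact T.
    apply: compact_closedI; first exact: segment_compact.
    rewrite (_ : [set t | _] = (fun t => `|u z - h t|) @^-1` `[e, +oo[); last first.
      by apply/seteqP; split => t /=; rewrite in_itv/= andbT.
    apply: preimage_closed => [t _|]; last exact: interval_closed.
    by apply: (@cvg_norm _ R^o); apply: cvgB; [exact: cvg_cst|exact: ch].
  have clT : closed (l @` T).
    apply: compact_closed; first exact: norm_hausdorff.
    by apply: continuous_compact => //; exact: continuous_subspaceT.
  have nz : ~ (l @` T) z.
    move=> [t [tI /=]]; rewrite leNgt => + lt; rewrite -lt uE ?subrr ?normr0 ?e0//.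
  have : nbhs z (~` (l @` T)).
    by apply: open_nbhs_nbhs; split => //; exact: closed_openC.
  rewrite /= /within/=; apply: filterS => y nTy Ky.
  have : K y by [].
  rewrite /K Dl => -[t tI lt]; rewrite ltNge; apply/negP => ge.
  apply: nTy; exists t => //; split => //=.
  by rewrite -uE; [rewrite lt|move: tI; rewrite /= in_itv].
have [M M0 uM] : exists2 M, 0 < M & forall z, K z -> `|u z| <= M.
  have cn : {within `[0, 1], continuous (fun t => `|h t|)}.
    by apply: continuous_subspaceT => t; apply: (@cvg_norm _ R^o); exact: ch.
  have [c _ cP] := EVT_max ler01 cn.
  exists (`|h c| + 1); first by rewrite ltr_wpDl.
  move=> z; rewrite /K Dl => -[t tI <-].
  rewrite uE; last by move: tI; rewrite /= in_itv.
  by rewrite (le_trans (cP t tI))// lerDl.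
have [U [UE cU _]] := continuous_bounded_extension pseudometric_normal clK M0 cu uM.
have [B DB] : exists B, forall z, D z -> `|z - q| <= B.
  move: bD => [B [_ DB]]; exists (B + 1 + `|q|) => z Dz.
  by rewrite (le_trans (ler_normB _ _))// lerD2r DB// ltrDl.
have B0 : 0 <= B by rewrite (le_trans _ (DB q Dq)).
(* The circle of radius [W] around q avoids [D]: W^2 > 2 B^2, and [D] lies in the ball of radius [B]
   for the max norm. *)
pose W := 2 * B + 1.
(* Polar coordinates around q, with the radius in units of [W] and the angle in full turns. *)
pose zz (x : R * R) : R * R := (q.1 + clamp 0 1 x.1 * W * cos (2 * pi * x.2),
                               q.2 + clamp 0 1 x.1 * W * sin (2 * pi * x.2)).
have cang : continuous (fun x : R * R => 2 * pi * x.2).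
  by move=> x; apply: cvgMr; exact: cvg_snd.
have ccos : continuous (fun x : R * R => cos (2 * pi * x.2)).
  by move=> x; apply: (@continuous_comp _ _ _ (fun x : R * R => 2 * pi * x.2) cos); [exact: cang|exact: continuous_cos].
have csin : continuous (fun x : R * R => sin (2 * pi * x.2)).
  by move=> x; apply: (@continuous_comp _ _ _ (fun x : R * R => 2 * pi * x.2) sin); [exact: cang|exact: continuous_sin].
have crad : continuous (fun x : R * R => clamp 0 1 x.1 * W).
  by move=> x; apply: cvgMl; apply: continuous_fst_comp; exact: continuous_clamp.
have czz : continuous zz.
  apply: continuous_pair => x; apply: cvgD; try exact: cvg_cst.
    by apply: cvgM; [exact: crad|exact: ccos].
  by apply: cvgM; [exact: crad|exact: csin].
pose N z := Num.sqrt ((z.1 - p.1) ^+ 2 + (z.2 - p.2) ^+ 2).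
pose A := zz @^-1` closure D.
pose C := zz @^-1` ~` D.
have clA : closed A by apply: preimage_closed => [x _|]; [exact: czz|exact: closed_closure].
have clC : closed C by apply: preimage_closed => [x _|]; [exact: czz|exact: open_closedC].
have AC : A `|` C = setT.
  apply/seteqP; split => // x _; have [Dx|Dx] := pselect (D (zz x)); last by right.
  by left; exact: subset_closure.
have N0 z : closure D z -> 0 < N z.
  move=> Dz; rewrite sqrtr_gt0; apply: off_center_pos => zp.
  by apply: Dp; rewrite -zp.
have angN z th : closure D z -> ang (z.1 - p.1) (z.2 - p.2) th ->
    (z.1 - p.1) / N z = cos th /\ (z.2 - p.2) / N z = sin th.
  move=> Dz [r r0 [e1 e2]]; have NE : N z = r.
    by rewrite /N e1 e2 !exprMn -mulrDr cos2Dsin2 mulr1 sqrtr_sqr ger0_norm// ltW.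
  by rewrite NE e1 e2 !(mulrC r) !mulfK// gt_eqF.
(* The angle of the field continued outside [D]; on the curve it equals the angle of z - p up to
   full turns, because [U] extends [u]. *)
pose Psi (x : R * R) := U (zz x) + k%:~R * (2 * pi * x.2).
have cPsi : continuous Psi.
  move=> x; apply: cvgD; last by apply: cvgMr; exact: cang.
  by apply: continuous_comp; [exact: czz|exact: cU].
have agree x : A x -> C x ->
    ((zz x).1 - p.1) / N (zz x) = cos (Psi x) /\ ((zz x).2 - p.2) / N (zz x) = sin (Psi x).
  move=> Ax Cx; have Kx : K (zz x) by split.
  have : K (zz x) by []; rewrite {1}/K Dl => -[t tI lt].
  have tI' : 0 <= t <= 1 by move: tI; rewrite /= in_itv.
  have [] := angN (zz x) (al t) Ax; first by rewrite -lt; exact: alP.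
  move=> -> ->; have qn : ang ((zz x).1 - q.1) ((zz x).2 - q.2) (2 * pi * x.2).
    exists (clamp 0 1 x.1 * W); last by rewrite /zz/=; split; ring.
    have c0 : 0 <= clamp 0 1 x.1 by have /andP[] := clamp_itv x.1 (@ler01 R).
    rewrite mulr_gt0//; last by rewrite /W ltr_wpDl// mulr_ge0.
    rewrite lt_neqAle c0 andbT; apply/eqP => c00; apply: Cx.
    by rewrite /zz -c00 !mul0r !addr0 -surjective_pairing.
  have := beP t tI'; rewrite lt => /ang_uniq /(_ qn)[j bj].
  rewrite /Psi -UE ?inE// -lt uE// /h bj.
  have -> : al t - k%:~R * (2 * pi * x.2 + j%:~R * (2 * pi)) + k%:~R * (2 * pi * x.2) =
      al t + (- (k * j))%:~R * (2 * pi) by rewrite mulrNz intrM; ring.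
  by have [-> ->] := trig_int (- (k * j)) (al t).
(* The closed sets [A] and [C] cover the parameter plane, and their intersection is mapped to the
   boundary curve, where the two formulas agree. *)
have glue (num : R * R -> R) (trig : R -> R) : continuous num -> continuous trig ->
    (forall x, A x -> C x -> num (zz x) / N (zz x) = trig (Psi x)) ->
    exists2 Phi : R * R -> R, continuous Phi &
      (forall x, A x -> Phi x = num (zz x) / N (zz x)) /\ (forall x, C x -> Phi x = trig (Psi x)).
  move=> cnum ctrig ag.
  pose Phi x := if x \in C then trig (Psi x) else num (zz x) / N (zz x).
  have PA x : A x -> Phi x = num (zz x) / N (zz x).
    by move=> Ax; rewrite /Phi; case: ifPn => // /set_mem Cx; rewrite ag.
  have PC x : C x -> Phi x = trig (Psi x) by move=> Cx; rewrite /Phi mem_set.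
  exists Phi => //.
  have : {within setT, continuous Phi}.
    rewrite -AC; apply: withinU_continuous => //.
      apply: (@subspace_eq_continuous _ _ _ (fun x => num (zz x) / N (zz x))).
        by move=> x /set_mem Ax; exact/esym/PA.
      apply: continuous_in_subspaceT => x /set_mem Ax.
      apply: cvgM; first by apply: continuous_comp; [exact: czz|exact: cnum].
      apply: cvgV; first by rewrite gt_eqF// N0.
      apply: (@continuous_comp _ _ _ zz N); first exact: czz.
      apply: (@continuous_comp _ _ _ (fun z => (z.1 - p.1) ^+ 2 + (z.2 - p.2) ^+ 2) Num.sqrt).
        rewrite /continuous_at; apply: cvgD; apply: cvgM; apply: cvgB; try exact: cvg_cst.
        + exact: cvg_fst.
        + exact: cvg_fst.
        + exact: cvg_snd.
        + exact: cvg_snd.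
      exact: sqrt_continuous.
    apply: (@subspace_eq_continuous _ _ _ (trig \o Psi)).
      by move=> x /set_mem Cx; exact/esym/PC.
    apply: continuous_subspaceT => x.
    by apply: continuous_comp; [exact: cPsi|exact: ctrig].
  by move=> /(continuous_subspace_setT Phi).
have cfstB : continuous (fun z : R * R => z.1 - p.1).
  by move=> z; apply: cvgB; [exact: cvg_fst|exact: cvg_cst].
have csndB : continuous (fun z : R * R => z.2 - p.2).
  by move=> z; apply: cvgB; [exact: cvg_snd|exact: cvg_cst].
have [Ph1 cPh1 [Ph1A Ph1C]] := glue _ _ cfstB (@continuous_cos R) (fun x Ax Cx => (agree x Ax Cx).1).
have [Ph2 cPh2 [Ph2A Ph2C]] := glue _ _ csndB (@continuous_sin R) (fun x Ax Cx => (agree x Ax Cx).2).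
have unit12 x : 0 < Ph1 x ^+ 2 + Ph2 x ^+ 2.
  have : (A `|` C) x by rewrite AC.
  case=> [Ax|Cx]; last by rewrite Ph1C// Ph2C// cos2Dsin2.
  rewrite Ph1A// Ph2A// !expr_div_n -mulrDl divr_gt0//; last by rewrite exprn_gt0// N0.
  by rewrite -sqrtr_gt0; exact: N0.
have [Th cTh ThP] := lift_square cPh1 cPh2 (fun x _ => unit12 x).
have i0 : 0 <= (0 : R) <= 1 by rewrite lexx ler01.
have i1 : 0 <= (1 : R) <= 1 by rewrite lexx ler01.
have ThP' s t : 0 <= s <= 1 -> 0 <= t <= 1 -> ang (Ph1 (s, t)) (Ph2 (s, t)) (Th (s, t)).
  by move=> sI tI; apply: ThP; split; rewrite /= in_itv.
have Av t : A (0, t).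
  rewrite /A/= /zz/= (@clamp_id _ 0 1 0)// !mul0r !addr0 -surjective_pairing.
  exact: subset_closure.
have Cv t : C (1, t).
  rewrite /C/= /zz/= (@clamp_id _ 0 1 1)// !mul1r => /DB.
  rewrite prod_normE ge_max /= !(addrC (_.1)) !(addrC (_.2)) !addrK => /andP[hc hs].
  have sq v : `|W * v| <= B -> (W * v) ^+ 2 <= B ^+ 2.
    by move=> vB; rewrite -real_normK ?num_real// ler_pXn2r ?nnegrE.
  have W2 : W ^+ 2 = (W * cos (2 * pi * t)) ^+ 2 + (W * sin (2 * pi * t)) ^+ 2.
    by rewrite !exprMn -mulrDr cos2Dsin2 mulr1.
  have W3 : W ^+ 2 <= 2 * B ^+ 2.
    by rewrite W2 (mulr_natl (B ^+ 2) 2) mulr2n lerD// sq.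
  have : B ^+ 2 * 2 < W ^+ 2.
    have -> : W ^+ 2 = B ^+ 2 * 2 + (B ^+ 2 * 2 + 4 * B + 1) by rewrite /W; ring.
    by rewrite ltrDl ltr_wpDl// addr_ge0 ?mulr_ge0// sqr_ge0.
  by rewrite mulrC ltNge W3.
have [cT0 _] := continuous_const_pair 0 0 cTh.
have [cT1 _] := continuous_const_pair 1 0 cTh.
have [_ cS0] := continuous_const_pair 0 0 cTh.
have [_ cS1] := continuous_const_pair 0 1 cTh.
(* The lift does not vary at the center, varies by n along the outer circle, and has equal
   variations on the two radial sides; together this forces n = 0. *)
have e0 : Th (0, 1) = Th (0, 0).
  apply: (@lift_const R (fun t => Th (0, t)) ((q.1 - p.1) / N q) ((q.2 - p.2) / N q)) => // t tI.
  have := ThP' 0 t i0 tI; rewrite Ph1A// Ph2A// /zz/= (@clamp_id _ 0 1 0)// !mul0r !addr0.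
  by rewrite -surjective_pairing.
have e1 : Th (1, 1) - Th (1, 0) = Psi (1, 1) - Psi (1, 0).
  apply: (@lift_unique R (fun t => Ph1 (1, t)) (fun t => Ph2 (1, t)) (fun t => Th (1, t)) (fun t => Psi (1, t)) 0 1) => //.
  - by have [] := continuous_const_pair 1 0 cPsi.
  - by move=> t tI; exact: ThP'.
  - by move=> t tI; rewrite Ph1C// Ph2C//; exists 1 => //; rewrite !mul1r.
have z10 s : zz (s, 1) = zz (s, 0).
  rewrite /zz/= mulr1 mulr0.
  have [h1 h2] := trig_int 1 (0 : R).
  by rewrite -[2 * pi]add0r -[2 * pi]mul1r h1 h2.
have e2 : Th (1, 0) - Th (0, 0) = Th (1, 1) - Th (0, 1).
  apply: (@lift_unique R (fun s => Ph1 (s, 0)) (fun s => Ph2 (s, 0)) (fun s => Th (s, 0)) (fun s => Th (s, 1)) 0 1) => //.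
  - by move=> s sI; exact: ThP'.
  - move=> s sI; have := ThP' s 1 sI i1.
    have [Ds|Ds] := pselect (D (zz (s, 0))).
      have D1 : closure D (zz (s, 1)) by rewrite z10; exact: subset_closure.
      have D0 : closure D (zz (s, 0)) by exact: subset_closure.
      by rewrite !Ph1A// !Ph2A// z10.
    have D1 : C (s, 1) by rewrite /C/= z10.
    rewrite !Ph1C// !Ph2C// /Psi/= z10 mulr1 mulr0 mulr0 addr0.
    by have [-> ->] := trig_int k (U (zz (s, 0))).
have : n = Th (1, 1) - Th (1, 0).
  by rewrite e1 /Psi/= z10 nE; ring.
by move: e0 e2; lra.
Qed.

End Exterior.

(** * Green's formula in one gap of a vertical line *)

Section Cell.
Context {R : realType}.
Notation mu := (@lebesgue_measure R).
Implicit Types (g k h : R -> R) (a b x y t s c L M N B m : R).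

Lemma locally_const_itv a b h : a <= b ->
  (forall t, a <= t <= b -> exists2 e, 0 < e & forall u v, a <= u <= b -> a <= v <= b ->
    `|u - t| < e -> `|v - t| < e -> u <= v -> h u = h v) -> h a = h b.
Proof.
move=> ab H; pose f t := h (clamp a b t).
suff : f a = f b by rewrite /f !clamp_id ?lexx ?ab.
apply: is_derive_0_is_cst => t.
have [e e0 He] := H _ (clamp_itv t ab).
apply: (near_eq_is_derive (f := cst (f t) : R -> R) _ (is_derive_cst (f t) (t : R) 1)).
near=> s; rewrite /f /=.
have st : `|clamp a b s - clamp a b t| < e.
  apply: (le_lt_trans (lip_clamp a b s t)); rewrite mul1r distrC.
  by near: s; apply: nbhsx_ballx.
have tt : `|clamp a b t - clamp a b t| < e by rewrite subrr normr0.
have [ts|/ltW ts] := leP (clamp a b t) (clamp a b s).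
  by rewrite (He (clamp a b t) (clamp a b s)) ?clamp_itv.
by rewrite (He (clamp a b s) (clamp a b t)) ?clamp_itv.
Unshelve. all: by end_near. Qed.

Lemma floor_near (h : R -> R) t : {for t, continuous h} -> (forall n : int, h t <> n%:~R) ->
  \forall s \near t, Num.floor (h s) = Num.floor (h t).
Proof.
move=> ch hn; pose n := Num.floor (h t).
have n1 : n%:~R < h t.
  by rewrite lt_neqAle floor_le andbT eq_sym; apply/eqP/hn.
have n2 : h t < (n + 1)%:~R by exact: floorD1_gt.
have c1 : \forall s \near t, n%:~R < h s by exact: (cvgr_gt _ ch).
have c2 : \forall s \near t, h s < (n + 1)%:~R by exact: (cvgr_lt _ ch).
near=> s; apply/eqP; rewrite -/n floor_eq; apply/andP; split; last by near: s.
by apply: ltW; near: s.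
Unshelve. all: by end_near. Qed.

Lemma Rintegral_itv_eq0 k x y : (forall t, x <= t <= y -> k t = 0) ->
  \int[mu]_(t in `[x, y]) k t = 0.
Proof.
move=> k0; transitivity (\int[mu]_(t in `[x, y]) cst 0 t).
  by apply: eq_Rintegral => t; rewrite inE/= in_itv/= => /k0.
by rewrite Rintegral_cst// mul0r.
Qed.

Lemma indic_above (d : R -> R) y t : (\1_(above d y) t : R) = (y < d t)%R%:R.
Proof.
rewrite indicE; have [dt|dt] := ltP y (d t); first by rewrite mem_set.
by rewrite memNset // /above/=; apply/negP; rewrite -leNgt.
Qed.

(* The floor counts full turns; the indicator of the right half-plane cancels
   its jump where the angle crosses the upward vertical direction. *)
Lemma floor_cos (n : int) (d : R) : - (pi / 2) < d -> d < pi / 2 ->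
  (Num.floor ((pi / 2 + n%:~R * (2 * pi) + d - pi / 2) / (2 * pi)))%:~R +
  (0 < cos (pi / 2 + n%:~R * (2 * pi) + d))%R%:R = n%:~R :> R.
Proof.
move=> d1 d2; have pi20 : 0 < 2 * pi :> R by rewrite mulr_gt0// pi_gt0.
have -> : cos (pi / 2 + n%:~R * (2 * pi) + d) = - sin d.
  rewrite -cosDpihalf; have [<- _] := trig_int n (d + pi / 2).
  by congr cos; ring.
set q := (_ / (2 * pi)).
have qE : q * (2 * pi) = n%:~R * (2 * pi) + d by rewrite /q divfK ?gt_eqF//; ring.
have [d0|d0] := ltP d 0.
  rewrite -sinN sin_gt0_pi; last by apply/andP; split; lra.
  have -> : Num.floor q = n - 1.
    apply/eqP; rewrite floor_eq subrK intrB -(ler_pM2r pi20) -(ltr_pM2r pi20) qE.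
    by apply/andP; split; lra.
  by rewrite intrB subrK.
rewrite ltNge oppr_le0 sin_ge0_pi ?d0/=; last by lra.
rewrite addr0; have -> // : Num.floor q = n.
apply/eqP; rewrite floor_eq intrD -(ler_pM2r pi20) -(ltr_pM2r pi20) qE.
by apply/andP; split; lra.
Qed.

(** Let T be the integral of [g] and Rg its primitive, which is 0 below the gap and T above it. Take
    T times the number of turns counted at the upward vertical, plus Rg(F2) where F1 > x, minus the
    running integral. This is locally constant: on the line above the gap the jumps of the first two
    terms cancel, below the gap neither jumps, and off the line the change of variables applies.
    Comparing its values at a and b gives the formula. *)
Lemma cell_formula a b (F1 F2 g2 : R -> R) L B x c c' s g M (th : R -> R) :
  a <= b -> 0 <= L -> continuous F1 -> lip L F2 -> (forall t, `|F2 t| <= B) ->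
  density a b F2 g2 L -> F1 a = F1 b -> F2 a = F2 b ->
  c <= s <= c' -> continuous g -> (forall y, `|g y| <= M) ->
  (forall y, ~ (c < y < c') -> g y = 0) ->
  (forall t, a <= t <= b -> F1 t = x -> F2 t < c \/ c' < F2 t) ->
  continuous th ->
  (forall t, a <= t <= b -> ang (F1 t - x) (F2 t - s) (th t)) ->
  \int[mu]_(t in `[a, b]) (\1_(above F1 x) t * (g (F2 t) * g2 t)) =
  (\int[mu]_(y in `[c, c']) g y) * ((th b - th a) / (2 * pi)).
Proof.
move=> ab L0 cF1 lF2 F2B D2 F1ab F2ab /andP[cs sc'] cg gM g0 sep cth thP.
have cF2 : continuous F2 by exact: lip_continuous lF2.
have pi0 := @pi_gt0 R.
have pi20 : 0 < 2 * pi :> R by rewrite mulr_gt0.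
set T := \int[mu]_(y in `[c, c']) g y.
pose m := Num.min (- B - 1) (c - 1).
have m1 : m <= - B - 1 by rewrite ge_min lexx.
have m2 : m <= c - 1 by rewrite ge_min lexx orbT.
have mF t : m < F2 t by have := F2B t; rewrite ler_norml => /andP[h _]; lra.
have mg : measurable_fun setT g by exact: continuous_measurable_fun.
pose Rg y := \int[mu]_(z in `[m, y]) g z.
have Rlo y : y <= c -> Rg y = 0.
  move=> yc; apply: Rintegral_itv_eq0 => z /andP[_ zy]; apply: g0 => /andP[cz _]; lra.
have Rhi y : c' <= y -> Rg y = T.
  move=> yc; rewrite /Rg (@Rintegral_itv_split _ g M m c y)//; [|lra|lra].
  rewrite (@Rintegral_itv_split _ g M c c' y)//; [|lra].
  rewrite (@Rintegral_itv_eq0 _ m c); last by move=> z /andP[z1 z2]; apply: g0 => /andP[]; lra.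
  rewrite (@Rintegral_itv_eq0 _ c' y) ?add0r ?addr0// => z /andP[z1 z2].
  by apply: g0 => /andP[]; lra.
have [mg2 g2L _ _] := D2.
pose k t := (\1_(above F1 x) t : R) * (g (F2 t) * g2 t).
have mk : measurable_fun setT k.
  apply: measurable_funM; first by apply: measurable_indic; exact: measurable_above.
  by apply: measurable_funM => //; apply: measurableT_comp => //; exact: continuous_measurable_fun.
have kM t : `|k t| <= 1 * (M * L).
  by apply: mul_bound; [exact: indic_bound|exact: mul_bound].
have k1 t : x < F1 t -> k t = g (F2 t) * g2 t.
  by move=> xF; rewrite /k indicE mem_set// mul1r.
have k0 t : F1 t <= x -> k t = 0.
  by move=> xF; rewrite /k indicE memNset ?mul0r// /above/=; apply/negP; rewrite -leNgt.
pose ph t := (th t - pi / 2) / (2 * pi).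
have cph : continuous ph.
  by move=> t; apply: cvgMl; apply: cvgB; [exact: cth|exact: cvg_cst].
pose H t := T * (Num.floor (ph t))%:~R + (\1_(above F1 x) t : R) * Rg (F2 t) -
  \int[mu]_(s in `[a, t]) k s.
have step u v : a <= u -> u <= v -> v <= b ->
    T * (Num.floor (ph u))%:~R + (\1_(above F1 x) u : R) * Rg (F2 u) + \int[mu]_(s in `[u, v]) k s =
    T * (Num.floor (ph v))%:~R + (\1_(above F1 x) v : R) * Rg (F2 v) -> H u = H v.
  move=> au uv vb E; rewrite /H -E (@Rintegral_itv_split _ k (1 * (M * L)) a u v)//.
  by ring.
have Hab : H a = H b.
  apply: locally_const_itv => // t tI.
  have [Q nQ QH] : exists2 Q : set R, nbhs t Q & forall u v, a <= u -> u <= v -> v <= b ->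
      (forall s, u <= s <= v -> Q s) -> H u = H v.
    (* In the first case the path is on the vertical ray above (x, s), hence above the gap, where Rg
       equals T and [floor_cos] shows that the jumps cancel. *)
    have [[n nE]|nn] := pselect (exists n : int, ph t = n%:~R).
      have thE : th t = pi / 2 + n%:~R * (2 * pi).
        by move: nE => /(congr1 (fun z => z * (2 * pi))); rewrite divfK ?gt_eqF// => <-; ring.
      have [tc ts] := trig_int n (pi / 2 : R).
      have [r r0 []] := thP t tI; rewrite thE tc ts cos_pihalf sin_pihalf mulr0 mulr1.
      move=> /eqP; rewrite subr_eq0 => /eqP F1t F2t.
      have F2c : c' < F2 t by case: (sep t tI F1t) => // F2c; lra.
      exists ([set z | c' < F2 z] `&` [set z | th t - pi / 2 < th z] `&` [set z | th z < th t + pi / 2]).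
        apply: filterI; first apply: filterI.
        - by exact: (cvgr_gt _ (cF2 t)).
        - by apply: (cvgr_gt _ (cth t)); lra.
        - by apply: (cvgr_lt _ (cth t)); lra.
      move=> u v au uv vb QQ.
      have one z : u <= z <= v -> (Num.floor (ph z))%:~R + (\1_(above F1 x) z : R) = n%:~R.
        move=> zI; have [[_ /= z1] /= z2] := QQ z zI.
        have zab : a <= z <= b by move/andP: zI => [z3 z4]; rewrite (le_trans au z3) (le_trans z4 vb).
        have [q q0 [qE _]] := thP z zab.
        have F1z : (x < F1 z) = (0 < cos (th z)) by rewrite -subr_gt0 qE pmulr_rgt0.
        rewrite indic_above F1z /ph (_ : th z = th t + (th z - th t)); last by rewrite addrC subrK.
        rewrite thE; apply: floor_cos; rewrite -thE; clear -z1 z2; lra.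
      have uI : u <= u <= v by rewrite lexx.
      have vI : u <= v <= v by rewrite lexx uv.
      apply: step => //; rewrite Rintegral_itv_eq0 ?addr0; last first.
        move=> z zI; have [[/= zc _] _] := QQ z zI.
        by rewrite /k g0 ?mul0r ?mulr0// => /andP[_ /(lt_trans zc)]; rewrite ltxx.
      have [[/= uc _] _] := QQ u uI; have [[/= vc _] _] := QQ v vI.
      rewrite !Rhi ?(ltW uc) ?(ltW vc)// ![_ * T]mulrC -!mulrDr.
      by rewrite !one.
    have nfl := floor_near (cph t) (fun n E => nn (ex_intro _ n E)).
    have [xF|Fx|F1t] := ltgtP x (F1 t).
    - exists ([set z | Num.floor (ph z) = Num.floor (ph t)] `&` [set z | x < F1 z]).
        by apply: filterI => //; exact: (cvgr_gt _ (cF1 t)).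
      move=> u v au uv vb QQ; apply: step => //.
      have [/= fu xu] := QQ u (introT andP (conj (lexx u) uv)).
      have [/= fv xv] := QQ v (introT andP (conj uv (lexx v))).
      rewrite fu fv !indicE !mem_set// !mul1r -addrA; congr (_ + _).
      transitivity (Rg (F2 u) + \int[mu]_(t in `[u, v]) (g (F2 t) * g2 t)).
        congr (_ + _); apply: eq_Rintegral => z; rewrite inE/= in_itv/= => zI.
        by rewrite k1//; have [] := QQ z zI.
      by rewrite -(density_chain L0 ab D2 lF2 mF cg gM au uv vb) addrC subrK.
    - exists ([set z | Num.floor (ph z) = Num.floor (ph t)] `&` [set z | F1 z < x]).
        by apply: filterI => //; exact: (cvgr_lt _ (cF1 t)).
      move=> u v au uv vb QQ; apply: step => //.
      have [/= fu xu] := QQ u (introT andP (conj (lexx u) uv)).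
      have [/= fv xv] := QQ v (introT andP (conj uv (lexx v))).
      rewrite fu fv !indicE !memNset /above/=; try by apply/negP; rewrite -leNgt ltW.
      rewrite Rintegral_itv_eq0 ?addr0 ?mul0r// => z zI.
      by have [_ /= zx] := QQ z zI; rewrite k0// ltW.
    (* A point of the line above the gap would have angle pi / 2 up to full turns, which is the case
       treated before. *)
    have F2c : F2 t < c.
      case: (sep t tI (esym F1t)) => // F2c.
      have [r r0 [e1 e2]] := thP t tI; exfalso.
      have c0 : cos (th t) = cos (pi / 2 : R).
        by move: e1; rewrite -F1t subrr cos_pihalf => /esym/eqP; rewrite mulf_eq0 gt_eqF//= => /eqP.
      have s1 : sin (th t) = sin (pi / 2 : R).
        have := cos2Dsin2 (th t); rewrite c0 cos_pihalf expr0n/= add0r sin_pihalf => /eqP.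
        rewrite sqrf_eq1 => /orP[/eqP//|/eqP sm]; exfalso; move: e2; rewrite sm; lra.
      have [n nE] := trig_eq c0 s1; apply: nn; exists n.
      by rewrite /ph nE addrC addKr mulfK// gt_eqF.
    exists ([set z | Num.floor (ph z) = Num.floor (ph t)] `&` [set z | F2 z < c]).
      by apply: filterI => //; exact: (cvgr_lt _ (cF2 t)).
    move=> u v au uv vb QQ; apply: step => //.
    have [/= fu xu] := QQ u (introT andP (conj (lexx u) uv)).
    have [/= fv xv] := QQ v (introT andP (conj uv (lexx v))).
    rewrite fu fv !Rlo ?ltW// !mulr0 Rintegral_itv_eq0 ?addr0// => z zI.
    have [_ /= zx] := QQ z zI; rewrite /k g0 ?mul0r ?mulr0// => /andP[/(lt_trans zx)].
    by rewrite ltxx.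
  move/nbhs_ballP: nQ => [e /= e0 eQ]; exists e => // u v /andP[au ub] /andP[av vb] ue ve uv.
  apply: QH => // z /andP[uz zv]; apply: eQ; rewrite /ball/= distrC ltr_norml.
  by move: ue ve uz zv; rewrite !ltr_norml; clear => /andP[? ?] /andP[? ?] ? ?; apply/andP; split; lra.
have aI : a <= a <= b by rewrite lexx ab.
have bI : a <= b <= b by rewrite lexx ab.
have [n nE] : exists n : int, th b = th a + n%:~R * (2 * pi).
  by apply: ang_uniq (thP b bI) _; rewrite -F1ab -F2ab; exact: thP.
have fE : Num.floor (ph b) = Num.floor (ph a) + n.
  apply/eqP; rewrite floor_eq.
  have -> : ph b = ph a + n%:~R by rewrite /ph nE addrAC mulrDl mulfK// gt_eqF.
  rewrite -addrA (addrC n) addrA !intrD lerD2r ltrD2r floor_le.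
  by rewrite -[1]/(1%:~R) -intrD floorD1_gt.
have -> : (th b - th a) / (2 * pi) = n%:~R by rewrite nE addrAC subrr add0r mulfK// gt_eqF.
move: Hab; rewrite /H fE -F2ab set_itv1 Rintegral_set1 subr0 intrD mulrDr.
have -> : (\1_(above F1 x) b : R) = \1_(above F1 x) a.
  by rewrite !indic_above F1ab.
rewrite -/k; lra.
Qed.

End Cell.

(** * Green's formula on a vertical line *)

Section Slice.
Context {R : realType}.
Notation mu := (@lebesgue_measure R).
Implicit Types (a b x y t s c L M N B V W e : R).

(** Lowering the loop instead of raising the center is a homotopy of closed loops that miss the
    center; the variation of the angle is a continuous function with values in the multiples of 2
    pi. *)
Lemma winds_segment (c : R -> R * R) x s s' n : continuous c -> c 0 = c 1 -> s <= s' ->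
  (forall t, 0 <= t <= 1 -> (c t).1 = x -> ~ s <= (c t).2 <= s') ->
  winds c (x, s) n -> winds c (x, s') n.
Proof.
move=> cc c01 ss' sep wn.
pose H (z : R * R) : R * R := ((c (clamp 0 1 z.2)).1, (c (clamp 0 1 z.2)).2 - clamp 0 1 z.1 * (s' - s)).
have cH : continuous H.
  apply: continuous_pair; first by apply: continuous_fst1; apply: (@continuous_snd_comp _ _ (c \o clamp 0 1)) => t; apply: continuous_comp; [exact: continuous_clamp|exact: cc].
  move=> z; apply: cvgB; first by apply: continuous_snd1; apply: (@continuous_snd_comp _ _ (c \o clamp 0 1)) => t; apply: continuous_comp; [exact: continuous_clamp|exact: cc].
  by apply: cvgMl; apply: continuous_fst_comp; exact: continuous_clamp.
have [z|Th cTh ThP] := @square_lift_at R H (x, s) cH.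
  rewrite /H/= => -[E1 E2].
  have I1 : 0 <= clamp 0 1 (clamp 0 1 z.1) <= 1 by exact: clamp_itv.
  have I2 : 0 <= clamp 0 1 (clamp 0 1 z.2) <= 1 by exact: clamp_itv.
  apply: (sep _ I2 E1); rewrite -(subrK (clamp 0 1 (clamp 0 1 z.1) * (s' - s)) (c _).2) E2.
  move/andP: I1 => [i1 i2]; have ss0 : 0 <= s' - s by rewrite subr_ge0.
  rewrite lerDl mulr_ge0//= -lerBrDl.
  by rewrite -[X in _ <= X]mul1r ler_wpM2r.
have i0 : 0 <= (0 : R) <= 1 by rewrite lexx ler01.
have i1 : 0 <= (1 : R) <= 1 by rewrite lexx ler01.
have cT t : continuous (fun u => Th (u, t)) by have [] := continuous_const_pair t t cTh.
have E : Th (0, 1) - Th (0, 0) = Th (1, 1) - Th (1, 0).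
  apply: (@int_valued_const R (fun u => Th (u, 1) - Th (u, 0)) 0 1) => //.
    by move=> t; apply: cvgB; exact: cT.
  move=> t tI; have h1 := ThP t 1 tI i1; have h0 := ThP t 0 tI i0.
  have [n' nE] : exists n' : int, Th (t, 1) = Th (t, 0) + n'%:~R * (2 * pi).
    by apply: ang_uniq h1 _; move: h0; rewrite /H/= !(@clamp_id _ 0 1) ?i0 ?i1// c01.
  by exists n'; rewrite nE addrAC subrr add0r.
have w0 : winds c (x, s) (Th (0, 1) - Th (0, 0)).
  exists (fun t => Th (0, t)); split => //; first by have [] := continuous_const_pair 0 0 cTh.
  by move=> t tI; have := ThP 0 t i0 tI; rewrite /H/= (@clamp_id _ 0 1 0)// (@clamp_id _ 0 1 t)// mul0r subr0.
rewrite (winds_uniq wn w0) E; exists (fun t => Th (1, t)); split => //.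
  by have [] := continuous_const_pair 1 0 cTh.
move=> t tI; have := ThP 1 t i1 tI; rewrite /H/= (@clamp_id _ 0 1 1)// (@clamp_id _ 0 1 t)// mul1r.
by congr ang; rewrite /=; ring.
Qed.

Definition rescale a b (F1 F2 : R -> R) t : R * R :=
  (F1 (a + t * (b - a)), F2 (a + t * (b - a))).

Lemma winds_rescale a b (F1 F2 : R -> R) p n : a < b -> winds (rescale a b F1 F2) p n ->
  exists th : R -> R, [/\ continuous th,
    forall t, a <= t <= b -> ang (F1 t - p.1) (F2 t - p.2) (th t) & th b - th a = n].
Proof.
move=> ab [th [cth thP thE]].
have ba : 0 < b - a by rewrite subr_gt0.
exists (fun t => th ((t - a) / (b - a))); split.
- move=> t; apply: continuous_comp; last exact: cth.
  by apply: cvgMl; apply: cvgB; [exact: cvg_id|exact: cvg_cst].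
- move=> t /andP[t1 t2].
  have := thP ((t - a) / (b - a)); rewrite /rescale/= divfK ?gt_eqF// (addrC a) subrK; apply.
  by rewrite divr_ge0 ?subr_ge0 ?(ltW ab)//= ler_pdivrMr// mul1r lerB.
- by rewrite subrr mul0r divff ?gt_eqF.
Qed.

Section Green.
Variables (a b : R) (F1 F2 g2 : R -> R) (L B x : R) (K : set R) (w : R -> R) (W N : R).
Hypotheses (ab : a < b) (L0 : 0 <= L) (cF1 : continuous F1) (lF2 : lip L F2)
  (F2B : forall t, `|F2 t| <= B) (D2 : density a b F2 g2 L)
  (F1ab : F1 a = F1 b) (F2ab : F2 a = F2 b)
  (cK : closed K) (K0 : mu K = 0%E) (Kn : K !=set0)
  (FK : forall t, a <= t <= b -> F1 t = x -> K (F2 t))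
  (mw : measurable_fun setT w) (wW : forall s, `|w s| <= W)
  (wn : forall s, ~ K s -> winds (rescale a b F1 F2) (x, s) (2 * pi * w s))
  (BN : B + 1 <= N) (w0 : forall s, N - 1 <= `|s| -> w s = 0).

(** The defect in Green's formula on the line. It is additive in [v] and is shown to vanish for [v]
    supported in one gap of [K], then for [v] vanishing near [K]; a limit gives the general case. *)
Let slice_gap v := \int[mu]_(t in `[a, b]) (\1_(above F1 x) t * (v (F2 t) * g2 t)) -
  \int[mu]_(s in `[- N, N]) (w s * v s).

Let bc (v : R -> R) := continuous v /\ exists V, forall s, `|v s| <= V.

Let mg2 : measurable_fun setT g2. Proof. by case: D2. Qed.
Let g2L t : `|g2 t| <= L. Proof. by case: D2. Qed.
Let cF2 : continuous F2. Proof. exact: lip_continuous lF2. Qed.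
Let N1 : 1 <= N. Proof. by apply: le_trans BN; rewrite lerDr (le_trans _ (F2B 0)). Qed.

Let m1 v : bc v -> measurable_fun setT (fun t => (\1_(above F1 x) t : R) * (v (F2 t) * g2 t)).
Proof.
move=> [cv _]; apply: measurable_funM; first by apply: measurable_indic; exact: measurable_above.
by apply: measurable_funM => //; apply: measurableT_comp; exact: continuous_measurable_fun.
Qed.

Let b1 v V : (forall s, `|v s| <= V) -> forall t, `|(\1_(above F1 x) t : R) * (v (F2 t) * g2 t)| <= 1 * (V * L).
Proof. by move=> vV t; apply: mul_bound; [exact: indic_bound|exact: mul_bound]. Qed.

Let m2 v : bc v -> measurable_fun setT (fun s => w s * v s).
Proof. by move=> [cv _]; apply: measurable_funM => //; exact: continuous_measurable_fun. Qed.

Let gapD u v : bc u -> bc v -> slice_gap (fun s => u s + v s) = slice_gap u + slice_gap v.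
Proof.
move=> bu bv; have [cu [U uU]] := bu; have [cv [V vV]] := bv.
rewrite /slice_gap addrACA -opprD -!RintegralD//.
- by congr (_ - _); apply: eq_Rintegral => t _; ring.
- by apply: (@bounded_integrable _ _ _ _ (W * U)) => [|t]; [exact: m2|exact: mul_bound].
- by apply: (@bounded_integrable _ _ _ _ (W * V)) => [|t]; [exact: m2|exact: mul_bound].
- by apply: (@bounded_integrable _ _ _ _ (1 * (U * L))) => [|t]; [exact: m1|exact: b1].
- by apply: (@bounded_integrable _ _ _ _ (1 * (V * L))) => [|t]; [exact: m1|exact: b1].
Qed.

Let gap_eq u v : (forall s, `|s| <= N - 1 -> u s = v s) -> slice_gap u = slice_gap v.
Proof.
move=> uv; rewrite /slice_gap; congr (_ - _); apply: eq_Rintegral => t _.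
  by rewrite uv// (le_trans (F2B t))// lerBrDr.
have [/uv->//|/ltW/w0 ->] := leP `|t| (N - 1).
by rewrite !mul0r.
Qed.

Let gap0 : slice_gap (cst 0) = 0.
Proof.
rewrite /slice_gap !Rintegral_itv_eq0 ?subr0// => t _; first by rewrite mulr0.
by rewrite mul0r mulr0.
Qed.

Let winds_loop s n : winds (rescale a b F1 F2) (x, s) n ->
  exists th : R -> R, [/\ continuous th,
    forall t, a <= t <= b -> ang (F1 t - x) (F2 t - s) (th t) & th b - th a = n].
Proof. exact: winds_rescale. Qed.

(** The winding number is constant along the gap by [winds_segment], so both sides equal its value
    times the integral of [v]. *)
Let gap_cell c c' v : bc v -> c <= c' -> - N <= c -> c' <= N ->
  (forall s, ~ (c < s < c') -> v s = 0) -> (forall s, c <= s <= c' -> ~ K s) ->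
  slice_gap v = 0.
Proof.
move=> bv cc' Nc cN v0 KI; have [cv [V vV]] := bv.
have wc s : c <= s <= c' -> w s = w c.
  move=> /andP[cs sc].
  have nKc : ~ K c by apply: KI; rewrite lexx.
  have nKs : ~ K s by apply: KI; rewrite cs.
  have pi0 : 2 * pi != 0 :> R by rewrite mulf_neq0// gt_eqF// pi_gt0.
  apply: (mulfI pi0); apply: winds_uniq (wn nKs) _.
  apply: winds_segment cs _ (wn nKc) => [||t tI /= F1x].
  - apply: continuous_pair => t.
      apply: (@continuous_comp _ _ _ (fun t => a + t * (b - a)) F1); last exact: cF1.
      by apply: cvgD; [exact: cvg_cst|apply: cvgMl; exact: cvg_id].
    apply: (@continuous_comp _ _ _ (fun t => a + t * (b - a)) F2); last exact: cF2.
    by apply: cvgD; [exact: cvg_cst|apply: cvgMl; exact: cvg_id].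
  - by rewrite /rescale !mul0r !mul1r !addr0 (addrC a) subrK F1ab F2ab.
  - move=> /andP[h1 h2]; apply: (KI (F2 (a + t * (b - a)))).
      by rewrite h1 (le_trans h2).
    apply: FK => //; case/andP: tI => t0 t1; have ba : 0 <= b - a by rewrite subr_ge0 ltW.
    by rewrite lerDl mulr_ge0//= -lerBrDl ler_piMl.
have nKc : ~ K c by apply: KI; rewrite lexx.
have [th [cth thP thE]] := winds_loop (wn nKc).
have cI : c <= c <= c' by rewrite lexx.
rewrite /slice_gap (@cell_formula R a b F1 F2 g2 L B x c c' c v V th) ?(ltW ab)//; last first.
  - move=> t tI F1t; have Kt := FK tI F1t.
    have [|h1] := ltP (F2 t) c; first by left.
    by have [|h2] := ltP c' (F2 t); [right|case: (KI (F2 t)) => //; rewrite h1].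
have pi0 : 2 * pi != 0 :> R by rewrite mulf_neq0// gt_eqF// pi_gt0.
rewrite thE (mulrC (2 * pi)) mulfK//.
rewrite (@Rintegral_itv_split _ _ (W * V) (- N) c N)//; last 3 first.
- exact: le_trans cN.
- exact: m2.
- by move=> t; exact: mul_bound.
rewrite (@Rintegral_itv_split _ _ (W * V) c c' N)//; last 2 first.
- exact: m2.
- by move=> t; exact: mul_bound.
rewrite (@Rintegral_itv_eq0 _ _ (- N) c); last first.
  by move=> t /andP[_ tc]; rewrite v0 ?mulr0// ltNge tc.
rewrite (@Rintegral_itv_eq0 _ _ c' N) ?add0r ?addr0; last first.
  by move=> t /andP[tc _]; rewrite v0 ?mulr0// !ltNge tc andbF.
rewrite -RintegralZr//; last first.
  by apply: bounded_integrable vV; exact: continuous_measurable_fun.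
apply/eqP; rewrite subr_eq0; apply/eqP; apply: eq_Rintegral => t.
by rewrite inE/= in_itv/= => /wc ->; rewrite mulrC.
Qed.

(** Partition of unity by the tents [chi i - chi i.+1], supported on intervals of length 2 eta < e.
    If such an interval meets [K], then [v] vanishes inside it; otherwise it lies in a gap. *)
Let gap_far v e : bc v -> 0 < e -> (forall s, dist_to K s < e -> v s = 0) -> slice_gap v = 0.
Proof.
move=> bv e0 v0; have [cv [V vV]] := bv.
have N0 : 0 < N by rewrite (lt_le_trans _ N1).
pose n := (Num.truncn (2 * N + 4 * N / e)).+1.
have n1 : 2 * N + 4 * N / e < n%:R by exact: truncnS_gt.
have q0 : 0 < 4 * N / e by rewrite divr_gt0// mulr_gt0.
have n0 : 0 < n.+1%:R :> R by rewrite ltr0n.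
(* With this mesh the last of the [n] tents ends exactly at N, and [eta <= 1] makes the tents add up
   to 1 where |s| <= N - 1. *)
pose eta := 2 * N / n.+1%:R.
have eta0 : 0 < eta by rewrite divr_gt0// mulr_gt0.
have etaE : eta * n.+1%:R = 2 * N by rewrite divfK// gt_eqF.
have eta1 : eta <= 1.
  rewrite ler_pdivrMr// mul1r -natr1; lra.
have eta2 : 2 * eta < e.
  have : 2 * (2 * N) / e < n.+1%:R by rewrite -natr1 (_ : 2 * (2 * N) = 4 * N) ?mulrA; [lra|ring].
  move=> h; rewrite (_ : 2 * eta = 2 * (2 * N) / n.+1%:R) /eta ?mulrA//.
  by rewrite ltr_pdivrMr// (mulrC e) -ltr_pdivrMr// -mulrA.
pose chi (i : nat) s : R := clamp 0 1 ((s + N) / eta - i%:R).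
have cchi i : continuous (chi i).
  move=> s; apply: (@continuous_comp _ _ _ (fun s => (s + N) / eta - i%:R) (clamp 0 1)).
    by apply: cvgB; [apply: cvgMl; apply: cvgD; [exact: cvg_id|exact: cvg_cst]|exact: cvg_cst].
  exact: continuous_clamp.
have chiB i s : `|chi i s| <= 1.
  by have /andP[h1 h2] := clamp_itv ((s + N) / eta - i%:R) (@ler01 R); rewrite /chi ger0_norm.
have bcd i j : bc (fun s => v s * (chi i s - chi j s)).
  split; first by move=> s; apply: cvgM; [exact: cv|apply: cvgB; exact: cchi].
  exists (V * (1 + 1)) => s; apply: mul_bound => //.
  by apply: (le_trans (ler_normB _ _)); apply: lerD.
have chi0 (i : nat) s : s <= - N + i%:R * eta -> chi i s = 0.
  by move=> si; apply: clamp_le => //; rewrite subr_le0 ler_pdivrMr//; lra.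
have chi1 (i : nat) s : - N + (i%:R + 1) * eta <= s -> chi i s = 1.
  by move=> si; apply: clamp_ge => //; rewrite lerBrDr ler_pdivlMr//; lra.
have cell i : (i < n)%N -> slice_gap (fun s => v s * (chi i s - chi i.+1 s)) = 0.
  move=> i_n; pose c := - N + i%:R * eta; pose c' := - N + (i%:R + 2) * eta.
  have cc' : c <= c' by rewrite /c /c' lerD2l ler_wpM2r ?(ltW eta0) ?lerDl//.
  have out s : ~ (c < s < c') -> v s * (chi i s - chi i.+1 s) = 0.
    move=> /negP; rewrite negb_and -!leNgt => /orP[sc|sc].
      rewrite !chi0 ?subrr ?mulr0//.
      by apply: (le_trans sc); rewrite /c lerD2l ler_wpM2r ?(ltW eta0)// -natr1 lerDl.
    rewrite !chi1 ?subrr ?mulr0//; first by move: sc; rewrite /c' -natr1; lra.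
    by apply: le_trans sc; rewrite /c' lerD2l ler_wpM2r ?ltW//; lra.
  have [[z [zI Kz]]|nz] := pselect (exists z, c <= z <= c' /\ K z).
    rewrite -gap0; apply: gap_eq => s _ /=.
    have [/andP[s1 s2]|/out//] := pselect (c < s < c').
    rewrite v0 ?mul0r//; apply: le_lt_trans (dist_to_le _ Kz) _.
    apply: lt_trans eta2; move: zI s1 s2; rewrite /c /c' => /andP[z1 z2] s1 s2.
    by rewrite ltr_norml; apply/andP; split; lra.
  apply: (gap_cell (bcd _ _) cc') => //.
  - by rewrite /c lerDl mulr_ge0// ltW.
  - have : (i%:R + 2) * eta <= n.+1%:R * eta.
      rewrite ler_wpM2r ?(ltW eta0)// -natrD ler_nat addn2; exact: i_n.
    by rewrite /c'; lra.
  - by move=> s sI Ks; apply: nz; exists s.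
have tel i : (i <= n)%N -> slice_gap (fun s => v s * (chi 0%N s - chi i s)) = 0.
  elim: i => [|i IH] i_n.
    by rewrite -gap0; apply: gap_eq => s _; rewrite subrr mulr0.
  transitivity (slice_gap (fun s => v s * (chi 0%N s - chi i s) + v s * (chi i s - chi i.+1 s))).
    by apply: gap_eq => s _; ring.
  by rewrite gapD// cell// IH ?addr0// ltnW.
rewrite -(tel n (leqnn n)); apply: gap_eq => s; rewrite ler_norml => /andP[s1 s2].
rewrite chi1 ?add0r ?mul1r; last by lra.
rewrite chi0 ?subr0 ?mulr1//.
by move: etaE; rewrite -natr1; lra.
Qed.

(** Multiply [v] by cutoffs that vanish near [K] and pass to the limit. What is lost on [K] has no
    weight: on the right [K] is null, and on the left [g2] vanishes almost everywhere on its
    preimage. *)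
Lemma slice_green (v : R -> R) V : continuous v -> (forall s, `|v s| <= V) ->
  \int[mu]_(t in `[a, b]) (\1_(above F1 x) t * (v (F2 t) * g2 t)) =
  \int[mu]_(s in `[- N, N]) (w s * v s).
Proof.
move=> cv vV.
have V0 : 0 <= V by exact: le_trans (vV 0).
pose ps (n : nat) s : R := clamp 0 1 (n%:R * dist_to K s - 1).
have cps n : continuous (ps n).
  move=> s; apply: (@continuous_comp _ _ _ (fun s => n%:R * dist_to K s - 1) (clamp 0 1)).
    by apply: cvgB; [apply: cvgMr; exact: (lip_continuous (dist_to_lip Kn))|exact: cvg_cst].
  exact: continuous_clamp.
have psB n s : `|ps n s| <= 1.
  by have /andP[h1 h2] := clamp_itv (n%:R * dist_to K s - 1) (@ler01 R); rewrite /ps ger0_norm.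
have psK s : ps n s @[n --> \oo] --> (\1_(~` K) s : R).
  rewrite indicE; have [Ks|Ks] := pselect (K s).
    rewrite memNset; last by move=> /(_ Ks).
    rewrite (_ : (fun n => _) = cst 0); first exact: cvg_cst.
    by apply/funext => n; rewrite /ps dist_to_eq0// mulr0 clamp_le//; lra.
  rewrite mem_set//; apply: cvg_near_cst.
  have d0 := dist_to_gt0 cK Ks Kn.
  near=> n; apply: clamp_ge => //; rewrite lerBrDr -ler_pdivrMr//.
  by near: n; exact: nbhs_infty_ger.
pose vn n s := v s * ps n s.
have vnV n s : `|vn n s| <= V * 1 by apply: mul_bound.
have bvn n : bc (vn n).
  by split; [move=> s; apply: cvgM; [exact: cv|exact: cps]|exists (V * 1)].
have E n : \int[mu]_(t in `[a, b]) (\1_(above F1 x) t * (vn n (F2 t) * g2 t)) =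
    \int[mu]_(s in `[- N, N]) (w s * vn n s).
  apply/eqP; rewrite -subr_eq0; apply/eqP.
  apply: (@gap_far _ n.+1%:R^-1) => // s sd.
  rewrite /vn /ps clamp_le ?mulr0// subr_le0.
  have [->|n0] := eqVneq n 0%N; first by rewrite mul0r.
  have np : 0 < n%:R :> R by rewrite ltr0n lt0n.
  rewrite -ler_pdivlMl// mulr1 (le_trans (ltW sd))// lef_pV2 ?posrE ?ltr0n ?lt0n//.
  by rewrite ler_nat.
have mK : measurable K by exact: closed_measurable.
have mcK : measurable_fun setT (\1_(~` K) : R -> R) by apply: measurable_indic; exact: measurableC.
have C1 : \int[mu]_(t in `[a, b]) (\1_(above F1 x) t * (vn n (F2 t) * g2 t)) @[n --> \oo] -->
    \int[mu]_(t in `[a, b]) (\1_(above F1 x) t * ((v (F2 t) * \1_(~` K) (F2 t)) * g2 t)).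
  apply: (@bounded_cvg_Rintegral _ _ _ _ _ _ _ (1 * (V * 1 * L))) => //.
  - exact: lebesgue_itv_fin.
  - by move=> n; apply: measurable_funTS; exact: m1.
  - by move=> n t _; exact: b1.
  - move=> t _; apply: cvgMr; apply: cvgMl; apply: cvgMr; exact: psK.
have C2 : \int[mu]_(s in `[- N, N]) (w s * vn n s) @[n --> \oo] -->
    \int[mu]_(s in `[- N, N]) (w s * (v s * \1_(~` K) s)).
  apply: (@bounded_cvg_Rintegral _ _ _ _ _ _ _ (W * (V * 1))) => //.
  - exact: lebesgue_itv_fin.
  - by move=> n; apply: measurable_funTS; exact: m2.
  - by move=> n t _; exact: mul_bound.
  - by move=> t _; apply: cvgMr; apply: cvgMr; exact: psK.
transitivity (\int[mu]_(t in `[a, b]) (\1_(above F1 x) t * ((v (F2 t) * \1_(~` K) (F2 t)) * g2 t))).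
  apply: (@Rintegral_ae _ a b) => //.
  apply: ae_imply (null_preimage L0 (ltW ab) D2 lF2 F2B cK K0) => t H at_ tb.
  have [Kt|Kt] := pselect (K (F2 t)); first by rewrite H// !mulr0.
  by rewrite [\1_(~` K) _]indicE mem_set// mulr1.
transitivity (\int[mu]_(s in `[- N, N]) (w s * (v s * \1_(~` K) s))).
  by move: C1; rewrite (funext E) => C1; apply: cvg_unique C1 C2; exact: Rhausdorff.
rewrite /Rintegral; congr fine.
apply: (@integral_off_null _ _ _ mu K) => // s _ Ks.
by rewrite [\1_(~` K) _]indicE mem_set// mulr1.
Unshelve. all: by end_near. Qed.

End Green.

End Slice.

(** * Null sets, Fubini and Green's formula in the plane *)

Section Plane.
Context {R : realType}.
Notation mu := (@lebesgue_measure R).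
Implicit Types (a b c d x y t s L M N B V W e : R) (U G : set (R * R)).

Lemma ball_prodE (x y e : R) : ball ((x, y) : R * R) e = `]x - e, x + e[ `*` `]y - e, y + e[.
Proof.
have E (z w : R) : (ball z e w) = (`|z - w| < e) by [].
apply/seteqP; split => -[u v]; rewrite -[ball _ _ _]/(ball x e u /\ ball y e v) !E /= !in_itv/= !ltr_norml.
  by move=> [/andP[h1 h2] /andP[h3 h4]]; split; apply/andP; split; lra.
by move=> [/andP[h1 h2] /andP[h3 h4]]; split; apply/andP; split; lra.
Qed.

(** Measurability in the plane refers to the product sigma-algebra; an open set is a countable union
    of open squares with rational center and radius. *)
Lemma open_measurable_plane U : open U -> measurable U.
Proof.
move=> oU.
pose A (p q r : rat) : set (R * R) :=
  if `[< ball ((ratr p, ratr q) : R * R) (ratr r : R) `<=` U >] then ball ((ratr p, ratr q) : R * R) (ratr r : R) else set0.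
suff -> : U = \bigcup_p \bigcup_q \bigcup_r A p q r.
  apply: bigcupT_measurable_rat => p; apply: bigcupT_measurable_rat => q.
  apply: bigcupT_measurable_rat => r; rewrite /A; case: ifP => // _.
  by rewrite ball_prodE; apply: measurableX; exact: measurable_itv.
apply/seteqP; split => [[x y] Uxy|z [p _ [q _ [r _]]]]; last first.
  by rewrite /A; case: asboolP => // h; exact: h.
have : nbhs (x, y) U by exact: open_nbhs_nbhs.
move=> /nbhs_ballP[e /= e0 eU].
have e2 : 0 < e / 2 by rewrite divr_gt0.
have [r /andP[r0 re]] : exists r : rat, (0 : R) < ratr r < e / 2.
  by have [r] := rat_in_itvoo e2; rewrite in_itv/= => rI; exists r.
have near (z : R) : exists p : rat, z - ratr r < ratr p < z.
  have [|p] := @rat_in_itvoo R (z - ratr r) z; first by rewrite ltrBlDr ltrDl.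
  by rewrite in_itv/= => pI; exists p.
have [p /andP[p1 p2]] := near x; have [q /andP[q1 q2]] := near y.
exists p => //; exists q => //; exists r => //; rewrite /A.
have BB : ball ((ratr p, ratr q) : R * R) (ratr r : R) `<=` U.
  rewrite ball_prodE => -[u v] /= []; rewrite !in_itv/= => /andP[u1 u2] /andP[v1 v2].
  apply: eU; rewrite ball_prodE/= !in_itv/=.
  clear -p1 p2 q1 q2 u1 u2 v1 v2 r0 re; split; apply/andP; split; lra.
by rewrite asboolT// ball_prodE/=; split; rewrite in_itv/=; apply/andP; split; lra.
Qed.

Lemma closed_measurable_plane G : closed G -> measurable G.
Proof.
by move=> cG; rewrite -[G]setCK; apply: measurableC; apply: open_measurable_plane; exact: closed_openC.
Qed.

(** The arc is covered by n + 1 squares of side 2L / n centered on it, of total area of order 1 /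
    n. *)
Lemma lipschitz_arc_null (h : R -> R * R) L G :
  (forall s t, 0 <= s <= 1 -> 0 <= t <= 1 -> `|h s - h t| <= L * `|s - t|) ->
  G = h @` `[0, 1] -> measurable G -> (mu \x mu)%E G = 0%E.
Proof.
move=> lh GE mG.
have L0 : 0 <= L.
  have := lh 0 1; rewrite !lexx !ler01 sub0r normrN1 mulr1 => /(_ isT isT); exact: le_trans.
have bound (n : nat) : (0 < n)%N -> ((mu \x mu) G <= (8 * L ^+ 2 / n%:R)%:E)%E.
  move=> n0; have np : 0 < n%:R :> R by rewrite ltr0n.
  pose A (i : nat) : set (R * R) := let z := h (i%:R / n%:R) in
    `[z.1 - L / n%:R, z.1 + L / n%:R] `*` `[z.2 - L / n%:R, z.2 + L / n%:R].
  have mA i : measurable (A i) by apply: measurableX; exact: measurable_itv.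
  have muA i : (mu \x mu)%E (A i) = ((2 * L / n%:R) ^+ 2)%:E.
    have q0 : 0 <= L / n%:R by rewrite divr_ge0// ltW.
    have E z : mu `[z - L / n%:R, z + L / n%:R]%classic = (2 * L / n%:R)%:E.
      rewrite lebesgue_measure_itv/= lte_fin; case: ltP => qq; first by rewrite -EFinD; congr EFin; ring.
      by congr EFin; lra.
    rewrite /A product_measure1E; [|exact: measurable_itv|exact: measurable_itv].
    rewrite expr2 EFinM; congr (_ * _)%E; exact: E.
  have sub : G `<=` \big[setU/set0]_(i < n.+1) A i.
    rewrite GE => _ [t tI <-]; move: tI; rewrite /= in_itv/= => /andP[t0 t1].
    have tn0 : 0 <= t * n%:R by rewrite mulr_ge0// ltW.
    pose i := Num.truncn (t * n%:R).
    have /andP[i1 i2] := truncn_itv tn0.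
    have i_n : (i < n.+1)%N.
      by rewrite ltnS -(ler_nat R) (le_trans i1)// ler_piMl// ltW.
    rewrite -(bigcup_mkord n.+1 A); exists i => //.
    have I0 : 0 <= (i%:R / n%:R : R) <= 1.
      rewrite divr_ge0//=.
      by rewrite ler_pdivrMr// mul1r ler_nat -ltnS.
    have tI : 0 <= t <= 1 by rewrite t0.
    have := lh _ _ tI I0; set z := h (i%:R / n%:R).
    have tt : `|t - i%:R / n%:R| <= n%:R^-1.
      rewrite ger0_norm; last by rewrite subr_ge0 ler_pdivrMr.
      rewrite lerBlDl -[X in _ <= _ + X]mul1r -mulrDl ler_pdivlMr//.
      by rewrite natr1 ltW.
    move=> /le_trans/(_ (ler_wpM2l L0 tt)).
    rewrite prod_normE ge_max/= !ler_norml => /andP[/andP[h1 h2] /andP[h3 h4]].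
    rewrite /A -/z /= !in_itv/=; clear -h1 h2 h3 h4; split; apply/andP; split; lra.
  have cs := @content_subadditive _ _ _ (mu \x mu)%E G A n.+1 (fun i _ => mA i) mG sub.
  apply: (le_trans cs).
  apply: (@le_trans _ _ (\sum_(k < n.+1) ((2 * L / n%:R) ^+ 2)%:E)%E).
    by apply: lee_sum => k _; rewrite le_eqVlt; apply/orP; left; apply/eqP; exact: muA.
  rewrite sumEFin lee_fin sumr_const card_ord -(mulr_natl (_ ^+ 2) n.+1).
  rewrite ler_pdivlMr//
    (_ : n.+1%:R * (2 * L / n%:R) ^+ 2 * n%:R = 4 * L ^+ 2 * (n.+1%:R / n%:R)); last first.
    by field; rewrite ?gt_eqF// pnatr_eq0 -lt0n.
  rewrite (_ : 8 * L ^+ 2 = 4 * L ^+ 2 * 2); last by ring.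
  rewrite ler_wpM2l ?mulr_ge0 ?sqr_ge0// ler_pdivrMr// -natrM ler_nat.
  by rewrite mul2n -addnn -addn1 leq_add2l.
apply/eqP; rewrite eq_le measure_ge0 andbT; apply/lee_addgt0Pr => e e0; rewrite add0e.
pose n := (Num.truncn (8 * L ^+ 2 / e)).+1.
apply: (le_trans (bound n _)) => //; rewrite lee_fin ler_pdivrMr ?ltr0n// (mulrC e) -ler_pdivrMr//.
by apply/ltW; exact: truncnS_gt.
Qed.

Lemma Rfubini (h : R * R -> R) a b c d M : measurable_fun setT h -> (forall z, `|h z| <= M) ->
  \int[mu]_(x in `[a, b]) (\int[mu]_(y in `[c, d]) h (x, y)) =
  \int[mu]_(y in `[c, d]) (\int[mu]_(x in `[a, b]) h (x, y)).
Proof.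
move=> mh hM.
pose D := `[a, b]%classic `*` `[c, d]%classic : set (R * R).
have mD : measurable D by apply: measurableX; exact: measurable_itv.
pose f : R * R -> \bar R := (EFin \o h) \_ D.
have Df : (mu \x mu)%E.-integrable setT f.
  have [+ _] := @integrable_mkcond _ _ _ (mu \x mu)%E D (EFin \o h) mD; apply.
  apply: measurable_bounded_integrable => //.
  - have E : (mu \x mu)%E D = (mu `[a, b]%classic * mu `[c, d]%classic)%E.
      by apply: product_measure1E; exact: measurable_itv.
    suff : (mu `[a, b]%classic * mu `[c, d]%classic < +oo)%E by rewrite -E.
    by rewrite lte_mul_pinfty// ?ge0_fin_numE ?lebesgue_itv_fin.
  - exact: measurable_funTS.
  - by exists M; split; rewrite ?num_real// => N MN z _; apply: (le_trans (hM z)); exact: ltW.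
have := Fubini Df.
have mx x : measurable_fun setT (fun y => h (x, y)) by exact: measurable_fun_pair2.
have my y : measurable_fun setT (fun x => h (x, y)) by exact: measurable_fun_pair1.
have Ex x : (\int[mu]_y f (x, y))%E = ((fun x => (\int[mu]_(y in `[c, d]) h (x, y))%:E) \_ `[a, b]) x.
  rewrite patchE; case: ifPn => [/set_mem xI|xI].
    rewrite /Rintegral fineK; last by apply: integrable_fin_num => //; exact: bounded_integrable.
    rewrite [RHS]integral_mkcond; apply: eq_integral => y _.
    rewrite /f !patchE; congr (if _ then _ else _); apply/idP/idP => /set_mem.
      by move=> [_ yI]; apply/mem_set.
    by move=> yI; apply/mem_set.
  rewrite integral0_eq// => y _; rewrite /f patchE memNset// => -[xI' _].
  by move: xI; rewrite mem_set.
have Ey y : (\int[mu]_x f (x, y))%E = ((fun y => (\int[mu]_(x in `[a, b]) h (x, y))%:E) \_ `[c, d]) y.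
  rewrite patchE; case: ifPn => [/set_mem yI|yI].
    rewrite /Rintegral fineK; last by apply: integrable_fin_num => //; exact: bounded_integrable.
    rewrite [RHS]integral_mkcond; apply: eq_integral => x _.
    rewrite /f !patchE; congr (if _ then _ else _); apply/idP/idP => /set_mem.
      by move=> [xI _]; apply/mem_set.
    by move=> xI; apply/mem_set.
  rewrite integral0_eq// => x _; rewrite /f patchE memNset// => -[_ yI'].
  by move: yI; rewrite mem_set.
move=> FE; rewrite {1}/Rintegral [RHS]/Rintegral; congr fine.
rewrite integral_mkcond [RHS]integral_mkcond.
transitivity (\int[mu]_x \int[mu]_y f (x, y))%E.
  by apply: eq_integral => x _; exact/esym/Ex.
by rewrite [LHS]FE; apply: eq_integral => y _; exact: Ey.
Qed.

Lemma lip_continuous_norm (V : normedModType R) (f : R -> V) L :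
  (forall s t, `|f s - f t| <= L * `|s - t|) -> continuous f.
Proof.
move=> lf z; apply/cvgrPdist_lt => e e0.
have L1 : 0 < `|L| + 1 by rewrite ltr_wpDl.
have d0 : 0 < e / (`|L| + 1) by rewrite divr_gt0.
apply/nbhs_ballP; exists (e / (`|L| + 1)) => //= s zs; apply: (le_lt_trans (lf z s)).
rewrite /ball/= in zs.
rewrite ltr_pdivlMr// mulrC in zs; apply: le_lt_trans zs.
by rewrite ler_wpM2r// (le_trans (ler_norm L))// lerDl.
Qed.

Lemma triangulable_null G : lipschitz_triangulable G ->
  measurable G /\ (mu \x mu)%E G = 0%E.
Proof.
move=> [cG [n [h [hl GE _]]]].
have clo A : compact A -> measurable (A : set (R * R)).
  by move=> cA; apply: closed_measurable_plane; apply: compact_closed cA; exact: norm_hausdorff.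
have mG := clo _ cG; split => //.
have arcs i : measurable (h i @` `[0, 1]) /\ (mu \x mu)%E (h i @` `[0, 1]%classic) = 0%E.
  have [lh _ _] := hl i; have [L L0 lL] := lipschitz_on_itv lh.
  have mh : measurable (h i @` `[0, 1]).
    apply: clo; have -> : h i @` `[0, 1] = (h i \o clamp 0 1) @` `[0, 1].
      by apply/seteqP; split => _ [t tI <-]; exists t => //=; rewrite clamp_id//; move: tI; rewrite /= in_itv.
    apply: continuous_compact; last exact: segment_compact.
    apply: continuous_subspaceT; apply: (@lip_continuous_norm _ _ L) => s t /=.
    apply: (le_trans (lL _ _ (clamp_itv s (@ler01 R)) (clamp_itv t (@ler01 R)))).
    by rewrite ler_wpM2l// (le_trans (lip_clamp 0 1 s t))// mul1r.
  by split=> //; exact: lipschitz_arc_null lL erefl mh.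
pose A (k : nat) : set (R * R) := if insub k is Some i then h i @` `[0, 1] else set0.
have A0 k : measurable (A k) /\ (mu \x mu)%E (A k) = 0%E.
  by rewrite /A; case: insub => [i|]; [exact: arcs|split; [exact: measurable0|exact: measure0]].
have sub : G `<=` \big[setU/set0]_(k < n) A k.
  rewrite GE => z [i _ zi]; rewrite -(bigcup_mkord n A); exists i => /=; first exact: ltn_ord.
  by rewrite /A valK.
have cs := @content_subadditive _ _ _ (mu \x mu)%E G A n (fun i _ => (A0 i).1) mG sub.
apply/eqP; rewrite eq_le measure_ge0 andbT; apply: (le_trans cs).
by rewrite big1// => k _; exact: (A0 k).2.
Qed.

Lemma null_slices G : measurable G -> (mu \x mu)%E G = 0%E ->
  {ae mu, forall x, mu (xsection G x) = 0%E}.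
Proof.
move=> mG G0.
have mf : measurable_fun setT (fun x => mu (xsection G x)) by exact: measurable_fun_xsection.
have E : (\int[mu]_x `|mu (xsection G x)| = 0)%E.
  by rewrite -[RHS]G0; apply: eq_integral => x _; rewrite gee0_abs.
have [+ _] := @ae_eq_integral_abs _ _ _ mu setT measurableT _ mf.
by move=> /(_ E); apply: filterS => x; apply.
Qed.

(** The slice formula is integrated in x against [q]. Fubini exchanges the integrals, and the
    condition x < F1 t becomes the primitive of [q] at F1 t. *)
Lemma plane_green a b (F1 F2 g2 : R -> R) L B G (w : R * R -> R) W N (q : R -> R) Q
    (v : R -> R) V :
  a < b -> 0 <= L -> continuous F1 -> (forall t, `|F1 t| <= B) ->
  lip L F2 -> (forall t, `|F2 t| <= B) -> density a b F2 g2 L ->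
  F1 a = F1 b -> F2 a = F2 b ->
  closed G -> (mu \x mu)%E G = 0%E -> (forall t, a <= t <= b -> G (F1 t, F2 t)) ->
  measurable_fun setT w -> (forall p, `|w p| <= W) ->
  (forall p, ~ G p -> winds (rescale a b F1 F2) p (2 * pi * w p)) ->
  B + 1 <= N -> (forall p, N - 1 <= `|p| -> w p = 0) ->
  measurable_fun setT q -> (forall x, `|q x| <= Q) ->
  continuous v -> (forall y, `|v y| <= V) ->
  \int[mu]_(t in `[a, b]) ((\int[mu]_(x in `[- N, F1 t]) q x) * (v (F2 t) * g2 t)) =
  \int[mu]_(x in `[- N, N]) (q x * \int[mu]_(y in `[- N, N]) (w (x, y) * v y)).
Proof.
move=> ab L0 cF1 F1B lF2 F2B D2 F1ab F2ab cG G0 FG mw wW wP BN w0 mq qQ cv vV.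
have [mg2 g2L _ _] := D2.
have mF1 : measurable_fun setT F1 by exact: continuous_measurable_fun.
have mF2 : measurable_fun setT F2 by apply: continuous_measurable_fun; exact: lip_continuous lF2.
have mv : measurable_fun setT v by exact: continuous_measurable_fun.
pose h (z : R * R) : R := (z.1 < F1 z.2)%R%:R * (q z.1 * (v (F2 z.2) * g2 z.2)).
have mh : measurable_fun setT h.
  apply: measurable_funM.
    rewrite (_ : (fun z : R * R => _) = \1_[set z : R * R | z.1 < F1 z.2] :> (R * R -> R)); last first.
      apply/funext => z; rewrite indicE; case: (boolP (z.1 < F1 z.2)) => zF.
        by rewrite mem_set.
      by rewrite memNset//=; exact/negP.
    apply: measurable_indic.
    have : measurable_fun [set: R * R] (fun z : R * R => z.1 < F1 z.2).
      by apply: measurable_fun_ltr => //; apply: measurableT_comp => //; exact: measurable_snd.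
    move=> /(_ measurableT [set true] I); rewrite setTI => /=.
    by congr measurable; apply/seteqP; split => z.
  apply: measurable_funM; first by apply: measurableT_comp => //; exact: measurable_fst.
  apply: (@measurableT_comp _ _ _ _ _ _ (fun t => v (F2 t) * g2 t) _ snd) => //.
  by apply: measurable_funM => //; exact: measurableT_comp.
have hM z : `|h z| <= 1 * (Q * (V * L)).
  apply: mul_bound; first by case: (_ < _); rewrite ?normr1 ?normr0.
  by apply: mul_bound => //; exact: mul_bound.
transitivity (\int[mu]_(t in `[a, b]) \int[mu]_(x in `[- N, N]) h (x, t)).
  apply: eq_Rintegral => t _.
  have FN : - N <= F1 t <= N by rewrite -ler_norml (le_trans (F1B t))// (le_trans _ BN)// lerDl.
  have /andP[N1 N2] := FN.
  have mht : measurable_fun setT (fun x => h (x, t)) by exact: measurable_fun_pair1.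
  rewrite (@Rintegral_itv_split _ (fun x => h (x, t)) (1 * (Q * (V * L))) (- N) (F1 t) N)//.
  rewrite [X in _ = _ + X]Rintegral_itv_eq0 ?addr0; last first.
    by move=> x /andP[Fx _]; rewrite /h/= ltNge Fx mul0r.
  rewrite -RintegralZr//; last exact: bounded_integrable qQ.
  rewrite /Rintegral; congr fine; apply: (@integral_off_null _ _ _ mu [set F1 t]) => //.
    exact: lebesgue_measure_set1.
  move=> x /=; rewrite in_itv/= => /andP[_ xF] xn.
  by rewrite /h/= lt_neqAle xF andbT (introN eqP xn) mul1r.
rewrite -(Rfubini (- N) N a b mh hM).
apply: (@Rintegral_ae _ (- N) N) => //.
apply: ae_imply (null_slices (closed_measurable_plane cG) G0) => x Gx _ _.
have mwx : measurable_fun setT (fun y => w (x, y)) by exact: measurable_fun_pair2.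
(* The additional point keeps [K] nonempty when the line misses [G], so that the distance to [K]
   makes sense. *)
pose K := xsection G x `|` [set 0].
have KG y : G (x, y) -> K y by move=> Gxy; left; rewrite /xsection/= inE.
have cK : closed K.
  apply: closedU; last by apply: compact_closed; [exact: Rhausdorff|exact: compact_set1].
  have -> : xsection G x = (fun y => (x, y)) @^-1` G.
    by apply/seteqP; split => y; rewrite /xsection/= inE.
  apply: preimage_closed cG => y _.
  by apply: (continuous_pair (f := cst x) (g := id)) => z; [exact: cvg_cst|exact: cvg_id].
have K0 : mu K = 0%E.
  apply: null_set_setU; [exact: measurable_xsection (closed_measurable_plane cG)|exact: measurable_set1| |].
  - exact: Gx.
  - exact: lebesgue_measure_set1.
rewrite -(@slice_green _ a b F1 F2 g2 L B x K (fun y => w (x, y)) W N ab L0 cF1 lF2 F2B D2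
   F1ab F2ab cK K0 _ _ mwx _ _ BN _ v V cv vV)//.
- rewrite -RintegralZl//; last first.
    apply: (@bounded_integrable _ _ _ _ (1 * (V * L))).
      apply: measurable_funM; first by apply: measurable_indic; exact: measurable_above.
      by apply: measurable_funM => //; exact: measurableT_comp.
    by move=> t; apply: mul_bound; [exact: indic_bound|exact: mul_bound].
  by apply: eq_Rintegral => t _; rewrite /h/= indic_above; ring.
- by exists 0; right.
- by move=> t tI F1t; apply: KG; rewrite -F1t; exact: FG.
- by move=> s Ks; apply: wP => Gs; apply: Ks; exact: KG.
- by move=> s Ns; apply: w0; rewrite prod_normE le_max Ns orbT.
Qed.

End Plane.

(** * Fejer-type kernels *)

Section Kernel.
Context {R : realType}.
Notation mu := (@lebesgue_measure R).
Implicit Types (a b c x y u s : R) (k : nat).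

(* [fejer k] evaluates to [sin^2 (k phi) / sin^2 phi] at [sin phi]. *)
Fixpoint fejer (k : nat) : {poly R} :=
  if k is k1.+1 then
    if k1 is k2.+1 then (2%:P - 4%:P * 'X^2) * fejer k1 - fejer k2 + 2%:P else 1
  else 0.

Lemma fejerS k u : (fejer k.+2).[u] = (2 - 4 * u ^+ 2) * (fejer k.+1).[u] - (fejer k).[u] + 2.
Proof. by rewrite /= !hornerE. Qed.

Lemma nat_ind2 (P : nat -> Prop) : P 0%N -> P 1%N -> (forall k, P k -> P k.+1 -> P k.+2) ->
  forall k, P k.
Proof.
move=> P0 P1 PS k; suff : P k /\ P k.+1 by case.
by elim: k => // k [h1 h2]; split => //; exact: PS.
Qed.

Lemma size_fejer k : (size (fejer k.+1) <= k.*2.+1)%N.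
Proof.
elim/nat_ind2: k => [||k IH1 IH2]; first by rewrite size_poly1.
  rewrite /= mulr1 subr0; apply: (leq_trans (size_polyD _ _)); rewrite geq_max.
  rewrite (leq_trans (size_polyD _ _)) ?geq_max ?size_polyN ?(leq_trans (size_polyC_leq1 _))//=.
  by rewrite mul_polyC (leq_trans (size_scale_leq _ _))// size_polyXn.
rewrite -[fejer _]/((2%:P - 4%:P * 'X^2) * fejer k.+2 - fejer k.+1 + 2%:P).
apply: (leq_trans (size_polyD _ _)); rewrite geq_max (leq_trans (size_polyC_leq1 _))// andbT.
apply: (leq_trans (size_polyD _ _)); rewrite geq_max size_polyN (leq_trans IH1) ?andbT; last first.
  by rewrite !doubleS; do 4 apply: leqW.
apply: (leq_trans (size_polyMleq _ _)).
have s3 : (size ((2%:P - 4%:P * 'X^2)%R : {poly R}) <= 3)%N.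
  apply: (leq_trans (size_polyD _ _)); rewrite geq_max (leq_trans (size_polyC_leq1 _))//=.
  by rewrite size_polyN mul_polyC (leq_trans (size_scale_leq _ _))// size_polyXn.
apply: (@leq_trans (3 + (k.+1).*2.+1).-1); last by rewrite !doubleS.
by rewrite -!subn1 leq_sub2r// leq_add.
Qed.

Lemma sin_mul_le k (p : R) : `|sin (k%:R * p)| <= k%:R * `|sin p|.
Proof.
elim: k => [|k IH]; first by rewrite !mul0r sin0 normr0.
rewrite -natr1 !mulrDl !mul1r sinD (le_trans (ler_normD _ _))// lerD//.
  rewrite normrM (le_trans _ IH)// -[leRHS]mulr1 ler_wpM2l//.
  by rewrite ler_norml cos_geN1 cos_le1.
rewrite normrM -[leRHS]mul1r ler_wpM2r//.
by rewrite ler_norml cos_geN1 cos_le1.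
Qed.

(** With squares of sines written through cosines of double angles, the recursion becomes the sum of
    the addition formulas for 2(k + 1)p + 2p and 2(k + 1)p - 2p. *)
Lemma fejer_sin k (p : R) : sin p ^+ 2 * (fejer k).[sin p] = sin (k%:R * p) ^+ 2.
Proof.
have sc (x : R) : sin x ^+ 2 *+ 2 = 1 - cos (x *+ 2).
  by have := cos2Dsin2 x; rewrite cos_mulr2n; lra.
elim/nat_ind2: k => [||k IH1 IH2].
- by rewrite horner0 mulr0 mul0r sin0 expr0n.
- by rewrite hornerC mulr1 mul1r.
rewrite fejerS; have := sc p; have := sc (k%:R * p); have := sc (k.+1%:R * p); have := sc (k.+2%:R * p).
have -> : (k.+2%:R * p) *+ 2 = (k.+1%:R * p) *+ 2 + p *+ 2 by rewrite -[k.+2%:R]natr1 mulrDl mul1r -mulrnDl.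
have -> : (k%:R * p) *+ 2 = (k.+1%:R * p) *+ 2 - p *+ 2.
  by rewrite -[k.+1%:R]natr1 mulrDl mul1r -mulrnBl addrK.
rewrite cosD cosB.
set A := sin (k.+2%:R * p) ^+ 2; set B := sin (k.+1%:R * p) ^+ 2 in IH2 *; set C := sin (k%:R * p) ^+ 2 in IH1 *.
set X := cos _; set Y := cos (p *+ 2); set Z := sin _ * sin _.
move=> hA hB hC hp; have hp' : sin p ^+ 2 = (1 - Y) / 2 by lra.
transitivity ((2 - 4 * sin p ^+ 2) * (sin p ^+ 2 * (fejer k.+1).[sin p]) -
  sin p ^+ 2 * (fejer k).[sin p] + 2 * sin p ^+ 2); first by ring.
rewrite IH2 IH1 hp'; have -> : B = (1 - X) / 2 by lra.
have -> : A = (1 - (X * Y - Z)) / 2 by lra.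
have -> : C = (1 - (X * Y + Z)) / 2 by lra.
by field.
Qed.

Lemma fejer0 k : (fejer k).[0] = k%:R ^+ 2.
Proof.
elim/nat_ind2: k => [||k IH1 IH2]; first by rewrite horner0 expr0n.
  by rewrite hornerC expr1n.
by rewrite fejerS IH1 IH2 -!natr1; ring.
Qed.

Lemma fejer_bounds k u : -1 <= u <= 1 ->
  [/\ 0 <= (fejer k).[u], u ^+ 2 * (fejer k).[u] <= 1 & (fejer k).[u] <= k%:R ^+ 2].
Proof.
move=> uI; have [->|u0] := eqVneq u 0.
  by rewrite fejer0 expr0n mul0r; split; rewrite ?sqr_ge0 ?ler01 ?lexx.
have uI' : u \in `[-1, 1] by rewrite in_itv.
have uE : sin (asin u) = u by exact: asinK.
have := fejer_sin k (asin u); rewrite uE => E.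
have u2 : 0 < u ^+ 2 by rewrite lt_neqAle sqr_ge0 eq_sym expf_neq0.
split; first by rewrite -(pmulr_rge0 _ u2) E sqr_ge0.
  by rewrite E -[X in _ <= X](cos2Dsin2 (k%:R * asin u)) lerDr sqr_ge0.
rewrite -(ler_pM2l u2) E -exprMn -real_normK ?num_real// -[X in _ <= X]real_normK ?num_real//.
rewrite lerXn2r ?nnegrE// normrM (ger0_norm (ler0n _ k)) (mulrC `|u|) -{2}uE.
exact: sin_mul_le.
Qed.

(** A quadratic Taylor bound at 0, proved with the exact coefficient k^2 (k^2 - 1) / 3: the error
    [e] is 0 at k = 0 and k = 1, and its second differences 4 u^2 ((n + 1)^2 - P(u)), where P is
    [fejer n.+1], are nonnegative. *)
Lemma fejer_lower k u : -1 <= u <= 1 ->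
  k%:R ^+ 2 - k%:R ^+ 4 * u ^+ 2 / 3 <= (fejer k).[u].
Proof.
move=> uI; pose e k := (fejer k).[u] - (k%:R ^+ 2 - k%:R ^+ 2 * (k%:R ^+ 2 - 1) * u ^+ 2 / 3).
have convex n : e n.+1 - e n <= e n.+2 - e n.+1.
  have [_ _ h] := fejer_bounds n.+1 uI.
  have E : e n.+2 - e n.+1 - (e n.+1 - e n) =
      4 * (u ^+ 2 * (n.+1%:R ^+ 2 - (fejer n.+1).[u])).
    by rewrite /e fejerS -!natr1; field.
  by rewrite -subr_ge0 E mulr_ge0// mulr_ge0 ?sqr_ge0// subr_ge0.
have e0 : e 0%N = 0 by rewrite /e horner0 expr0n/= !mul0r !subr0.
have e1 : e 1%N = 0 by rewrite /e hornerC expr1n; ring.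
have step n : 0 <= e n.+1 - e n.
  by elim: n => [|n IH]; [rewrite e0 e1 subrr|exact: le_trans (convex n)].
have pos n : 0 <= e n.
  by elim: n => [|n IH]; [rewrite e0|have := step n; lra].
have := pos k; rewrite /e; have : 0 <= k%:R ^+ 2 * u ^+ 2 / 3 by rewrite divr_ge0// mulr_ge0 ?sqr_ge0.
lra.
Qed.

Lemma FTC_Rintegral (F f : R -> R) a b : a <= b ->
  (forall x, a <= x <= b -> is_derive x 1 F (f x)) -> {within `[a, b], continuous f} ->
  \int[mu]_(x in `[a, b]) f x = F b - F a.
Proof.
move=> ab dF cf; have [->|ab'] := eqVneq a b.
  by rewrite set_itv1 Rintegral_set1 subrr.
have ltab : a < b by rewrite lt_neqAle ab'.
have cF x : a <= x <= b -> {for x, continuous F}.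
  by move=> xI; apply/differentiable_continuous/derivable1_diffP; have [] := dF x xI.
rewrite /Rintegral (continuous_FTC2 ltab cf (F := F))//.
- split=> [x xI||].
  + by have [] := dF x (subset_itv_oo_cc xI).
  + by apply: cvg_at_right_filter; apply: cF; rewrite lexx.
  + by apply: cvg_at_left_filter; apply: cF; rewrite lexx ab.
- by move=> x xI; rewrite derive1E; have [_ <-] := dF x (subset_itv_oo_cc xI).
Qed.

(** For s > 0 the clamp changes the polynomial only off [c - s, c + s]; it keeps the function
    bounded and nonnegative on the whole line. *)
Definition fbump k c s x : R := (fejer k).[clamp (- 1) 1 ((x - c) / s)].

Lemma bump_ge0 k c s x : 0 <= fbump k c s x.
Proof. by have [|] := @fejer_bounds k (clamp (- 1) 1 ((x - c) / s)); rewrite ?clamp_itv//; lra. Qed.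

Lemma bump_le k c s x : `|fbump k c s x| <= k%:R ^+ 2.
Proof.
rewrite ger0_norm ?bump_ge0//.
by have [|_ _] := @fejer_bounds k (clamp (- 1) 1 ((x - c) / s)); rewrite ?clamp_itv//; lra.
Qed.

Lemma continuous_bump k c s : continuous (fbump k c s).
Proof.
move=> x.
apply: (@continuous_comp _ _ _ (fun x => clamp (- 1) 1 ((x - c) / s)) (horner (fejer k))); last exact: continuous_horner.
apply: (@continuous_comp _ _ _ (fun x => (x - c) / s) (clamp (- 1) 1)); last exact: continuous_clamp.
by apply: cvgMl; apply: cvgB; [exact: cvg_id|exact: cvg_cst].
Qed.

Lemma bumpE k c s x : 0 < s -> c - s <= x <= c + s -> fbump k c s x = (fejer k).[(x - c) / s].
Proof.
move=> s0 /andP[x1 x2]; rewrite /fbump clamp_id// ler_pdivlMr// ler_pdivrMr//.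
by apply/andP; split; lra.
Qed.

Lemma measurable_bump k c s : measurable_fun setT (fbump k c s).
Proof. by apply: continuous_measurable_fun; exact: continuous_bump. Qed.

Lemma integrable_bump k c s a b : mu.-integrable `[a, b] (EFin \o fbump k c s).
Proof. by apply: bounded_integrable; [exact: measurable_bump|exact: bump_le]. Qed.

(** Integrating the parabola of [fejer_lower] over |x - c| <= s / k gives 2ks - 2ks/9 = 16ks/9, and
    this interval lies in the given one because s / k <= rho. *)
Lemma bump_mass k c s rho : (0 < k)%N -> 0 < s -> 3 * s <= k%:R * rho -> rho <= s ->
  16 / 9 * k%:R * s <= \int[mu]_(x in `[c - rho, c + rho]) fbump k c s x.
Proof.
move=> k0 s0 sk rs.
have kp : 0 < k%:R :> R by rewrite ltr0n.
have kn : k%:R != 0 :> R by rewrite gt_eqF.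
have sn : s != 0 by rewrite gt_eqF.
pose t := s / k%:R; have t0 : 0 < t by rewrite divr_gt0.
have tr : t <= rho by rewrite /t ler_pdivrMr//; lra.
pose g x : R := k%:R ^+ 2 - k%:R ^+ 4 * ((x - c) / s) ^+ 2 / 3.
pose Gp : {poly R} := k%:R ^+ 2 *: ('X - c%:P) - (k%:R ^+ 4 / (9 * s ^+ 2)) *: ('X - c%:P) ^+ 3.
have Gd x : Gp^`().[x] = g x.
  rewrite /Gp !derivCE /= !hornerE /g /=; field.
  by rewrite sn.
have cg : continuous g.
  move=> x; apply: cvgB; first exact: cvg_cst.
  apply: cvgMl; apply: cvgMr.
  apply: (@continuous_comp _ _ _ (fun x => (x - c) / s) (fun u => u ^+ 2)); last exact: exprn_continuous.
  by apply: cvgMl; apply: cvgB; [exact: cvg_id|exact: cvg_cst].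
have ct : c - t <= c + t by lra.
have mass : \int[mu]_(x in `[c - t, c + t]) g x = 16 / 9 * k%:R * s.
  transitivity (Gp.[c + t] - Gp.[c - t]).
    apply: (@FTC_Rintegral (horner Gp) g) => //; last exact: continuous_subspaceT.
    by move=> x _; rewrite -Gd; exact: is_derive_poly.
  by rewrite /Gp !hornerE /= /t; field; rewrite kn sn.
rewrite -mass.
apply: (@le_trans _ _ (\int[mu]_(x in `[c - t, c + t]) fbump k c s x)).
  apply: le_Rintegral => //; [|exact: integrable_bump|].
    by apply: continuous_compact_integrable; [exact: segment_compact|exact: continuous_subspaceT].
  move=> x; rewrite /= in_itv/= => /andP[x1 x2]; rewrite bumpE//; last by apply/andP; split; lra.
  by apply: fejer_lower; rewrite ler_pdivlMr// ler_pdivrMr//; apply/andP; split; lra.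
have iB u v w : u <= v -> v <= w -> \int[mu]_(x in `[u, w]) fbump k c s x =
    \int[mu]_(x in `[u, v]) fbump k c s x + \int[mu]_(x in `[v, w]) fbump k c s x.
  by move=> uv vw; apply: Rintegral_itv_split (measurable_bump k c s) (bump_le k c s).
have pos u v : 0 <= \int[mu]_(x in `[u, v]) fbump k c s x.
  by apply: Rintegral_ge0 => x _; exact: bump_ge0.
rewrite (iB (c - rho) (c - t) (c + rho)); [|lra|lra].
rewrite (iB (c - t) (c + t) (c + rho)); [|lra|lra].
by rewrite addrCA lerDl addr_ge0.
Qed.

(* The kernel is at most [s^2 / (x - c)^2]. *)
Lemma bump_tail k c s u v : 0 < s -> u <= v -> c - s <= u -> v <= c + s ->
  (v < c) || (c < u) ->
  \int[mu]_(x in `[u, v]) fbump k c s x <= s ^+ 2 * ((c - v)^-1 - (c - u)^-1).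
Proof.
move=> s0 uv us vs vc.
have nz x : u <= x <= v -> c - x != 0.
  by move=> /andP[x1 x2]; rewrite subr_eq0; apply/eqP; move/orP: vc => []; lra.
have ct : {within `[u, v], continuous (fun x => s ^+ 2 * (c - x) ^- 2)}.
  apply: continuous_in_subspaceT => x /set_mem; rewrite /= in_itv/= => xI.
  apply: cvgMr; apply: cvgV; first by rewrite expf_neq0// nz.
  apply: (@continuous_comp _ _ _ (fun x => c - x) (fun u => u ^+ 2)); last exact: exprn_continuous.
  by apply: cvgB; [exact: cvg_cst|exact: cvg_id].
have E : \int[mu]_(x in `[u, v]) (s ^+ 2 * (c - x) ^- 2) = s ^+ 2 * (c - v)^-1 - s ^+ 2 * (c - u)^-1.
  apply: (FTC_Rintegral uv _ ct (F := fun x => s ^+ 2 * (c - x)^-1)) => x xI.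
  have nx := nz x xI.
  have d1 : is_derive x 1 (fun x => c - x) (0 - 1).
    exact: (is_deriveB (is_derive_cst c x 1) (is_derive_id x 1)).
  have d2 := @is_deriveV _ (fun x => c - x) x (0 - 1) 1 nx d1.
  have d3 : is_derive x 1 (fun x => s ^+ 2 * (c - x)^-1) (s ^+ 2 * (- (c - x) ^- 2 * (0 - 1))).
    exact: (is_deriveZ (s ^+ 2) d2).
  by apply: (is_derive_eq d3); field.
rewrite mulrBr -E; apply: le_Rintegral => //; first exact: integrable_bump.
  by apply: continuous_compact_integrable; first exact: segment_compact.
move=> x; rewrite /= in_itv/= => xI; have nx := nz x xI; move/andP: xI => [x1 x2].
rewrite bumpE//; last by apply/andP; split; lra.
have [|_ + _] := @fejer_bounds k ((x - c) / s).
  by rewrite ler_pdivlMr// ler_pdivrMr//; apply/andP; split; lra.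
have q0 : 0 < (c - x) ^+ 2 by rewrite lt_neqAle sqr_ge0 eq_sym expf_neq0.
by rewrite ler_pdivlMr// expr_div_n mulrAC ler_pdivrMr ?exprn_gt0// mul1r -[x - c]opprB sqrrN mulrC.
Qed.

(** Each tail is at most s^2 / rho <= ks / 3 while the central mass is at least 16ks/9; the two
    tails thus amount to at most 3/8 of the central mass, and the total to at most 11/8 of it. *)
Lemma bump_ratio k c s rho x0 : (0 < k)%N -> 0 < s -> 0 < rho -> 3 * s <= k%:R * rho ->
  x0 <= c - rho -> c + rho <= x0 + s ->
  8 * \int[mu]_(x in `[x0, x0 + s]) fbump k c s x <=
    11 * \int[mu]_(x in `[c - rho, c + rho]) fbump k c s x /\
  0 < \int[mu]_(x in `[c - rho, c + rho]) fbump k c s x.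
Proof.
move=> k0 s0 r0 sk xr rx.
have fin (A C M e : R) : 16 / 9 * e <= M -> A <= e / 3 -> C <= e / 3 -> 8 * (A + (M + C)) <= 11 * M.
  by move=> h1 h2 h3; lra.
have kp : 0 < k%:R :> R by rewrite ltr0n.
have rs : rho <= s by lra.
have m1 := bump_mass c k0 s0 sk rs; set M := \int[mu]_(x in _) _ in m1 *.
have ks : 0 < k%:R * s by rewrite mulr_gt0.
split; last first.
  by apply: lt_le_trans m1; rewrite -mulrA mulr_gt0//; lra.
have iB u v w : u <= v -> v <= w -> \int[mu]_(x in `[u, w]) fbump k c s x =
    \int[mu]_(x in `[u, v]) fbump k c s x + \int[mu]_(x in `[v, w]) fbump k c s x.
  by move=> uv vw; apply: Rintegral_itv_split (measurable_bump k c s) (bump_le k c s).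
rewrite (iB x0 (c - rho) (x0 + s)); [|lra|lra].
rewrite (iB (c - rho) (c + rho) (x0 + s)); [|lra|lra]; rewrite -/M.
have t1 : \int[mu]_(x in `[x0, c - rho]) fbump k c s x <= s ^+ 2 * ((c - (c - rho))^-1 - (c - x0)^-1).
  by apply: bump_tail => //; try lra; apply/orP; left; lra.
have t2 : \int[mu]_(x in `[c + rho, x0 + s]) fbump k c s x <=
    s ^+ 2 * ((c - (x0 + s))^-1 - (c - (c + rho))^-1).
  by apply: bump_tail => //; try lra; apply/orP; right; lra.
have e1 : (c - (c - rho))^-1 - (c - x0)^-1 <= rho^-1.
  have -> : c - (c - rho) = rho by ring.
  by rewrite gerBl invr_ge0; lra.
have e2 : (c - (x0 + s))^-1 - (c - (c + rho))^-1 <= rho^-1.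
  have -> : c - (c + rho) = - rho by ring.
  by rewrite invrN opprK gerDr invr_le0; lra.
have s2 : 0 <= s ^+ 2 by exact: sqr_ge0.
have h1 := ler_wpM2l s2 e1; have h2 := ler_wpM2l s2 e2.
have h3 : s ^+ 2 * rho^-1 <= k%:R * s / 3.
  rewrite ler_pdivrMr//; rewrite (_ : k%:R * s / 3 * rho = s * (k%:R * rho / 3)); last by ring.
  by rewrite expr2 ler_pM2l//; lra.
apply: (fin _ _ _ (k%:R * s)); first by rewrite mulrA.
  exact: le_trans t1 (le_trans h1 h3).
exact: le_trans t2 (le_trans h2 h3).
Qed.

End Kernel.

(** * Green's formula for polynomials, and concentration of the kernels *)

Section Moments.
Context {R : realType}.
Notation mu := (@lebesgue_measure R).
Implicit Types (a b c x y s t L N B W : R) (p q : {poly R}).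

Lemma Rintegral_sum n (f : nat -> R -> R) a b :
  (forall i, measurable_fun setT (f i) /\ exists C, forall t, `|f i t| <= C) ->
  \int[mu]_(t in `[a, b]) (\sum_(i < n) f i t) = \sum_(i < n) \int[mu]_(t in `[a, b]) f i t.
Proof.
move=> Hf; elim: n => [|n IH].
  rewrite big_ord0; under eq_Rintegral do rewrite big_ord0.
  by rewrite Rintegral_cst// mul0r.
rewrite big_ord_recr/= -IH -RintegralD//.
- by apply: eq_Rintegral => t _; rewrite big_ord_recr.
- have [C HC] : exists C, forall t, `|\sum_(i < n) f i t| <= C.
    elim: {IH} n => [|n [C HC]]; first by exists 0 => t; rewrite big_ord0 normr0.
    have [_ [C' HC']] := Hf n; exists (C + C') => t.
    by rewrite big_ord_recr/= (le_trans (ler_normD _ _))// lerD.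
  apply: bounded_integrable HC; apply: measurable_sum => i.
  by have [] := Hf i.
- by have [m [C HC]] := Hf n; exact: bounded_integrable HC.
Qed.

Lemma horner_bounded p B : exists C, forall x, `|x| <= B -> `|p.[x]| <= C.
Proof.
exists (\sum_(i < size p) `|p`_i| * B ^+ i) => x xB; rewrite horner_coef.
apply: (le_trans (ler_norm_sum _ _ _)); apply: ler_sum => i _.
by rewrite normrM normrX ler_wpM2l// lerXn2r ?nnegrE// (le_trans _ xB).
Qed.

Lemma poly_moments a b (F1 F2 g2 : R -> R) L B n m p q :
  continuous F1 -> continuous F2 -> measurable_fun setT g2 -> (forall t, `|g2 t| <= L) ->
  (forall t, `|F1 t| <= B) -> (forall t, `|F2 t| <= B) ->
  (forall i j, (i < n)%N -> (j < m)%N -> \int[mu]_(t in `[a, b]) (F1 t ^+ i * (F2 t ^+ j * g2 t)) = 0) ->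
  (size p <= n)%N -> (size q <= m)%N ->
  \int[mu]_(t in `[a, b]) (p.[F1 t] * (q.[F2 t] * g2 t)) = 0.
Proof.
move=> cF1 cF2 mg gL F1B F2B M0 pn qm.
have mF1 : measurable_fun setT F1 by exact: continuous_measurable_fun.
have mF2 : measurable_fun setT F2 by exact: continuous_measurable_fun.
have mq : measurable_fun setT (fun t => q.[F2 t]).
  by apply: (@measurableT_comp _ _ _ _ _ _ (horner q)) => //; apply: continuous_measurable_fun; exact: continuous_horner.
have powB (F : R -> R) i : (forall t, `|F t| <= B) -> forall t, `|F t ^+ i| <= B ^+ i.
  by move=> FB t; rewrite normrX lerXn2r ?nnegrE// (le_trans _ (FB t)).
have [C HC] := horner_bounded q B.
have Hi i : (i < n)%N -> \int[mu]_(t in `[a, b]) (F1 t ^+ i * (q.[F2 t] * g2 t)) = 0.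
  move=> i_n; pose f j t := q`_j * (F1 t ^+ i * (F2 t ^+ j * g2 t)).
  have mf0 j : measurable_fun setT (fun t => F1 t ^+ i * (F2 t ^+ j * g2 t)).
    by apply: measurable_funM; [exact: measurable_funX|apply: measurable_funM => //; exact: measurable_funX].
  have bf0 j t : `|F1 t ^+ i * (F2 t ^+ j * g2 t)| <= B ^+ i * (B ^+ j * L).
    by apply: mul_bound; [exact: powB|apply: mul_bound => //; exact: powB].
  transitivity (\int[mu]_(t in `[a, b]) (\sum_(j < m) f j t)).
    apply: eq_Rintegral => t _; rewrite (horner_coef_wide _ qm) big_distrl/= big_distrr/=.
    by apply: eq_bigr => j _; rewrite /f; ring.
  rewrite Rintegral_sum.
    rewrite big1// => j _; rewrite RintegralZl// ?M0 ?mulr0//.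
    exact: bounded_integrable (bf0 j).
  move=> j; split; first by apply: measurable_funM => //; exact: mf0.
  by exists (`|q`_j| * (B ^+ i * (B ^+ j * L))) => t; apply: mul_bound.
pose f i t := p`_i * (F1 t ^+ i * (q.[F2 t] * g2 t)).
have mf0 i : measurable_fun setT (fun t => F1 t ^+ i * (q.[F2 t] * g2 t)).
  by apply: measurable_funM; [exact: measurable_funX|exact: measurable_funM].
have bf0 i t : `|F1 t ^+ i * (q.[F2 t] * g2 t)| <= B ^+ i * (C * L).
  by apply: mul_bound; [exact: powB|apply: mul_bound => //; exact: HC].
transitivity (\int[mu]_(t in `[a, b]) (\sum_(i < n) f i t)).
  apply: eq_Rintegral => t _; rewrite (horner_coef_wide _ pn) big_distrl/=.
  by apply: eq_bigr => i _; rewrite /f; ring.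
rewrite Rintegral_sum.
  rewrite big1// => i _; rewrite RintegralZl// ?Hi ?mulr0//.
  exact: bounded_integrable (bf0 i).
move=> i; split; first by apply: measurable_funM => //; exact: mf0.
by exists (`|p`_i| * (B ^+ i * (C * L))) => t; apply: mul_bound.
Qed.

(** The constant coefficient is a division by 0, which is 0 by convention. *)
Definition antideriv p : {poly R} := \poly_(i < (size p).+1) (p`_i.-1 / i%:R).

Lemma deriv_antideriv p : (antideriv p)^`() = p.
Proof.
apply/polyP => i; rewrite coef_deriv coef_poly /= ltnS.
case: ltnP => ip; last by rewrite mul0rn nth_default.
by rewrite -[LHS]mulr_natr divfK ?pnatr_eq0.
Qed.

Lemma poly_green a b (F1 F2 g2 : R -> R) L B (G : set (R * R)) (w : R * R -> R) W N n m p q :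
  a < b -> 0 <= L -> continuous F1 -> (forall t, `|F1 t| <= B) ->
  lip L F2 -> (forall t, `|F2 t| <= B) -> density a b F2 g2 L ->
  F1 a = F1 b -> F2 a = F2 b ->
  closed G -> (mu \x mu)%E G = 0%E -> (forall t, a <= t <= b -> G (F1 t, F2 t)) ->
  measurable_fun setT w -> (forall z, `|w z| <= W) ->
  (forall z, ~ G z -> winds (rescale a b F1 F2) z (2 * pi * w z)) ->
  B + 1 <= N -> (forall z, N - 1 <= `|z| -> w z = 0) ->
  (forall i j, (i < n.+1)%N -> (j < m)%N ->
    \int[mu]_(t in `[a, b]) (F1 t ^+ i * (F2 t ^+ j * g2 t)) = 0) ->
  (size p <= n)%N -> (size q <= m)%N ->
  \int[mu]_(x in `[- N, N]) (p.[x] * \int[mu]_(y in `[- N, N]) (w (x, y) * q.[y])) = 0.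
Proof.
move=> ab L0 cF1 F1B lF2 F2B D2 F1ab F2ab cG G0 FG mw wW wP BN w0 M0 pn qm.
have B0 : 0 <= B by exact: le_trans (F1B 0).
have N0 : 0 <= N by apply: le_trans BN; rewrite addr_ge0.
have NN : - N <= N by lra.
have cN x : `|clamp (- N) N x| <= N by rewrite ler_norml clamp_itv.
have [mg2 g2L _ _] := D2.
(* Clamping makes the polynomials bounded on the line and changes nothing on [-N, N], where the
   integrals live. *)
pose pc (r : {poly R}) x := r.[clamp (- N) N x].
have cpc r : continuous (pc r).
  move=> x; apply: (@continuous_comp _ _ _ (clamp (- N) N) (horner r)); last exact: continuous_horner.
  exact: continuous_clamp.
have [Q HQ] := horner_bounded p N; have [V HV] := horner_bounded q N.
have E := @plane_green R a b F1 F2 g2 L B G w W N (pc p) Q (pc q) V ab L0 cF1 F1B lF2 F2B D2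
  F1ab F2ab cG G0 FG mw wW wP BN w0 (continuous_measurable_fun (@cpc p)) (fun x => HQ _ (cN x))
  (@cpc q) (fun x => HV _ (cN x)).
transitivity (\int[mu]_(x in `[- N, N]) (pc p x * \int[mu]_(y in `[- N, N]) (w (x, y) * pc q y))).
  apply: eq_Rintegral => x; rewrite inE/= in_itv/= => xI; rewrite /pc clamp_id//; congr (_ * _).
  by apply: eq_Rintegral => y; rewrite inE/= in_itv/= => yI; rewrite clamp_id.
rewrite -E.
pose A := antideriv p - (antideriv p).[- N]%:P.
have FN (F : R -> R) t : (forall t, `|F t| <= B) -> - N <= F t <= N.
  by move=> FB; rewrite -ler_norml (le_trans (FB t))// (le_trans _ BN)// lerDl.
transitivity (\int[mu]_(t in `[a, b]) (A.[F1 t] * (q.[F2 t] * g2 t))).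
  apply: eq_Rintegral => t _; congr (_ * _); last by rewrite /pc clamp_id// FN.
  have /andP[N1 N2] := FN F1 t F1B.
  transitivity (\int[mu]_(x in `[- N, F1 t]) p.[x]).
    apply: eq_Rintegral => x; rewrite inE/= in_itv/= => /andP[x1 x2].
    by rewrite /pc clamp_id// x1 (le_trans x2).
  rewrite /A hornerD hornerN hornerC; apply: (@FTC_Rintegral _ (horner (antideriv p))) => //.
    move=> x _; have := is_derive_poly (antideriv p) x; by rewrite deriv_antideriv.
  by apply: continuous_subspaceT; exact: continuous_horner.
apply: (@poly_moments a b F1 F2 g2 L B n.+1 m A q cF1 (lip_continuous lF2) mg2 g2L F1B F2B M0 _ qm).
apply: (leq_trans (size_polyD _ _)); rewrite geq_max size_polyN.
rewrite (leq_trans (size_poly _ _))//=.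
by rewrite (leq_trans (size_polyC_leq1 _)).
Qed.

(** Adding the bound [M] makes the integrand nonnegative, so Tonelli's theorem gives measurability;
    the contribution of the constant is then subtracted. *)
Lemma measurable_slice_integral (h : R * R -> R) c d M : measurable_fun setT h ->
  (forall z, `|h z| <= M) -> measurable_fun setT (fun x => \int[mu]_(y in `[c, d]) h (x, y)).
Proof.
move=> mh hM.
pose f (z : R * R) : \bar R := ((h z + M) * \1_`[c, d] z.2)%:E.
have f0 z : (0 <= f z)%E.
  by rewrite lee_fin mulr_ge0// -lerBlDr sub0r; have := hM z; rewrite ler_norml => /andP[].
have mf : measurable_fun setT f.
  apply/measurable_EFinP; apply: measurable_funM; first by apply: measurable_funD.
  have mi : measurable_fun setT (\1_`[c, d] : R -> R) by exact: measurable_indic.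
  exact: (measurableT_comp mi (@measurable_snd _ _ R R)).
have := @measurable_fun_fubini_tonelli_F _ _ _ _ R mu f mf f0.
move=> mF; have -> : (fun x => \int[mu]_(y in `[c, d]) h (x, y)) =
    (fun x => fine (fubini_F mu f x) - M * fine (mu `[c, d]%classic)).
  apply/funext => x; have mhx : measurable_fun setT (fun y => h (x, y)) by exact: measurable_fun_pair2.
  transitivity (\int[mu]_(y in `[c, d]) (h (x, y) + M) - \int[mu]_(y in `[c, d]) cst M y).
    rewrite -RintegralB//.
    - by apply: eq_Rintegral => y _; rewrite addrK.
    - apply: (@bounded_integrable _ _ _ _ (M + M)); first exact: measurable_funD.
      move=> y; apply: (le_trans (ler_normD _ _)); apply: lerD => //.
      by rewrite ger0_norm// (le_trans _ (hM (x, y))).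
    - by apply: (@bounded_integrable _ _ _ _ `|M|).
  rewrite Rintegral_cst//; congr (_ - _); rewrite /fubini_F /Rintegral; congr fine.
  rewrite integral_mkcond; apply: eq_integral => y _; rewrite /f patchE indicE/=.
  by case: ifP => yI; rewrite ?mulr1 ?mulr0.
by apply: measurable_funB => //; apply: measurableT_comp => //; exact: measurable_fine.
Qed.

(** Off the box the integrand vanishes, and inside it the part away from the center weighs at most
    3/8 of the central mass, where the loss is at most [C]. *)
Lemma weighted_bump (I : R -> R) k c s rho x0 N A C M : (0 < k)%N -> 0 < s -> 0 < rho ->
  3 * s <= k%:R * rho -> x0 <= c - rho -> c + rho <= x0 + s -> - N <= x0 -> x0 + s <= N ->
  measurable_fun setT I -> (forall x, `|I x| <= M) ->
  (forall x, I x != 0 -> x0 < x < x0 + s) ->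
  (forall x, c - rho <= x <= c + rho -> A <= I x) -> (forall x, - C <= I x) -> 0 <= C ->
  (A - 3 / 8 * C) * \int[mu]_(x in `[c - rho, c + rho]) fbump k c s x <=
  \int[mu]_(x in `[- N, N]) (fbump k c s x * I x).
Proof.
move=> k0 s0 r0 sk xr rx Nx xN mI IM Is IA IC C0.
have fin (m t l r T1 T2 T3 : R) : 8 * (l + (m + r)) <= 11 * m -> - C * l <= T1 -> A * m <= T2 -> - C * r <= T3 ->
    (A - 3 / 8 * C) * m <= T1 + (T2 + T3).
  move=> h h1 h2 h3; have := ler_wpM2l C0 (_ : l + r <= 3 / 8 * m); rewrite mulrDr => h4.
  have : C * l + C * r <= C * (3 / 8 * m) by apply: h4; lra.
  lra.
have [rat _] := bump_ratio k0 s0 r0 sk xr rx.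
have mb := measurable_bump k c s; have bk := bump_le k c s.
have sp (f : R -> R) K u v w : measurable_fun setT f -> (forall x, `|f x| <= K) ->
    u <= v -> v <= w -> \int[mu]_(x in `[u, w]) f x =
    \int[mu]_(x in `[u, v]) f x + \int[mu]_(x in `[v, w]) f x.
  by move=> mf fK uv vw; apply: Rintegral_itv_split mf fK.
have mbI : measurable_fun setT (fun x => fbump k c s x * I x) by exact: measurable_funM.
have bIB x : `|fbump k c s x * I x| <= k%:R ^+ 2 * M by exact: mul_bound.
have ib u v : mu.-integrable `[u, v] (EFin \o fbump k c s) by exact: integrable_bump.
have low u v (D : R) : (forall x, u <= x <= v -> D <= I x) ->
    D * \int[mu]_(x in `[u, v]) fbump k c s x <= \int[mu]_(x in `[u, v]) (fbump k c s x * I x).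
  move=> DI; rewrite -RintegralZl//; apply: le_Rintegral => //.
  - apply: (@bounded_integrable _ _ _ _ (`|D| * k%:R ^+ 2)); first exact: measurable_funM.
    by move=> x; exact: mul_bound.
  - exact: bounded_integrable bIB.
  - move=> x; rewrite /= in_itv/= => xI; rewrite mulrC ler_wpM2l ?bump_ge0//.
    exact: DI.
have I0 x : ~ (x0 < x < x0 + s) -> fbump k c s x * I x = 0.
  by move=> nx; have [->|/Is//] := eqVneq (I x) 0; rewrite mulr0.
rewrite (sp _ _ (- N) x0 N mbI bIB Nx); last lra.
rewrite (sp _ _ x0 (x0 + s) N mbI bIB); [|lra|lra].
rewrite (@Rintegral_itv_eq0 _ _ (- N) x0) ?add0r; last first.
  by move=> x /andP[_ xx]; apply: I0 => /andP[]; lra.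
rewrite (@Rintegral_itv_eq0 _ _ (x0 + s) N) ?addr0; last first.
  by move=> x /andP[xx _]; apply: I0 => /andP[_]; lra.
rewrite (sp _ _ x0 (c - rho) (x0 + s) mbI bIB xr); last lra.
rewrite (sp _ _ (c - rho) (c + rho) (x0 + s) mbI bIB _ rx); last lra.
rewrite (sp _ _ x0 (c - rho) (x0 + s) mb bk xr) in rat; last lra.
rewrite (sp _ _ (c - rho) (c + rho) (x0 + s) mb bk _ rx) in rat; last lra.
apply: (fin _ 0 _ _ _ _ _ rat); apply: low => // x _; exact: IC.
Qed.

(** Two uses of [weighted_bump], with [m1] and [m2] the central masses. The integral in y is at
    least 5/8 W m2 for x in the central interval and at least -11/8 W m2 elsewhere; integrating in x
    leaves (5/8 - 3/8 * 11/8) W m1 m2 = 7/64 W m1 m2. *)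
Lemma concentration (w : R * R -> R) W N k x0 y0 s c1 c2 rho :
  measurable_fun setT w -> (forall z, `|w z| <= W) -> 0 < W -> (0 < k)%N -> 0 < s -> 0 < rho ->
  3 * s <= k%:R * rho -> - N <= x0 -> x0 + s <= N -> - N <= y0 -> y0 + s <= N ->
  x0 <= c1 - rho -> c1 + rho <= x0 + s -> y0 <= c2 - rho -> c2 + rho <= y0 + s ->
  (forall z, w z != 0 -> x0 < z.1 < x0 + s /\ y0 < z.2 < y0 + s) ->
  (forall z, c1 - rho <= z.1 <= c1 + rho -> c2 - rho <= z.2 <= c2 + rho -> w z = W) ->
  0 < \int[mu]_(x in `[- N, N]) (fbump k c1 s x * \int[mu]_(y in `[- N, N]) (w (x, y) * fbump k c2 s y)).
Proof.
move=> mw wW W0 k0 s0 r0 sk Nx xN Ny yN x1 x2 y1 y2 ws wc.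
have [_ M1] := bump_ratio k0 s0 r0 sk x1 x2; have [_ M2] := bump_ratio k0 s0 r0 sk y1 y2.
set m1 := \int[mu]_(x in _) _ in M1; set m2 := \int[mu]_(x in _) _ in M2.
pose h (z : R * R) := w z * fbump k c2 s z.2.
have mh : measurable_fun setT h.
  apply: measurable_funM => //.
  exact: (measurableT_comp (measurable_bump k c2 s) (@measurable_snd _ _ R R)).
have hB z : `|h z| <= W * k%:R ^+ 2 by apply: mul_bound => //; exact: bump_le.
pose I x := \int[mu]_(y in `[- N, N]) h (x, y).
have NN : - N <= N by lra.
have IB x : `|I x| <= W * k%:R ^+ 2 * (N - - N).
  by apply: Rintegral_itv_bound => //; exact: measurable_fun_pair2.
have IE x : I x = \int[mu]_(y in `[- N, N]) (fbump k c2 s y * w (x, y)).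
  by apply: eq_Rintegral => y _; rewrite /h mulrC.
have mwx x : measurable_fun setT (fun y => w (x, y)) by exact: measurable_fun_pair2.
have low x A : (forall y, c2 - rho <= y <= c2 + rho -> A <= w (x, y)) -> (A - 3 / 8 * W) * m2 <= I x.
  move=> wA; rewrite IE; apply: (@weighted_bump _ k c2 s rho y0 N A W W) => //; last exact: ltW.
    by move=> y /ws[].
  by move=> y; have := wW (x, y); rewrite ler_norml => /andP[].
have pos : 0 < (5 / 8 * W * m2 - 3 / 8 * (11 / 8 * W * m2)) * m1.
  have Wm : 0 < W * m2 by rewrite mulr_gt0.
  rewrite mulr_gt0// -!mulrA; lra.
apply: (lt_le_trans pos).
apply: (@weighted_bump I k c1 s rho x0 N _ _ (W * k%:R ^+ 2 * (N - - N))) => //.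
- exact: measurable_slice_integral mh hB.
- move=> x; apply: contraR => nx; rewrite IE Rintegral_itv_eq0// => y _.
  have [->|/ws[/= xs _]] := eqVneq (w (x, y)) 0; first by rewrite mulr0.
  by rewrite xs in nx.
- move=> x xI; have := low x W; rewrite (_ : W - 3 / 8 * W = 5 / 8 * W); last lra.
  by apply=> y yI; rewrite wc.
- move=> x; have := low x (- W); rewrite (_ : - W - 3 / 8 * W = - (11 / 8 * W)); last lra.
  by rewrite mulNr; apply=> y _; have := wW (x, y); rewrite ler_norml => /andP[].
- by rewrite mulr_ge0 ?mulr_ge0//; lra.
Qed.

End Moments.

(** * From vanishing moments to vanishing winding number *)

Section Geometry.
Context {R : realType}.
Notation mu := (@lebesgue_measure R).
Implicit Types (x y s t : R) (p q z : R * R) (S C D G : set (R * R)) (l : R -> R * R).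

Lemma component_open S z : open S -> open (connected_component S z).
Proof.
move=> oS; rewrite openE => p cp; have Sp := connected_component_sub cp.
have /nbhs_ballP[e /= e0 eS] : nbhs p S by exact: open_nbhs_nbhs.
apply/nbhs_ballP; exists e => // q pq; apply: connected_component_trans cp _.
pose g t : R * R := (p.1 + t * (q.1 - p.1), p.2 + t * (q.2 - p.2)).
have cg : continuous g.
  by apply: continuous_pair => t; apply: cvgD; try exact: cvg_cst; apply: cvgMl; exact: cvg_id.
have gS : g @` `[0, 1] `<=` S.
  move=> _ [t tI <-]; apply: eS; move: tI; rewrite /= in_itv/= => /andP[t0 t1].
  move: p q pq {Sp} @g cg => [p1 p2] [q1 q2]; rewrite ball_prodE /= !in_itv/=.
  move=> [/andP[a1 a2] /andP[b1 b2]] _.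
  have h (u v : R) : u - e < v -> v < u + e -> u - e < u + t * (v - u) < u + e.
    by move=> uv vu; apply/andP; split; nra.
  by split; exact: h.
have cA : connected (g @` `[0, 1]).
  by apply: connected_continuous_connected; [exact: segment_connected|exact: continuous_subspaceT].
apply: (connected_component_max _ gS cA).
  by exists 0; rewrite ?/g/= ?in_itv/= ?lexx ?ler01 ?mul0r ?addr0// -surjective_pairing.
by exists 1; rewrite ?/g/= ?in_itv/= ?lexx ?ler01// !mul1r !subrKC -surjective_pairing.
Qed.

(** Off [G] the point avoids the boundary curve: inside [D] the orientation gives one turn, and
    outside the closure [winds_exterior] gives 0. *)
Lemma jordan_winding G l D p n : simple_closed_lipschitz_curve G l -> jordan_domain l D ->
  counterclockwise l D -> ~ G p -> winds l p n -> n = 2 * pi * \1_D p.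
Proof.
move=> [ll lG l01 il] [[oD _] bD _ Dl] cc Gp wn.
rewrite (interior_id D).1// in Dl.
have [L L0 lL] := lipschitz_on_itv ll.
pose l' := l \o clamp 0 1.
have cl : continuous l'.
  apply: (@lip_continuous_norm _ _ _ L) => s t.
  apply: (le_trans (lL _ _ (clamp_itv s (@ler01 R)) (clamp_itv t (@ler01 R)))).
  by rewrite ler_wpM2l// (le_trans (lip_clamp 0 1 s t))// mul1r.
have lE t : 0 <= t <= 1 -> l t = l' t by move=> tI; rewrite /l'/= clamp_id.
have i0 : 0 <= (0 : R) <= 1 by rewrite lexx ler01.
have i1 : 0 <= (1 : R) <= 1 by rewrite lexx ler01.
have ccw q : D q -> winds l q (2 * pi).
  move=> Dq; have [th [cth thP thE]] := cc q Dq.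
  exists (th \o clamp 0 1); split.
  - exact: continuous_within_clamp1.
  - move=> t tI; rewrite /= clamp_id//; have [|rho r0 ->] := thP t; first by rewrite /= in_itv.
    by exists rho => //=; split; ring.
  - by rewrite /= !clamp_id.
rewrite indicE; have [Dp|Dp] := pselect (D p).
  by rewrite mem_set// mulr1; apply: winds_uniq wn (ccw p Dp).
rewrite memNset// mulr0.
have Dl' : closure D `\` D = l' @` `[0, 1].
  rewrite Dl; apply/seteqP; split => _ [t tI <-]; exists t => //;
  by move: tI; rewrite /= in_itv/= => /lE.
have nDp : ~ closure D p.
  move=> cDp; have : (closure D `\` D) p by [].
  by rewrite Dl => /lG.
have [q Dq] : D !=set0.
  apply: contrapT => /set0P/negP; rewrite negbK => /eqP D0.
  have : (closure D `\` D) (l' 0) by rewrite Dl'; exists 0 => //=; rewrite in_itv/= i0.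
  by rewrite D0 closure0; case.
apply: (@winds_exterior _ l' D q p n) => //.
- by rewrite -!lE.
- move=> s t; rewrite !inE/= !in_itv/= => /andP[s0 s1] /andP[t0 t1].
  rewrite -!lE ?s0 ?t0 ?ltW// => st; apply: il => //; rewrite inE/= in_itv/= ?s0 ?t0//.
- by apply: eq_winds (ccw q Dq) => t tI; exact: lE.
- by apply: eq_winds wn => t tI; exact: lE.
Qed.

Lemma square_in_box x y t x' y' s : 0 < t ->
  `]x, x + t[ `*` `]y, y + t[ `<=` `[x', x' + s] `*` `[y', y' + s] -> t <= s.
Proof.
move=> t0 sub; rewrite leNgt; apply/negP => st.
pose e := Num.min (t / 2) ((t - s) / 4).
have e0 : 0 < e by rewrite lt_min; apply/andP; split; lra.
have e1 : e <= t / 2 by rewrite ge_min lexx.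
have e2 : e <= (t - s) / 4 by rewrite ge_min lexx orbT.
have e3 : e < t by lra.
have [|/= + _] := sub (x + e, y + e); first by split; rewrite /= in_itv/=; apply/andP; split; lra.
have [|/= + _] := sub (x + t - e, y + e); first by split; rewrite /= in_itv/=; apply/andP; split; lra.
rewrite !in_itv/= => /andP[h1 h2] /andP[h3 h4]; lra.
Qed.

(** The bounding square makes the measure finite; for infinite measure [area] would be the default
    value 0. *)
Lemma square_area_le C x y t a b : measurable C -> C `<=` `[a, b] `*` `[a, b] -> 0 < t ->
  `]x, x + t[ `*` `]y, y + t[ `<=` C -> t ^+ 2 <= area C.
Proof.
move=> mC CB t0 sub.
have mQ : measurable (`]x, x + t[ `*` `]y, y + t[ : set (R * R)).
  by apply: measurableX; exact: measurable_itv.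
have mB : measurable (`[a, b] `*` `[a, b] : set (R * R)).
  by apply: measurableX; exact: measurable_itv.
have side (z : R) : mu `]z, z + t[%classic = t%:E.
  rewrite lebesgue_measure_itv/= lte_fin ltrDl t0 -EFinD; congr EFin; ring.
have EQ : (mu \x mu)%E (`]x, x + t[ `*` `]y, y + t[) = (t ^+ 2)%:E.
  rewrite expr2 EFinM -{1}(side x) -(side y).
  by apply: product_measure1E; exact: measurable_itv.
have EB : (mu \x mu)%E (`[a, b] `*` `[a, b]) = (mu `[a, b]%classic * mu `[a, b]%classic)%E.
  by apply: product_measure1E; exact: measurable_itv.
have Bf : (mu `[a, b]%classic * mu `[a, b]%classic < +oo)%E.
  by rewrite lte_mul_pinfty// ?ge0_fin_numE ?lebesgue_itv_fin.
have Bf' : ((mu \x mu)%E (`[a, b] `*` `[a, b]) < +oo)%E by rewrite EB.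
move: mQ mB EQ sub CB {EB} Bf'.
set P := `]x, x + t[ `*` _; set B := `[a, b] `*` _ => mQ mB EQ sub CB Bf'.
have le1 : ((mu \x mu) P <= (mu \x mu) C)%E.
  by apply: (@le_measure _ _ _ (mu \x mu)%E); rewrite ?inE.
have le2 : ((mu \x mu) C <= (mu \x mu) B)%E.
  by apply: (@le_measure _ _ _ (mu \x mu)%E); rewrite ?inE.
rewrite -lee_fin /area fineK; last first.
  by rewrite ge0_fin_numE ?measure_ge0//; exact: le_lt_trans le2 Bf'.
by rewrite -EQ.
Qed.

(** Put k = floor(d/2) + 1, so that d <= 2k - 1, and let m be the side of the minimal square. From A
    >= r^2 and pi >= 2 the bound on N gives 27 (m / 2) / r < d, hence 27/4 m <= k r. With s close to
    m and rho close to r / 2 the goal amounts to 6 m <= k r; the slack pays for extremal squares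
    that need not be attained and for the strict inclusion in an open box. *)
Lemma good_square m (C : 'I_m.+1 -> set (R * R)) S (d : nat) (j0 : 'I_m.+1) :
  let r := \big[Num.min/max_square_side (C ord0)]_j max_square_side (C j) in
  let A := \big[Num.max/area (C ord0)]_j area (C j) in
  open S -> bounded_set S -> range C = connected_component S @` S ->
  Num.floor (27 * pi / 2 * (A * (min_square_side S / 2) / r ^+ 3)) + 1 <= d%:Z ->
  exists s rho x0 y0 c1 c2 : R,
    [/\ 0 < s, 0 < rho, 3 * s <= (d./2).+1%:R * rho,
        S `<=` `]x0, x0 + s[ `*` `]y0, y0 + s[ &
        `[c1 - rho, c1 + rho] `*` `[c2 - rho, c2 + rho] `<=` C j0].
Proof.
move=> r A oS bS CS.
have Cz j : exists2 z, S z & C j = connected_component S z.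
  have : range C (C j) by exists j.
  by rewrite CS => -[z Sz <-]; exists z.
have CjS j : C j `<=` S by have [z Sz ->] := Cz j; exact: connected_component_sub.
have oC j : open (C j) by have [z Sz ->] := Cz j; exact: component_open.
have [M SM] : exists M, S `<=` `[- M, M] `*` `[- M, M].
  move: bS => [M [_ SM]]; exists (M + 1) => z Sz.
  have := SM (M + 1) (ltr_pwDr ltr01 (lexx M)) z Sz; rewrite /= prod_normE ge_max !ler_norml.
  by move=> /andP[h1 h2]; split; rewrite /= in_itv/=.
pose Q j := [set s : R | 0 < s /\ exists x y, `]x, x + s[ `*` `]y, y + s[ `<=` C j].
pose E := [set s : R | 0 <= s /\ exists x y, S `<=` `[x, x + s] `*` `[y, y + s]].
have QE j t s : Q j t -> E s -> t <= s.
  move=> [t0 [x [y sub]]] [s0 [x' [y' sub']]].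
  by apply: (square_in_box t0 (subset_trans sub (subset_trans (CjS j) sub'))).
have [z0 Sz0 _] := Cz ord0.
have M0 : 0 <= M.
  by have [/=] := SM _ Sz0; rewrite in_itv/= => /andP[h1 h2] _; lra.
have EM : E (2 * M).
  split; first by rewrite mulr_ge0.
  by exists (- M), (- M); rewrite (_ : - M + 2 * M = M)//; ring.
have hE : has_inf E by split; [exists (2 * M)|exists 0 => s []].
have Qne j : Q j !=set0.
  have [z Sz CE] := Cz j; have Cjz : C j z by rewrite CE; exact: connected_component_refl.
  have /nbhs_ballP[e /= e0 eC] : nbhs z (C j) by exact: open_nbhs_nbhs.
  exists (2 * e); split; first by rewrite mulr_gt0.
  exists (z.1 - e), (z.2 - e); have := ball_prodE z.1 z.2 e; rewrite -surjective_pairing => bE.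
  by rewrite (_ : z.1 - e + 2 * e = z.1 + e) 1?(_ : z.2 - e + 2 * e = z.2 + e) -?bE//; ring.
have hQ j : has_sup (Q j) by split => //; exists (2 * M) => t Qt; exact: QE Qt EM.
have side0 j : 0 < max_square_side (C j).
  have [t Qt] := Qne j; apply: (lt_le_trans Qt.1).
  by apply: ub_le_sup Qt; case: (hQ j).
have r0 : 0 < r by apply: lt_bigmin.
have rj j : r <= max_square_side (C j) by exact: bigmin_le.
pose mS := min_square_side S.
have rm : r <= mS.
  apply: (le_trans (rj ord0)); apply: ge_sup; first exact: Qne.
  move=> t Qt; apply: lb_le_inf; first by case: hE.
  by move=> s Es; exact: QE Qt Es.
have rA : r ^+ 2 <= A.
  have A0 : area (C ord0) <= A by exact: le_bigmax.
  have sq t : Q ord0 t -> t ^+ 2 <= A.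
    move=> [t0 [x [y sub]]]; apply: le_trans A0.
    apply: (@square_area_le (C ord0) x y t (- M) M) => //.
      exact: open_measurable_plane.
    exact: subset_trans (CjS ord0) SM.
  have A00 : 0 <= A by have [t Qt] := Qne ord0; apply: le_trans (sq t Qt); exact: sqr_ge0.
  rewrite -[X in _ <= X]sqr_sqrtr// lerXn2r ?nnegrE ?sqrtr_ge0 ?(ltW r0)//.
  apply: (le_trans (rj ord0)); apply: ge_sup; first exact: Qne.
  move=> t Qt; rewrite -[t]ger0_norm; last by rewrite ltW// Qt.1.
  by rewrite -sqrtr_sqr ler_sqrt// sq.
move=> Nd; pose k : R := (d./2).+1%:R.
have kr : 27 / 4 * mS <= k * r.
  have d1 : 27 * pi / 2 * (A * (mS / 2) / r ^+ 3) < d%:R.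
    apply: lt_le_trans (floorD1_gt _) _.
    by rewrite (_ : d%:R = (d%:Z)%:~R)// ler_int.
  have q1 : 27 * (mS / 2) / r <= 27 * pi / 2 * (A * (mS / 2) / r ^+ 3).
    have -> : 27 * pi / 2 * (A * (mS / 2) / r ^+ 3) = (pi / 2) * (A / r ^+ 2) * (27 * (mS / 2) / r).
      by field; rewrite gt_eqF.
    have m0 : 0 <= 27 * (mS / 2) / r by rewrite divr_ge0 ?mulr_ge0 ?(ltW r0)//; lra.
    rewrite ler_peMl//; apply: (@le_trans _ _ (1 * 1)); first by rewrite mulr1.
    rewrite ler_pM//; last by rewrite ler_pdivlMr ?exprn_gt0// mul1r.
    by rewrite ler_pdivlMr// mul1r pi_ge2.
  have dk : d%:R <= 2 * k - 1.
    rewrite lerBrDr natr1 /k -natrM ler_nat mul2n doubleS ltnS -{1}(odd_double_half d).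
    by case: (odd d).
  have : 27 * (mS / 2) / r <= 2 * k by lra.
  by rewrite ler_pdivrMr//; lra.
have [s1 Es1 s1m] := inf_adherent (divr_gt0 (lt_le_trans r0 rm) (ltr0Sn R 99)) hE.
have [t Qt tr] := sup_adherent (divr_gt0 (side0 j0) (ltr0Sn R 99)) (hQ j0).
have s1m' : s1 < 101 / 100 * mS by move: s1m; rewrite -/(min_square_side S) -/mS; lra.
have tr' : 99 / 100 * r < t.
  by move: tr; rewrite -/(max_square_side (C j0)); have := rj j0; lra.
case: Qt => t0 [x [y sub]]; case: Es1 => s10 [x' [y' sub']].
(* The margins fit because 27/4 * 99/100 * 49/100 > 3 * 102/100. *)
pose s : R := 102 / 100 * mS; pose rho : R := 49 / 100 * t.
have m0 : 0 < mS by exact: lt_le_trans rm.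
have ss : s1 < s by rewrite /s; lra.
have k0 : 0 < k by rewrite ltr0n.
exists s, rho, (x' - (s - s1) / 2), (y' - (s - s1) / 2), (x + t / 2), (y + t / 2); split.
- by rewrite mulr_gt0.
- by rewrite mulr_gt0.
- rewrite -/k /s /rho; have : k * (99 / 100 * r) <= k * t by rewrite ler_wpM2l ?ltW.
  lra.
- move=> z /sub' [/=]; rewrite !in_itv/= => /andP[z1 z2] /andP[z3 z4].
  clear -z1 z2 z3 z4 s1m' ss; split; apply/andP; split; lra.
- apply: subset_trans sub => z [/=]; rewrite !in_itv/= /rho => /andP[z1 z2] /andP[z3 z4].
  clear -t0 z1 z2 z3 z4; split; apply/andP; split; lra.
Qed.

(** The boundary of [D] misses [S], so [D] is both open and closed relative to each component of
    [S]. *)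
Lemma component_const S D p0 p1 : open D -> S `&` (closure D `\` D) = set0 ->
  connected_component S p0 p1 -> (\1_D p1 : R) = \1_D p0.
Proof.
move=> oD SD zx.
have Sz : S p0 by apply: contrapT => nz; move: zx; rewrite connected_component_out.
have key p q : connected_component S p q -> S p -> D p -> D q.
  move=> pq Sp Dp; pose A := connected_component S p.
  have E : A `&` D = A.
    apply: (@component_connected _ S p).
    - by exists p; split => //; exact: connected_component_refl.
    - by exists D.
    - exists (closure D); first exact: closed_closure.
      apply/seteqP; split => y [Ay Dy]; split => //; first exact: subset_closure.
      apply: contrapT => nDy; have : (S `&` (closure D `\` D)) y.
        by split=> //; exact: connected_component_sub Ay.
      by rewrite SD.
  have : (A `&` D) q by rewrite E; exact: pq.
  by case.
have Sp1 : S p1 by exact: connected_component_sub zx.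
rewrite !indicE; have [D1|D1] := pselect (D p1).
  by rewrite !mem_set//; exact: key (connected_component_sym zx) Sp1 D1.
by rewrite !memNset// => D0; apply: D1; exact: key zx Sz D0.
Qed.

Lemma winding_zero (d : nat) a b (F1 F2 g2 : R -> R) L1 L2 B G z :
  a < b -> lip L1 F1 -> 0 <= L2 -> lip L2 F2 ->
  (forall t, `|F1 t| <= B) -> (forall t, `|F2 t| <= B) -> density a b F2 g2 L2 ->
  F1 a = F1 b -> F2 a = F2 b -> (forall t, G (F1 t, F2 t)) -> C2 d G ->
  (forall i j, (i < d.+2)%N -> (j < d.+1)%N ->
    \int[mu]_(t in `[a, b]) (F1 t ^+ i * (F2 t ^+ j * g2 t)) = 0) ->
  ~ G z -> winds (rescale a b F1 F2) z 0.
Proof.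
move=> ab lF1 L20 lF2 F1B F2B D2 F1ab F2ab FG [_ triG [N HN Nd]] M0 Gz.
have cF1 := lip_continuous lF1; have cF2 := lip_continuous lF2.
pose c := rescale a b F1 F2.
have cc : continuous c.
  have ca : continuous (fun t => a + t * (b - a)).
    by move=> t; apply: cvgD; [exact: cvg_cst|apply: cvgMl; exact: cvg_id].
  apply: continuous_pair => t.
    by apply: (@continuous_comp _ _ _ (fun t => a + t * (b - a)) F1); [exact: ca|exact: cF1].
  by apply: (@continuous_comp _ _ _ (fun t => a + t * (b - a)) F2); [exact: ca|exact: cF2].
have cG t : G (c t) by exact: FG.
have c01 : c 0 = c 1 by rewrite /c /rescale !mul0r !mul1r !addr0 (addrC a) subrK F1ab F2ab.
have [n cn] : exists n, winds c z n.
  by apply: winds_exists => // t ct; apply: Gz; rewrite -ct.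
case: HN => [[triv _]|[_ [m [l [D [s [C [_ lG jD sl [_ CS NE]]]]]]]]].
  have hom : path_homotopic G c (cst (c 0)).
    apply: triv => //; split => //; first exact: continuous_subspaceT.
    by move=> _ [t _ <-].
  by have := cn; rewrite (winds_null_homotopic Gz cc hom cn).
case: sl => sl gen; move: CS NE.
set S := (\bigcup_(j in _) D j) `\` _.
set A := \big[Num.max/_]_j _; set r := \big[Num.min/_]_j _ => CS NE.
have oD j : open (D j) by have [[[]]] := jD j.
have bD j : bounded_set (D j) by have [[_]] := jD j.
have lD j : closure (D j) `\` D j = l j @` `[0, 1].
  by have [[_ _ _ <-] _] := jD j; rewrite (interior_id (D j)).1.
have cl j : compact (l j @` `[0, 1]).
  have [ll _ _ _] := lG j; have [L L0 lL] := lipschitz_on_itv ll.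
  have -> : l j @` `[0, 1] = (l j \o clamp 0 1) @` `[0, 1].
    by apply/seteqP; split => _ [t tI <-]; exists t => //=; rewrite clamp_id//; move: tI; rewrite /= in_itv.
  apply: continuous_compact; last exact: segment_compact.
  apply: continuous_subspaceT; apply: (@lip_continuous_norm _ _ _ L) => u v /=.
  apply: (le_trans (lL _ _ (clamp_itv u (@ler01 R)) (clamp_itv v (@ler01 R)))).
  by rewrite ler_wpM2l// (le_trans (lip_clamp 0 1 u v))// mul1r.
have oS : open S.
  rewrite /S setDE; apply: openI; first exact: bigcup_open.
  apply: closed_openC; apply: closed_bigcup; first exact: finite_finset.
  by move=> j _; apply: compact_closed (cl j); exact: norm_hausdorff.
have SlD j : S `&` (closure (D j) `\` D j) = set0.
  rewrite lD; apply/seteqP; split => // p [[_ np] lp]; apply: np; by exists j.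
have [k kP] := homologous_winding sl gen cc cG c01.
(* Given by a formula on the whole plane, [w] is measurable; the factor [\1_S] alters the sum only
   on the curves [l j], which lie in [G], so off [G] it is the winding number. *)
pose w p : R := \1_S p * \sum_j \1_(D j) p * (k j)%:~R.
have wP p : ~ G p -> winds c p (2 * pi * w p).
  move=> Gp; have [nn [nnP wn]] := kP p Gp.
  suff <- : \sum_j nn j *~ k j = 2 * pi * w p by [].
  have -> : w p = \sum_j \1_(D j) p * (k j)%:~R.
    rewrite /w indicE; have [Sp|Sp] := pselect (S p); first by rewrite mem_set// mul1r.
    rewrite memNset// mul0r big1// => j _; rewrite indicE memNset ?mul0r// => Dp.
    apply: Sp; split; first by exists j.
    by move=> [i _ lp]; apply: Gp; have [_ sub _ _] := lG i; exact: sub.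
  rewrite mulr_sumr; apply: eq_bigr => j _.
  rewrite (jordan_winding (lG j) (jD j).1 (jD j).2 Gp (nnP j)).
  by rewrite -mulrzr mulrA.
have wS p : w p != 0 -> S p.
  by apply: contraNP => nSp; rewrite /w indicE memNset// mul0r.
have wc p p' : connected_component S p p' -> w p' = w p.
  move=> pp'; have Sp' := connected_component_sub pp'.
  have Sp := connected_component_sub (connected_component_sym pp').
  rewrite /w !indicE !mem_set// !mul1r; apply: eq_bigr => j _.
  by rewrite (component_const (oD j) (SlD j) pp').
suff w0 : w z = 0 by have := wP z Gz; rewrite w0 mulr0.
apply/eqP; apply: contrapT => /negP wz.
have Cp j : exists2 p, S p & connected_component S p = C j.
  have : range C (C j) by exists j.
  by rewrite CS => -[p Sp pE]; exists p.
(* One point in each of the finitely many components; |w| attains its maximum at one of them. *)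
pose pt j := xget z [set p | S p /\ connected_component S p = C j].
have ptP j : S (pt j) /\ connected_component S (pt j) = C j.
  have [p Sp pE] := Cp j.
  exact: (@xgetPex _ z [set p | S p /\ connected_component S p = C j] (ex_intro _ p (conj Sp pE))).
have wpt p : S p -> exists j, w p = w (pt j).
  move=> Sp; have : (connected_component S @` S) (connected_component S p) by exists p.
  rewrite -CS => -[j _ jE]; exists j; apply: wc; rewrite (ptP j).2 jE.
  exact: connected_component_refl.
have [j0 _ j0P] := @arg_maxP _ R 'I_m.+1 ord0 predT (fun j => `|w (pt j)|) isT.
pose W := `|w (pt j0)|.
have wW p : `|w p| <= W.
  have [->|/wS/wpt[j ->]] := eqVneq (w p) 0; first by rewrite normr0 normr_ge0.
  exact: j0P.
have W0 : 0 < W by apply: lt_le_trans (wW z); rewrite normr_gt0.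
have bS : bounded_set S.
  have : \forall M \near +oo, forall j, forall p, D j p -> `|p| <= M.
    by apply: filter_forall => j; exact: bD j.
  by apply: filterS => M MD p [[j _ Dp] _]; exact: MD Dp.
have [M SM] : exists M, forall p, S p -> `|p| <= M.
  by move: bS => [M [_ SM]]; exists (M + 1); apply: SM; rewrite ltrDl.
have Nd' : Num.floor (27 * pi / 2 * (A * (min_square_side S / 2) / r ^+ 3)) + 1 <= d%:Z.
  by rewrite -NE.
have [t [rho [x0 [y0 [c1 [c2 [t0 r0 tr box sq]]]]]]] := good_square j0 oS bS CS Nd'.
have sqS p : c1 - rho <= p.1 <= c1 + rho -> c2 - rho <= p.2 <= c2 + rho -> C j0 p.
  by move=> h1 h2; apply: sq; split; rewrite /= in_itv.
have CjS : C j0 `<=` S by rewrite -(ptP j0).2; exact: connected_component_sub.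
have bx p : S p -> x0 < p.1 < x0 + t /\ y0 < p.2 < y0 + t.
  by move=> /box[]; rewrite /= !in_itv/=.
have ends x : x - rho <= x - rho <= x + rho /\ x - rho <= x + rho <= x + rho.
  by clear -r0; split; apply/andP; split; lra.
have [/andP[x1 _] /andP[y1 _]] : x0 < c1 - rho < x0 + t /\ y0 < c2 - rho < y0 + t.
  by apply: (bx (c1 - rho, c2 - rho)); apply/CjS/sqS; exact: (ends _).1.
have [/andP[_ x2] /andP[_ y2]] : x0 < c1 + rho < x0 + t /\ y0 < c2 + rho < y0 + t.
  by apply: (bx (c1 + rho, c2 + rho)); apply/CjS/sqS; exact: (ends _).2.
have [NN [BN MN [Nx xN] [Ny yN]]] : exists NN, [/\ B + 1 <= NN, M < NN - 1,
    - NN <= x0 /\ x0 + t <= NN & - NN <= y0 /\ y0 + t <= NN].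
  clear -t0; exists (`|B| + `|M| + `|x0| + `|y0| + t + 2).
  move: (ler_norm M) (ler_norm B) (ler_norm x0) (ler_norm y0) (ler_norm (- x0)) (ler_norm (- y0)).
  rewrite !normrN; move: (normr_ge0 B) (normr_ge0 M).
  move: `|B| `|M| `|x0| `|y0| => nB nM nx ny; split; [lra|lra|split; lra|split; lra].
have wN p : NN - 1 <= `|p| -> w p = 0.
  by move=> pN; apply/eqP; apply: contrapT => /negP/wS/SM pM; clear -pM pN MN; lra.
(* [fejer K] has degree at most twice [d./2], hence at most d; the sign [e] makes the extremal value
   of [w] positive. *)
pose K := (d./2).+1; pose e : R := Num.sg (w (pt j0)).
have e1 : `|e| = 1 by rewrite normr_sg; case: eqVneq W0 => [w0|//]; rewrite /W w0 normr0 ltxx.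
have we p : `|e * w p| <= W by rewrite normrM e1 mul1r.
have mw : measurable_fun setT w.
  apply: measurable_funM; first by apply: measurable_indic; exact: open_measurable_plane.
  apply: measurable_sum => j; apply: measurable_funM => //.
  by apply: measurable_indic; exact: open_measurable_plane.
have pos := @concentration R (fun p => e * w p) W NN K x0 y0 t c1 c2 rho.
have {pos} : 0 < \int[mu]_(x in `[- NN, NN]) (fbump K c1 t x *
    \int[mu]_(y in `[- NN, NN]) (e * w (x, y) * fbump K c2 t y)).
  apply: pos => //; try exact: ltW.
  - exact: measurable_funM.
  - by move=> p; rewrite mulf_eq0 negb_or => /andP[_ /wS /bx].
  - move=> p p1 p2; rewrite (wc (pt j0)); first by rewrite /e /W normrEsg.
    by rewrite (ptP j0).2; exact: sqS.
pose lin (u : R) : {poly R} := t^-1 *: ('X - u%:P).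
pose P := fejer K \Po lin c1; pose Q := e *: (fejer K \Po lin c2).
have linE u v : (lin u).[v] = (v - u) / t by rewrite /lin !hornerE mulrC.
have szlin u : (size (fejer K \Po lin u) <= d.+1)%N.
  apply: (leq_trans (size_comp_poly_leq _ _)); rewrite ltnS.
  apply: (@leq_trans ((d./2).*2 * 1)); last first.
    by rewrite muln1 -[X in (_ <= X)%N](odd_double_half d) leq_addl.
  apply: leq_mul; first by rewrite -subn1 leq_subLR add1n size_fejer.
  by rewrite -subn1 leq_subLR addn1 (leq_trans (size_scale_leq _ _))// size_XsubC.
have [mG nG] := triangulable_null triG.
have clG : closed G by case: triG => cG' _; apply: compact_closed cG'; exact: norm_hausdorff.
have := @poly_green R a b F1 F2 g2 L2 B G w W NN d.+1 d.+1 P Q ab L20 cF1 F1B lF2 F2B D2 F1ab F2ab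
  clG nG (fun u _ => FG u) mw wW wP BN wN M0 (szlin c1) (leq_trans (size_scale_leq _ _) (szlin c2)).
(* On the box that contains the support of [w] the clamped kernels coincide with polynomials, so the
   integral just shown positive is one that the moments force to be 0. *)
suff -> : \int[mu]_(x in `[- NN, NN]) (P.[x] * \int[mu]_(y in `[- NN, NN]) (w (x, y) * Q.[y])) =
    \int[mu]_(x in `[- NN, NN]) (fbump K c1 t x *
      \int[mu]_(y in `[- NN, NN]) (e * w (x, y) * fbump K c2 t y)) by move=> ->; rewrite ltxx.
have win (u v c' : R) : u < c' - rho -> c' + rho < u + t -> u < v < u + t -> c' - t <= v <= c' + t.
  by clear -r0 => h1 h2 /andP[h3 h4]; apply/andP; split; lra.
have inner x : \int[mu]_(y in `[- NN, NN]) (w (x, y) * Q.[y]) =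
    \int[mu]_(y in `[- NN, NN]) (e * w (x, y) * fbump K c2 t y).
  apply: eq_Rintegral => y _; have [->|/wS/bx[_ /= yI]] := eqVneq (w (x, y)) 0.
    by rewrite mulr0 !mul0r.
  rewrite bumpE//; last exact: win y1 y2 yI.
  by rewrite /Q hornerZ horner_comp linE; ring.
apply: eq_Rintegral => x _; rewrite inner.
have [xI|xI] := boolP (x0 < x < x0 + t).
  congr (_ * _); rewrite bumpE//; last exact: win x1 x2 xI.
  by rewrite /P horner_comp linE.
rewrite (@Rintegral_itv_eq0 _ _ (- NN) NN) ?mulr0// => y _.
have [->|/wS/bx[/= xI']] := eqVneq (w (x, y)) 0; first by rewrite mulr0 mul0r.
by rewrite xI' in xI.
Qed.

End Geometry.

(** * The image of dF on Borel sets of the plane *)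

Section Pushforward.
Context {R : realType}.
Notation mu := (@lebesgue_measure R).
Implicit Types (a b c x y s t L N B M : R) (G : set (R * R)).

(** The sets annihilated by the image under [Phi] of the signed measure h dt form a Dynkin system;
    bounded convergence gives closure under countable disjoint unions. *)
Lemma integral_dynkin d (T : measurableType d) (Phi : R -> T) (h : R -> R) M a b (G : set (set T)) :
  @measurable _ T = <<s G >> -> setI_closed G ->
  measurable_fun setT Phi -> measurable_fun setT h -> (forall t, `|h t| <= M) ->
  \int[mu]_(t in `[a, b]) h t = 0 ->
  (forall A, G A -> \int[mu]_(t in `[a, b]) (\1_A (Phi t) * h t) = 0) ->
  forall A, measurable A -> \int[mu]_(t in `[a, b]) (\1_A (Phi t) * h t) = 0.
Proof.
move=> GE GI mPhi mh hM h0 HG A; rewrite GE.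
have mA (B : set T) : measurable B -> measurable_fun setT (fun t => \1_B (Phi t) * h t).
  move=> mB; apply: measurable_funM => //.
  have mi : measurable_fun setT (\1_B : T -> R) by exact: measurable_indic.
  exact: measurableT_comp mi mPhi.
have bA (B : set T) t : `|\1_B (Phi t) * h t| <= 1 * M.
  by apply: mul_bound => //; rewrite indicE; case: (_ \in _); rewrite ?normr1 ?normr0.
apply: (dynkin_induction (P := fun A => \int[mu]_(t in `[a, b]) (\1_A (Phi t) * h t) = 0) GE GI).
- by rewrite -[RHS]h0; apply: eq_Rintegral => t _; rewrite indicE in_setT mul1r.
- exact: HG.
- move=> B mB B0.
  transitivity (\int[mu]_(t in `[a, b]) (h t - \1_B (Phi t) * h t)); last first.
    rewrite RintegralB// ?B0 ?h0 ?subrr//; first exact: bounded_integrable hM.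
    by apply: bounded_integrable (bA B); exact: mA.
  apply: eq_Rintegral => t _; rewrite !indicE in_setC.
  by case: (_ \in _); rewrite ?mul0r ?mul1r ?subrr ?subr0.
- move=> F mF tF F0.
  pose s n (p : T) : R := \sum_(i < n) \1_(F i) p.
  have sE j (x : T) n : F j x -> s n x = (j < n)%N%:R.
    move=> Fj; have out i : i <> j -> \1_(F i) x = 0 :> R.
      move=> ij; rewrite indicE memNset// => Fi; apply: ij.
      by apply: tF => //; exists x.
    rewrite /s; have [jn|nj] := ltnP j n.
      rewrite (bigD1 (Ordinal jn))//= big1 ?addr0; first by rewrite indicE mem_set.
      by move=> i /eqP ij; apply: out => E; apply: ij; exact: val_inj.
    by rewrite big1// => i _; apply: out => E; move: (ltn_ord i); rewrite E ltnNge nj.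
  have s0 (x : T) n : ~ (\bigcup_k F k) x -> s n x = 0.
    by move=> nx; rewrite /s big1// => i _; rewrite indicE memNset// => Fi; apply: nx; exists i.
  have sB (x : T) n : `|s n x| <= 1.
    have [[j _ Fj]|/s0->] := pselect ((\bigcup_k F k) x); last by rewrite normr0.
    by rewrite (sE j)//; case: (_ < _)%N; rewrite ?normr1 ?normr0.
  have sI n : \int[mu]_(t in `[a, b]) (s n (Phi t) * h t) = 0.
    transitivity (\int[mu]_(t in `[a, b]) (\sum_(i < n) (\1_(F i) (Phi t) * h t))).
      by apply: eq_Rintegral => t _; rewrite /s big_distrl.
    rewrite (Rintegral_sum _ a b (f := fun i t => \1_(F i) (Phi t) * h t)); first by rewrite big1.
    by move=> i; split; [exact: mA|exists (1 * M); exact: bA].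
  have C : \int[mu]_(t in `[a, b]) (s n (Phi t) * h t) @[n --> \oo] -->
      \int[mu]_(t in `[a, b]) (\1_(\bigcup_k F k) (Phi t) * h t).
    apply: (@bounded_cvg_Rintegral _ _ _ _ _ _ _ (1 * M)) => //.
    - exact: lebesgue_itv_fin.
    - move=> n; apply: measurable_funTS; apply: measurable_funM => //.
      apply: (@measurableT_comp _ _ _ _ _ _ (s n)) => //.
      by apply: measurable_sum => i; exact: measurable_indic.
    - by move=> n t _; exact: mul_bound.
    - move=> t _; apply: cvgMl; rewrite indicE.
      have [[j _ Fj]|nF] := pselect ((\bigcup_k F k) (Phi t)).
        rewrite mem_set; last by exists j.
        apply: cvg_near_cst; near=> n; rewrite (sE j)// (_ : (j < n)%N)//.
        by near: n; exact: nbhs_infty_gt.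
      by rewrite memNset//; apply: cvg_near_cst; apply: nearW => n; rewrite s0.
  move: C; rewrite (funext sI) => C.
  apply: (cvg_unique _ C); [exact: Rhausdorff|exact: cvg_cst].
Unshelve. all: by end_near. Qed.

Lemma measurable_rays : @measurable _ R = <<s RGenOInfty.G (R := R) >>.
Proof. exact: RGenOInfty.measurableE. Qed.

(** Rays are replaced by Borel sets in one coordinate at a time, and then rectangles by Borel sets
    of the plane. The level -B - 1 lies below all values, so the ray above it stands for the whole
    line. *)
Lemma quadrants_generate a b (F1 F2 h : R -> R) B M :
  measurable_fun setT F1 -> measurable_fun setT F2 -> measurable_fun setT h ->
  (forall t, `|F1 t| <= B) -> (forall t, `|F2 t| <= B) -> (forall t, `|h t| <= M) ->
  (forall c c', \int[mu]_(t in `[a, b]) (\1_(above F1 c) t * (\1_(above F2 c') t * h t)) = 0) ->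
  forall A : set (R * R), measurable A -> \int[mu]_(t in `[a, b]) (\1_A (F1 t, F2 t) * h t) = 0.
Proof.
move=> mF1 mF2 mh F1B F2B hM quad.
have rayI : setI_closed (RGenOInfty.G (R := R)).
  move=> _ _ [x ->] [y ->]; exists (Num.max x y); apply/seteqP; split => t /=; rewrite !in_itv/= !andbT gt_max.
    by move=> [-> ->].
  by move=> /andP.
have aboveE (F : R -> R) c t : (\1_`]c, +oo[ (F t) : R) = \1_(above F c) t.
  by rewrite indic_above indicE /=; congr (nat_of_bool _)%:R; rewrite mem_setE in_itv/= andbT.
have mabove (F : R -> R) c : measurable_fun setT F -> measurable_fun setT (\1_(above F c) : R -> R).
  move=> mF; rewrite (_ : \1_(above F c) = \1_`]c, +oo[ \o F); last by apply/funext => t; rewrite -aboveE.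
  by apply: measurableT_comp => //; exact: measurable_indic.
have all1 (F : R -> R) t : (forall t, `|F t| <= B) -> (\1_(above F (- B - 1)) t : R) = 1.
  by move=> FB; rewrite indic_above (_ : _ < _)//; have := FB t; rewrite ler_norml => /andP[]; lra.
have ind (T : Type) (A : set T) (x : T) : `|\1_A x : R| <= 1.
  by rewrite indicE; case: (_ \in _); rewrite ?normr1 ?normr0.
have step1 c (B2 : set R) : measurable B2 ->
    \int[mu]_(t in `[a, b]) (\1_B2 (F2 t) * (\1_(above F1 c) t * h t)) = 0.
  apply: (integral_dynkin (M := 1 * M) measurable_rays rayI mF2).
  - by apply: measurable_funM => //; exact: mabove.
  - by move=> t; apply: mul_bound.
  - rewrite -[RHS](quad c (- B - 1)); apply: eq_Rintegral => t _.
    by rewrite (all1 F2)// mul1r.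
  - move=> _ [c' ->]; rewrite -[RHS](quad c c'); apply: eq_Rintegral => t _.
    by rewrite aboveE; ring.
have mB2 (B2 : set R) : measurable B2 -> measurable_fun setT (fun t => (\1_B2 (F2 t) : R) * h t).
  move=> m2; apply: measurable_funM => //.
  have mi : measurable_fun setT (\1_B2 : R -> R) by exact: measurable_indic.
  exact: measurableT_comp mi mF2.
have step2 (B1 B2 : set R) : measurable B1 -> measurable B2 ->
    \int[mu]_(t in `[a, b]) (\1_B1 (F1 t) * (\1_B2 (F2 t) * h t)) = 0.
  move=> m1 m2; move: B1 m1; apply: (integral_dynkin (M := 1 * M) measurable_rays rayI mF1).
  - exact: mB2.
  - by move=> t; apply: mul_bound.
  - rewrite -[RHS](step1 (- B - 1) B2 m2); apply: eq_Rintegral => t _.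
    by rewrite (all1 F1)// mul1r.
  - move=> _ [c ->]; rewrite -[RHS](step1 c B2 m2); apply: eq_Rintegral => t _.
    by rewrite aboveE; ring.
have prodE (B1 B2 : set R) t : (\1_(B1 `*` B2) (F1 t, F2 t) : R) = \1_B1 (F1 t) * \1_B2 (F2 t).
  rewrite !indicE -natrM; congr (_%:R); have [h1|h1] := pselect (B1 (F1 t)); last first.
    by rewrite [in RHS]memNset// mul0n memNset// => -[].
  rewrite [F1 t \in _]mem_set// mul1n; have [h2|h2] := pselect (B2 (F2 t)).
    by rewrite !mem_set.
  by rewrite !memNset// => -[].
apply: (integral_dynkin (M := M) (measurable_prod_measurableType R R)) => //.
- move=> _ _ [A1 mA1 [A2 mA2 <-]] [C1 mC1 [C2 mC2 <-]]; rewrite -setXI.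
  by exists (A1 `&` C1); [exact: measurableI|exists (A2 `&` C2) => //; exact: measurableI].
- exact/measurable_fun_pair.
- rewrite -[RHS](step2 setT setT measurableT measurableT); apply: eq_Rintegral => t _.
  by rewrite !indicE !in_setT !mul1r.
- move=> _ [A1 mA1 [A2 mA2 <-]]; rewrite -[RHS](step2 A1 A2 mA1 mA2).
  by apply: eq_Rintegral => t _; rewrite prodE mulrA.
Qed.

Lemma ae_dense (P : R -> Prop) c e : 0 < e -> {ae mu, forall x, P x} -> exists2 x, c < x < c + e & P x.
Proof.
move=> e0 [N [mN N0 NP]]; apply: contrapT => nP.
have sub : `]c, c + e[ `<=` N.
  move=> x; rewrite /= in_itv/= => xI; apply: NP => /= Px; apply: nP; by exists x.
have mI : measurable (`]c, c + e[%classic : set (measurableTypeR R)) by exact: measurable_itv.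
set I := `]c, c + e[%classic in sub mI.
have : (mu I <= mu N)%E by apply: le_measure; rewrite ?inE//.
rewrite N0 /I lebesgue_measure_itv/= lte_fin ltrDl e0 -EFinD lee_fin; lra.
Qed.

(** With winding number 0 the slice formula gives 0 for every continuous weight on a line whose
    slice of [G] is null. The indicator of the ray above c' is a limit of such weights, and an
    arbitrary c is a limit of such lines. *)
Lemma quadrant_zero a b (F1 F2 g2 : R -> R) L B G :
  a < b -> 0 <= L -> continuous F1 -> lip L F2 -> (forall t, `|F2 t| <= B) -> density a b F2 g2 L ->
  F1 a = F1 b -> F2 a = F2 b -> closed G -> {ae mu, forall x, mu (xsection G x) = 0%E} ->
  (forall t, G (F1 t, F2 t)) -> (forall z, ~ G z -> winds (rescale a b F1 F2) z 0) ->
  forall c c', \int[mu]_(t in `[a, b]) (\1_(above F1 c) t * (\1_(above F2 c') t * g2 t)) = 0.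
Proof.
move=> ab L0 cF1 lF2 F2B D2 F1ab F2ab cG G0 FG wP c c'.
have [mg2 g2L _ _] := D2; have cF2 := lip_continuous lF2.
have mA (F : R -> R) y : continuous F -> measurable_fun setT (\1_(above F y) : R -> R).
  by move=> cF; apply: measurable_indic; exact: measurable_above.
have slice x (v : R -> R) (V : R) : mu (xsection G x) = 0%E -> continuous v -> (forall s, `|v s| <= V) ->
    \int[mu]_(t in `[a, b]) (\1_(above F1 x) t * (v (F2 t) * g2 t)) = 0.
  move=> Gx cv vV; pose K := xsection G x `|` [set 0].
  have KG y : G (x, y) -> K y by move=> Gxy; left; rewrite /xsection/= inE.
  have cK : closed K.
    apply: closedU; last by apply: compact_closed; [exact: Rhausdorff|exact: compact_set1].
    have -> : xsection G x = (fun y => (x, y)) @^-1` G.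
      by apply/seteqP; split => y; rewrite /xsection/= inE.
    apply: preimage_closed cG => y _.
    by apply: (continuous_pair (f := cst x) (g := id)) => z; [exact: cvg_cst|exact: cvg_id].
  have K0 : mu K = 0%E.
    apply: null_set_setU; [exact: measurable_xsection (closed_measurable_plane cG)|exact: measurable_set1| |].
    - exact: Gx.
    - exact: lebesgue_measure_set1.
  rewrite (@slice_green _ a b F1 F2 g2 L B x K (cst 0) 0 (B + 1) ab L0 cF1 lF2 F2B D2
     F1ab F2ab cK K0 _ _ _ _ _ _ _ v V cv vV)//.
  - by apply: Rintegral_itv_eq0 => s _; rewrite mul0r.
  - by exists 0; right.
  - by move=> t tI F1t; apply: KG; rewrite -F1t; exact: FG.
  - by move=> s; rewrite normr0.
  - by move=> s Ks; rewrite mulr0; apply: wP => Gs; apply: Ks; exact: KG.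
have step x : mu (xsection G x) = 0%E ->
    \int[mu]_(t in `[a, b]) (\1_(above F1 x) t * (\1_(above F2 c') t * g2 t)) = 0.
  move=> Gx; pose v (n : nat) s : R := clamp 0 1 (n%:R * (s - c')).
  have cv n : continuous (v n).
    move=> s; apply: (@continuous_comp _ _ _ (fun s => n%:R * (s - c')) (clamp 0 1)).
      by apply: cvgMr; apply: cvgB; [exact: cvg_id|exact: cvg_cst].
    exact: continuous_clamp.
  have vB n s : `|v n s| <= 1.
    by have /andP[h1 h2] := clamp_itv (n%:R * (s - c')) (@ler01 R); rewrite /v ger0_norm.
  have vl t : v n (F2 t) @[n --> \oo] --> (\1_(above F2 c') t : R).
    rewrite indic_above; have [ct|tc] := ltP c' (F2 t).
      apply: cvg_near_cst; near=> n; apply: clamp_ge => //.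
      rewrite -ler_pdivrMr ?subr_gt0//; near: n; exact: nbhs_infty_ger.
    apply: cvg_near_cst; apply: nearW => n; apply: clamp_le => //.
    by rewrite mulr_ge0_le0// subr_le0.
  have C : \int[mu]_(t in `[a, b]) (\1_(above F1 x) t * (v n (F2 t) * g2 t)) @[n --> \oo] -->
      \int[mu]_(t in `[a, b]) (\1_(above F1 x) t * (\1_(above F2 c') t * g2 t)).
    apply: (@bounded_cvg_Rintegral _ _ _ _ _ _ _ (1 * (1 * L))) => //.
    - exact: lebesgue_itv_fin.
    - move=> n; apply: measurable_funTS; apply: measurable_funM; first exact: mA.
      by apply: measurable_funM => //; apply: measurableT_comp; exact: continuous_measurable_fun.
    - by move=> n t _; apply: mul_bound; [exact: indic_bound|exact: mul_bound].
    - by move=> t _; apply: cvgMr; apply: cvgMl; exact: vl.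
  move: C; rewrite (funext (fun n => slice x _ _ Gx (cv n) (vB n))) => C.
  by apply: (cvg_unique _ C); [exact: Rhausdorff|exact: cvg_cst].
(* The good lines are dense, being of full measure. Approaching c from the right makes the
   indicators of F1 > xs n converge also at the times with F1 = c. *)
have [xs xsP] : exists xs : nat -> R, forall n, c < xs n < c + n.+1%:R^-1 /\ mu (xsection G (xs n)) = 0%E.
  have ex n : exists x, c < x < c + n.+1%:R^-1 /\ mu (xsection G x) = 0%E.
    by have [|x h1 h2] := @ae_dense _ c n.+1%:R^-1 _ G0; [rewrite invr_gt0|exists x].
  exists (fun n => xget 0 [set x | c < x < c + n.+1%:R^-1 /\ mu (xsection G x) = 0%E]) => n.
  exact: (@xgetPex _ 0 [set x | c < x < c + n.+1%:R^-1 /\ mu (xsection G x) = 0%E] (ex n)).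
have C : \int[mu]_(t in `[a, b]) (\1_(above F1 (xs n)) t * (\1_(above F2 c') t * g2 t)) @[n --> \oo] -->
    \int[mu]_(t in `[a, b]) (\1_(above F1 c) t * (\1_(above F2 c') t * g2 t)).
  apply: (@bounded_cvg_Rintegral _ _ _ _ _ _ _ (1 * (1 * L))) => //.
  - exact: lebesgue_itv_fin.
  - move=> n; apply: measurable_funTS; apply: measurable_funM; first exact: mA.
    by apply: measurable_funM => //; exact: mA.
  - by move=> n t _; apply: mul_bound; [exact: indic_bound|apply: mul_bound; [exact: indic_bound|]].
  - move=> t _; apply: cvgMl; rewrite indic_above; have [ct|tc] := ltP c (F1 t).
      apply: cvg_near_cst; near=> n; rewrite indic_above (_ : _ < _)//.
      have [/andP[_ h] _] := xsP n; apply: (lt_le_trans h); rewrite -lerBrDl.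
      rewrite -[_ - _]invrK lef_pV2 ?posrE ?invr_gt0 ?subr_gt0//.
      apply: (@le_trans _ _ n%:R); last by rewrite ler_nat.
      by near: n; exact: nbhs_infty_ger.
    apply: cvg_near_cst; apply: nearW => n; rewrite indic_above.
    have [/andP[h _] _] := xsP n; rewrite (_ : _ < _ = false)//.
    by apply/negbTE; rewrite -leNgt (le_trans tc)// ltW.
move: C; rewrite (funext (fun n => step _ (xsP n).2)) => C.
by apply: (cvg_unique _ C); [exact: Rhausdorff|exact: cvg_cst].
Unshelve. all: by end_near. Qed.

(** Reflection in the diagonal turns an argument th into pi / 2 - th; this carries the results on
    dF2 over to dF1. *)
Lemma winds_swap a b (F1 F2 : R -> R) (z : R * R) n :
  winds (rescale a b F1 F2) z n -> winds (rescale a b F2 F1) (z.2, z.1) (- n).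
Proof.
move=> [th [cth thP thE]]; exists (fun t => pi / 2 - th t); split.
- by move=> t; apply: cvgB; [exact: cvg_cst|exact: cth].
- move=> t tI; have [r r0 [e1 e2]] := thP t tI; exists r => //=.
  by rewrite e1 e2 cosB sinB cos_pihalf sin_pihalf; split; ring.
- by rewrite -thE; ring.
Qed.

Lemma null_slices_swap G : measurable G -> (mu \x mu)%E G = 0%E ->
  {ae mu, forall y, mu (xsection [set z : R * R | G (z.2, z.1)] y) = 0%E}.
Proof.
move=> mG G0.
have E : (\int[mu]_y mu (ysection G y) = 0)%E.
  rewrite -[RHS]G0; have FE := indic_fubini_tonelli mu mu mG.
  transitivity (\int[mu]_y fubini_G mu (EFin \o \1_G) y)%E.
    by apply: eq_integral => y _; rewrite (indic_fubini_tonelli_GE mu mG).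
  rewrite -FE; apply: eq_integral => x _.
  exact: (congr1 (fun f => f x) (indic_fubini_tonelli_FE mu mG)).
have mf : measurable_fun setT (fun y => mu (ysection G y)) by exact: measurable_fun_ysection.
have E' : (\int[mu]_y `|mu (ysection G y)| = 0)%E.
  by rewrite -[RHS]E; apply: eq_integral => y _; rewrite gee0_abs.
have [+ _] := @ae_eq_integral_abs _ _ _ mu setT measurableT _ mf.
move=> /(_ E'); apply: filterS => y /(_ I) /= yG; rewrite -[RHS]yG; congr (mu _).
Qed.

End Pushforward.

(** * Net passages of the lifted path over an arc *)

Section Trail.
Context {R : realType}.
Notation mu := (@lebesgue_measure R).
Implicit Types (a b s t L B : R) (n : int) (i M : nat).

(** The turns from -M to M numbered by 0, ..., 2M, for use in finite sums; number M is the turn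
    0. *)
Definition turn M i : R := (i%:Z - M%:Z)%:~R * (2 * pi).

Lemma turn_eq M i j : `|turn M i - turn M j| < 2 * pi -> i = j.
Proof.
have p0 : 0 < 2 * pi :> R by rewrite mulr_gt0// pi_gt0.
rewrite /turn -mulrBl -intrB normrM (gtr0_norm p0) gtr_pMl// -intr_norm.
rewrite -[1]/(1%:~R) ltr_int => h; have /eqP : i%:Z - M%:Z - (j%:Z - M%:Z) == 0.
  by rewrite -normr_le0 -ltzD1 add0r.
by move/eqP; rewrite opprB addrA subrK subr_eq0 => /eqP[].
Qed.

Lemma turn_bound (d : R -> R) a b al be : a <= b -> continuous d ->
  exists M, forall n t, a <= t <= b -> al + n%:~R * (2 * pi) <= d t <= be + n%:~R * (2 * pi) ->
    exists2 i, (i < M.*2.+1)%N & n%:~R * (2 * pi) = turn M i.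
Proof.
move=> ab cd; have p0 : 0 < 2 * pi :> R by rewrite mulr_gt0// pi_gt0.
have cn : {within `[a, b], continuous (fun t => `|d t|)}.
  by apply: continuous_subspaceT => t; apply: (@cvg_norm _ R^o); exact: cd.
have [c _ cP] := EVT_max ab cn; pose D := `|d c| + `|al| + `|be|.
exists (Num.truncn (D / (2 * pi))).+1 => n t tI /andP[h1 h2].
set M := (Num.truncn _).+1.
have DM : D < M%:R * (2 * pi) by rewrite -ltr_pdivrMr//; exact: truncnS_gt.
have dD : `|d t| <= `|d c| by apply: cP; rewrite in_itv.
have nD : `|n%:~R * (2 * pi)| <= D.
  move: dD (ler_norm al) (ler_norm (- al)) (ler_norm be) (ler_norm (- be)).
  rewrite !normrN /D ler_norml => /andP[d1 d2] l1 l2 l3 l4; rewrite ler_norml.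
  by apply/andP; split; lra.
have nM : `|n| < M%:Z.
  rewrite -(ltr_int R) intr_norm -(ltr_pM2r p0) -{1}(gtr0_norm p0) -normrM.
  exact: le_lt_trans nD DM.
move: nM; rewrite ltr_norml => /andP[n1 n2].
have : 0 <= n + M%:Z by rewrite -lerBlDr sub0r ltW.
case E : (n + M%:Z) => [i|//] _; exists i; last by rewrite /turn -E addrK.
by rewrite ltnS ltnW// -ltz_nat -E -addnn PoszD ltrD2r.
Qed.

(** The times on the arc split according to the turn. By [level_density] a copy of the arc
    contributes [gam be - gam al] if it lies between d a and d b, and 0 otherwise, since neither end
    lies on a copy and d a < d b. The copy with turn 0 does lie between, so the total is a positive
    multiple of [gam be - gam al]. *)
Lemma trail_level a b (d gam f g : R -> R) L B al be M (T : set R) :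
  a <= b -> 0 <= L -> continuous d -> lip L f -> (forall t, `|f t| <= B) -> density a b f g L ->
  (forall t, f t = gam (d t)) -> (forall s n, gam (s + n%:~R * (2 * pi)) = gam s) ->
  d a < al -> al < be -> be < d b -> be - al < 2 * pi ->
  (forall n, ~ al <= d a + n%:~R * (2 * pi) <= be) ->
  (forall n, ~ al <= d b + n%:~R * (2 * pi) <= be) ->
  (forall t, T t <-> exists2 i, (i < M.*2.+1)%N & al + turn M i <= d t <= be + turn M i) ->
  \int[mu]_(t in `[a, b]) (\1_T t * g t) = 0 -> gam al = gam be.
Proof.
move=> ab L0 cd lf fB Df fE per aal albe beb short nA nB TE T0.
have [mg gL _ _] := Df.
have mA y : measurable_fun setT (\1_(above d y) : R -> R) by apply: measurable_indic; exact: measurable_above.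
have mAg y : measurable_fun setT (fun t => \1_(above d y) t * g t) by exact: measurable_funM.
have bAg y t : `|\1_(above d y) t * g t| <= 1 * L by apply: mul_bound; [exact: indic_bound|].
have iAg y : mu.-integrable `[a, b] (EFin \o (fun t => \1_(above d y) t * g t)) by exact: bounded_integrable (bAg y).
pose h i t := \1_(above d (al + turn M i)) t * g t - \1_(above d (be + turn M i)) t * g t.
pose ins i := (d a < al + turn M i) && (be + turn M i < d b).
have hI i : \int[mu]_(t in `[a, b]) h i t = (ins i)%:R * (gam be - gam al).
  rewrite RintegralB//; have lev y := level_density y L0 ab cd lf fB Df fE (lexx a) ab (lexx b).
  rewrite !lev; have := nA (- (i%:Z - M%:Z)); have := nB (- (i%:Z - M%:Z)).
  rewrite mulrNz mulNr -/(turn M i) => nb na.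
  have pal : gam (al + turn M i) = gam al by exact: per.
  have pbe : gam (be + turn M i) = gam be by exact: per.
  rewrite /ins; have [h1|h1] := ltP (d a) (al + turn M i); last first.
    have h2 : be + turn M i < d a.
      by rewrite ltNge; apply/negP => h2; apply: na; apply/andP; split; lra.
    have e (x y : R) : x < y -> Num.max y x = y by move=> xy; apply/max_idPl/ltW.
    rewrite (e _ (d a) h2) (e _ (d b)) ?(e _ (d b)) ?(e _ (d a)) ?mul0r ?subrr//; lra.
  have e1 (y : R) : d a < y -> Num.max (d a) y = y by move=> xy; apply/max_idPr/ltW.
  have h0 : al + turn M i < be + turn M i by rewrite ltrD2r.
  rewrite ?(e1 _ h1) ?(e1 _ (lt_trans h1 h0)) pal pbe.
  have [h2|h2] := ltP (be + turn M i) (d b).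
    rewrite ?(max_idPl (ltW h2)) ?(max_idPl (ltW (lt_trans h0 h2)))/= mul1r; ring.
  have h3 : d b < al + turn M i.
    by rewrite ltNge; apply/negP => h3; apply: nb; apply/andP; split; lra.
  by rewrite ?(max_idPr (ltW h3)) ?(max_idPr h2)/= mul0r ?pal ?pbe !subrr.
have sumT : \int[mu]_(t in `[a, b]) (\sum_(i < M.*2.+1) h i t) = 0.
  rewrite -[RHS]T0; apply: (@Rintegral_ae _ a b) => //.
  have c1 y : closed [set y : R] by apply: compact_closed; [exact: Rhausdorff|exact: compact_set1].
  (* The half-open layers of levels and the closed set [T] differ only where f equals [gam al], and
     there [g] vanishes almost everywhere. *)
  have H1 := null_preimage L0 ab Df lf fB (c1 (gam al)) (lebesgue_measure_set1 _).
  apply: ae_imply H1 => t H at_ tb; have {}H := H at_ tb.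
  have [g0|g0] := eqVneq (g t) 0.
    by rewrite g0 mulr0 big1// => i _; rewrite /h g0 !mulr0 subrr.
  have nal i : d t <> al + turn M i.
    move=> dE; move/eqP: g0; apply; apply: H => /=.
    by rewrite fE dE; exact: per.
  have hE i : h i t = ((al + turn M i < d t <= be + turn M i)%R)%:R * g t.
    rewrite /h !indic_above -mulrBl; congr (_ * _).
    have [x1|x1] := ltP (al + turn M i) (d t); have [x2|x2] := leP (d t) (be + turn M i) => /=; rewrite ?subrr ?subr0//.
    lra.
  have [Tt|nT] := pselect (T t).
    rewrite indicE mem_set// mul1r; have [i0 i0M /andP[x1 x2]] := (TE t).1 Tt.
    have x1' : al + turn M i0 < d t by rewrite lt_neqAle x1 andbT; apply/eqP => /esym/nal.
    rewrite (bigD1 (Ordinal i0M))//= hE x1' x2 mul1r big1 ?addr0// => i ii0; rewrite hE.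
    case: (boolP (_ < _ <= _)) => [/andP[y1 y2]|_]; last by rewrite mul0r.
    exfalso; move/eqP: ii0; apply; apply: val_inj => /=; apply: (@turn_eq M).
    by rewrite ltr_norml; apply/andP; split; lra.
  rewrite indicE memNset// mul0r big1// => i _; rewrite hE.
  case: (boolP (_ < _ <= _)) => [/andP[y1 y2]|_]; last by rewrite mul0r.
  by exfalso; apply: nT; apply/TE; exists i => //; rewrite (ltW y1).
move: sumT; rewrite Rintegral_sum; last first.
  move=> i; split; first exact: measurable_funB.
  by exists (1 * L + 1 * L) => t; apply: (le_trans (ler_normB _ _)); apply: lerD.
rewrite (eq_bigr (fun i : 'I_(M.*2.+1) => (ins i)%:R * (gam be - gam al))) => [|i _]; last exact: hI.
rewrite -mulr_suml => /eqP; rewrite mulf_eq0 subr_eq0 => /orP[|/eqP->//].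
have MM : (M < M.*2.+1)%N by rewrite ltnS -addnn leq_addr.
rewrite psumr_eq0 => [|i _]; last exact: ler0n.
move=> /allP/(_ (Ordinal MM)); rewrite mem_index_enum => /(_ isT) /=.
by rewrite /ins /turn subrr mul0r !addr0 aal beb oner_eq0.
Qed.

End Trail.

Lemma finite_inj_preimage (T U : Type) (X : set T) (f : T -> U) (B : set U) :
  set_inj X f -> finite_set B -> finite_set (X `&` f @^-1` B).
Proof.
move=> fi fB; pose h x := if x \in X then Some (f x) else None.
have fS : finite_set (h @^-1` (Some @` B)).
  apply: finite_preimage; last exact: finite_image.
  move=> x y; rewrite !inE /h /=; case: ifP => [Xx _|_ [? _ //]]; case: ifP => [Xy _|_ [? _ //]].
  by move=> [] /fi; apply.
apply: sub_finite_set fS => x [Xx Bx]; rewrite /= /h mem_set//.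
by exists (f x).
Qed.

(** * The lift of the path in the circle arc is closed *)

Section ClosedTrail.
Context {R : realType}.
Notation mu := (@lebesgue_measure R).
Implicit Types (a b s t L B : R).

Definition on_circle s : R * R := (cos s, sin s).

Lemma on_circle_eq s t : on_circle s = on_circle t -> exists n : int, s = t + n%:~R * (2 * pi).
Proof. by move=> [c1 s1]; exact: trig_eq. Qed.

Lemma on_circle_turn s (n : int) : on_circle (s + n%:~R * (2 * pi)) = on_circle s.
Proof. by rewrite /on_circle; have [-> ->] := trig_int n s. Qed.

Lemma short_turn (n : int) s t : s = t + n%:~R * (2 * pi) -> `|s - t| <= 1 -> s = t.
Proof.
move=> -> h; suff -> : n = 0 by rewrite mul0r addr0.
move: h; rewrite addrAC subrr add0r normrM (gtr0_norm (_ : 0 < 2 * pi)); last by rewrite mulr_gt0// pi_gt0.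
move=> h; apply/eqP; rewrite -normr_le0 -ltzD1 add0r -(ltr_int R) intr_norm.
have p2 := @pi_ge2 R; have n0 := normr_ge0 (n%:~R : R).
by rewrite ltNge; apply/negP => h1; nra.
Qed.

(** If d a < d b, a short arc between them avoids the exceptional points and both ends. The image of
    the times on this arc is compact and, by injectivity, is visited at those times only. As dF1 and
    dF2 annihilate it, [trail_level] gives the two ends of the arc the same image, against
    injectivity. *)
Lemma trail_lt a b (d : R -> R) (F1 F2 g1 g2 : R -> R) L B (gt : R -> R * R) (P : set (R * R)) :
  a < b -> 0 <= L -> continuous d -> lip L F1 -> lip L F2 ->
  (forall t, `|F1 t| <= B) -> (forall t, `|F2 t| <= B) ->
  density a b F1 g1 L -> density a b F2 g2 L ->
  (forall t, (F1 t, F2 t) = gt (d t)) ->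
  (forall s (n : int), gt (s + n%:~R * (2 * pi)) = gt s) ->
  finite_set P ->
  (forall t t', a <= t <= b -> a <= t' <= b -> ~ P (on_circle (d t')) ->
    (F1 t, F2 t) = (F1 t', F2 t') -> on_circle (d t) = on_circle (d t')) ->
  (forall A : set (R * R), measurable A -> \int[mu]_(t in `[a, b]) (\1_A (F1 t, F2 t) * g1 t) = 0) ->
  (forall A : set (R * R), measurable A -> \int[mu]_(t in `[a, b]) (\1_A (F1 t, F2 t) * g2 t) = 0) ->
  ~ d a < d b.
Proof.
move=> ab L0 cd lF1 lF2 F1B F2B D1 D2 Fgt per fP inj van1 van2 dab.
pose P2 := P `|` [set on_circle (d a)] `|` [set on_circle (d b)].
have fP2 : finite_set P2.
  by rewrite /P2 !finite_setU; split; [split => //; exact: finite_set1|exact: finite_set1].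
have [s0 sI nP0] : exists2 s, d a < s < d b & ~ P2 (on_circle s).
  apply: contrapT => nex.
  (* On an interval of length at most 1 the map [on_circle] is injective, so only finitely many
     parameters are forbidden, while the interval has positive measure. *)
  pose m := Num.min (d b) (d a + 1).
  have dm : d a < m by rewrite lt_min dab ltrDl ltr01.
  pose X := `]d a, m[%classic : set R.
  have XP s : X s -> P2 (on_circle s).
    rewrite /X /m /= in_itv/= lt_min => /and3P[h1 h2 _]; apply: contrapT => nP; apply: nex.
    by exists s => //; rewrite h1.
  have fX : finite_set X.
    have : finite_set (X `&` on_circle @^-1` P2).
      apply: finite_inj_preimage fP2 => s t; rewrite !inE /X/= !in_itv/= /m !lt_min.
      move=> /and3P[s1 _ s2] /and3P[t1 _ t2] /on_circle_eq[n nE].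
      by apply: short_turn nE _; rewrite ler_norml; apply/andP; split; lra.
    by apply: sub_finite_set => s Xs; split => //; exact: XP.
  have := countable_lebesgue_measure0 (finite_set_countable fX).
  by rewrite /X lebesgue_measure_itv/= lte_fin dm => /eqP; rewrite -EFinD eqe subr_eq0 gt_eqF.
have cc : continuous on_circle by apply: continuous_pair; [exact: continuous_cos|exact: continuous_sin].
have clP : closed P2.
  have [+ _] := @accessible_finite_set_closed (R * R)%type; apply => //.
  by apply: hausdorff_accessible; exact: norm_hausdorff.
have : nbhs s0 (on_circle @^-1` (~` P2)).
  by apply: cc; apply: open_nbhs_nbhs; split => //; exact: closed_openC.
move=> /nbhs_ballP[r /= r0 rP]; move/andP: sI => [as0 s0b].
pose e := Num.min (Num.min (r / 2) (1 / 2)) (Num.min ((s0 - d a) / 2) ((d b - s0) / 2)).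
have e0 : 0 < e by rewrite !lt_min; apply/andP; split; apply/andP; split; lra.
have [er e1 ea eb] : [/\ e <= r / 2, e <= 1 / 2, e <= (s0 - d a) / 2 & e <= (d b - s0) / 2].
  by rewrite /e; split; rewrite !ge_min lexx ?orbT.
pose al := s0 - e; pose be := s0 + e.
have near s : al <= s <= be -> ~ P2 (on_circle s).
  move=> /andP[h1 h2]; apply: rP; rewrite /ball/= ltr_norml; rewrite /al /be in h1 h2.
  by apply/andP; split; lra.
have [M MP] := turn_bound al be (ltW ab) cd.
pose T := [set t | exists2 i, (i < M.*2.+1)%N & al + turn M i <= d t <= be + turn M i].
have TE t : a <= t <= b -> (exists n : int, al + n%:~R * (2 * pi) <= d t <= be + n%:~R * (2 * pi)) -> T t.
  by move=> tI [n h]; have [i iM iE] := MP n t tI h; exists i; rewrite -?iE.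
have clT : closed T.
  rewrite (_ : T = \bigcup_(i in `I_(M.*2.+1)) (d @^-1` `[al + turn M i, be + turn M i])).
    apply: closed_bigcup; first exact: finite_II.
    by move=> i _; apply: preimage_closed => [t _|]; [exact: cd|exact: interval_closed].
  by apply/seteqP; split => t [i iM h]; exists i => //; move: h; rewrite /= in_itv.
pose K := (fun t => (F1 t, F2 t)) @` (`[a, b] `&` T).
(* [K] is a continuous image of a compact set of times; this is where closedness of [T] enters. *)
have mK : measurable K.
  apply: closed_measurable_plane; apply: compact_closed; first exact: norm_hausdorff.
  apply: continuous_compact; last by apply: compact_closedI => //; exact: segment_compact.
  by apply: continuous_subspaceT; apply: continuous_pair; exact: lip_continuous.
have KT t : a <= t <= b -> (\1_K (F1 t, F2 t) : R) = \1_T t.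
  move=> tI; rewrite !indicE; have [Tt|nT] := pselect (T t).
    by rewrite !mem_set//; exists t => //; split => //; rewrite /= in_itv.
  rewrite [t \in T]memNset// memNset// => -[t' [t'I [i iM /andP[h1 h2]]] Ft]; apply: nT.
  have t'I' : a <= t' <= b by move: t'I; rewrite /= in_itv.
  have nP : ~ P2 (on_circle (d t')).
    rewrite -(on_circle_turn _ (- (i%:Z - M%:Z))) mulrNz mulNr; apply: near.
    by rewrite -/(turn M i); apply/andP; split; lra.
  have [n nE] := on_circle_eq (inj t t' tI t'I' (fun p => nP (or_introl (or_introl p))) (esym Ft)).
  apply: TE => //; exists (n + (i%:Z - M%:Z)); rewrite intrD mulrDl -/(turn M i) nE.
  by apply/andP; split; lra.
have van (g : R -> R) : \int[mu]_(t in `[a, b]) (\1_K (F1 t, F2 t) * g t) = 0 ->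
    \int[mu]_(t in `[a, b]) (\1_T t * g t) = 0.
  move=> <-; apply: eq_Rintegral => t; rewrite inE/= in_itv/= => tI; by rewrite KT.
have aal : d a < al by rewrite /al; lra.
have albe : al < be by rewrite /al /be; lra.
have beb : be < d b by rewrite /be; lra.
have short : be - al < 2 * pi by have := @pi_ge2 R; rewrite /al /be; lra.
have nA (n : int) : ~ al <= d a + n%:~R * (2 * pi) <= be.
  by move=> /near; apply; rewrite on_circle_turn; left; right.
have nB (n : int) : ~ al <= d b + n%:~R * (2 * pi) <= be.
  by move=> /near; apply; rewrite on_circle_turn; right.
have E1 := @trail_level R a b d (fst \o gt) F1 g1 L B al be M T (ltW ab) L0 cd lF1 F1B D1
  (fun t => congr1 fst (Fgt t)) (fun s n => congr1 fst (per s n)) aal albe beb short nA nB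
  (fun t => iff_refl _) (van _ (van1 K mK)).
have E2 := @trail_level R a b d (snd \o gt) F2 g2 L B al be M T (ltW ab) L0 cd lF2 F2B D2
  (fun t => congr1 snd (Fgt t)) (fun s n => congr1 snd (per s n)) aal albe beb short nA nB
  (fun t => iff_refl _) (van _ (van2 K mK)).
have ivt s : d a < s < d b -> exists2 t, a <= t <= b & d t = s.
  move=> /andP[h1 h2]; have [||t tI <-] := @IVT R d a b s (ltW ab).
  - exact: continuous_subspaceT.
  - by rewrite ge_min le_max (ltW h1) (ltW h2) orbT.
  - by exists t => //; move: tI; rewrite in_itv.
have [ta taI taE] : exists2 t, a <= t <= b & d t = al by apply: ivt; rewrite aal (lt_trans albe).
have [tb tbI tbE] : exists2 t, a <= t <= b & d t = be by apply: ivt; rewrite beb (lt_trans aal).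
have nPa : ~ P2 (on_circle (d ta)) by rewrite taE; apply: near; rewrite lexx ltW.
have Fab : (F1 tb, F2 tb) = (F1 ta, F2 ta).
  by rewrite !Fgt taE tbE [LHS]surjective_pairing [RHS]surjective_pairing; congr (_, _); symmetry.
have [n nE] := on_circle_eq (inj tb ta tbI taI (fun p => nPa (or_introl (or_introl p))) Fab).
have : d tb = d ta.
  by apply: short_turn nE _; rewrite taE tbE /al /be ler_norml; apply/andP; split; lra.
by rewrite taE tbE => E; move: albe; rewrite E ltxx.
Qed.

Lemma trail_ends a b (d : R -> R) (F1 F2 g1 g2 : R -> R) L B (gt : R -> R * R) (P : set (R * R)) :
  a < b -> 0 <= L -> continuous d -> lip L F1 -> lip L F2 ->
  (forall t, `|F1 t| <= B) -> (forall t, `|F2 t| <= B) ->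
  density a b F1 g1 L -> density a b F2 g2 L ->
  (forall t, (F1 t, F2 t) = gt (d t)) ->
  (forall s (n : int), gt (s + n%:~R * (2 * pi)) = gt s) ->
  finite_set P ->
  (forall t t', a <= t <= b -> a <= t' <= b -> ~ P (on_circle (d t')) ->
    (F1 t, F2 t) = (F1 t', F2 t') -> on_circle (d t) = on_circle (d t')) ->
  (forall A : set (R * R), measurable A -> \int[mu]_(t in `[a, b]) (\1_A (F1 t, F2 t) * g1 t) = 0) ->
  (forall A : set (R * R), measurable A -> \int[mu]_(t in `[a, b]) (\1_A (F1 t, F2 t) * g2 t) = 0) ->
  d a = d b.
Proof.
move=> ab L0 cd lF1 lF2 F1B F2B D1 D2 Fgt per fP inj van1 van2.
apply/eqP; rewrite eq_le !leNgt; apply/andP; split; apply/negP; last first.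
  exact: (trail_lt ab L0 cd lF1 lF2 F1B F2B D1 D2 Fgt per fP inj van1 van2).
(* Complex conjugation reverses the parameter and reduces the opposite inequality to the one already
   excluded. *)
rewrite -ltrN2; pose cj (z : R * R) : R * R := (z.1, - z.2).
have cjE s : on_circle (- s) = cj (on_circle s) by rewrite /on_circle cosN sinN.
have cjK : involutive cj by move=> z; rewrite /cj/= opprK -surjective_pairing.
apply: (@trail_lt a b (fun t => - d t) F1 F2 g1 g2 L B (fun s => gt (- s)) (cj @` P)) => //.
- by move=> t; apply: cvgN; exact: cd.
- by move=> t; rewrite opprK.
- by move=> s n; rewrite opprD -mulNr -mulrNz per.
- exact: finite_image.
- move=> t t' tI t'I nP /(inj t t' tI t'I) h; rewrite !cjE h// => Pt; apply: nP.
  by rewrite cjE; exists (on_circle (d t')).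
Qed.

Lemma circle_lift a b (d : R -> R * R) : a < b -> continuous d -> (forall t, unit_circle (d t)) ->
  exists2 th : R -> R, continuous th & forall t, a <= t <= b -> d t = on_circle (th t).
Proof.
move=> ab cd du.
pose c := rescale a b (fst \o d) (snd \o d).
have cc : continuous c.
  have ca : continuous (fun t => a + t * (b - a)).
    by move=> t; apply: cvgD; [exact: cvg_cst|apply: cvgMl; exact: cvg_id].
  apply: continuous_pair => t.
    by apply: (@continuous_comp _ _ _ (fun t => a + t * (b - a)) (fst \o d)); [exact: ca|exact: continuous_fst1].
  by apply: (@continuous_comp _ _ _ (fun t => a + t * (b - a)) (snd \o d)); [exact: ca|exact: continuous_snd1].
have c0 t : c t <> (0, 0).
  move=> [e1 e2]; have := du (a + t * (b - a)).
  by rewrite /unit_circle/= e1 e2 expr0n addr0 => /esym/eqP; rewrite oner_eq0.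
have [n wn] := winds_exists cc c0.
have [th [cth thP _]] := winds_rescale ab wn; exists th => // t tI.
have [r r0 [/= ]] := thP t tI; rewrite !subr0 => e1 e2.
have r1 : r = 1.
  have := du t; rewrite /unit_circle/= e1 e2 !exprMn -mulrDr cos2Dsin2 mulr1 => /eqP.
  by rewrite sqrf_eq1 => /orP[/eqP//|/eqP rE]; move: r0; rewrite rE; lra.
by rewrite /on_circle [LHS]surjective_pairing e1 e2 r1 !mul1r.
Qed.

Lemma clamp_lip a b f : a <= b -> [lipschitz f t | t in `[a, b]] -> f a = 0 ->
  exists2 L, 0 <= L & lip L (f \o clamp a b) /\ forall t, `|(f \o clamp a b) t| <= L * (b - a).
Proof.
move=> ab /lipschitz_on_itv[L L0 lL] fa; exists L => //; split.
  move=> s t /=; apply: (le_trans (lL _ _ (clamp_itv s ab) (clamp_itv t ab))).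
  by rewrite ler_wpM2l// (le_trans (lip_clamp a b s t))// mul1r.
move=> t; have cI := clamp_itv t ab; have aI : a <= a <= b by rewrite lexx.
rewrite -[X in `|X|]subr0 -fa /=; apply: (le_trans (lL _ _ cI aI)).
rewrite ler_wpM2l// ger0_norm ?subr_ge0; last by case/andP: cI.
by rewrite lerB//; case/andP: cI.
Qed.

Lemma derive_clamp_ae a b f g L : density a b (f \o clamp a b) g L ->
  {ae mu, forall t, a < t -> t < b -> derive1 f t = g t}.
Proof.
move=> [_ _ _]; apply: ae_imply => t H at_ tb; have [_ <-] := H at_ tb.
rewrite !derive1E; apply: near_eq_derive; near=> s.
rewrite /= clamp_id//; apply/andP; split; apply: ltW; near: s; [exact: lt_nbhsr|exact: lt_nbhsl].
Unshelve. all: by end_near. Qed.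

End ClosedTrail.

(** * Vanishing moments make dF annihilate all Borel sets *)

Section NullMoments.
Context {R : realType}.
Implicit Types (L B c x y s t : R).
Notation mu := (@lebesgue_measure R).

Lemma closed_swap (G : set (R * R)) : closed G -> closed [set z : R * R | G (z.2, z.1)].
Proof.
move=> cG; have cs : continuous (fun z : R * R => (z.2, z.1)).
  by move=> z; apply: (@cvg_pair _ _ _ _ (nbhs z.2) (nbhs z.1)); [exact: cvg_snd|exact: cvg_fst].
exact: (preimage_closed (fun z _ => cs z) cG).
Qed.

(** The moments involve dF2 only, but they make the winding number vanish, which is symmetric in the
    coordinates up to sign; exchanging the coordinates then treats dF1. *)
Lemma moments_null (d : nat) a b (F1 F2 g1 g2 : R -> R) L B G :
  a < b -> 0 <= L -> lip L F1 -> lip L F2 ->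
  (forall t, `|F1 t| <= B) -> (forall t, `|F2 t| <= B) ->
  density a b F1 g1 L -> density a b F2 g2 L ->
  F1 a = F1 b -> F2 a = F2 b -> (forall t, G (F1 t, F2 t)) -> C2 d G ->
  (forall i j, (i < d.+2)%N -> (j < d.+1)%N ->
    \int[mu]_(t in `[a, b]) (F1 t ^+ i * (F2 t ^+ j * g2 t)) = 0) ->
  forall A : set (R * R), measurable A ->
    \int[mu]_(t in `[a, b]) (\1_A (F1 t, F2 t) * g1 t) = 0 /\
    \int[mu]_(t in `[a, b]) (\1_A (F1 t, F2 t) * g2 t) = 0.
Proof.
move=> ab L0 l1 l2 B1 B2 D1 D2 e1 e2 FG C2G mom A mA.
have w0 z : ~ G z -> winds (rescale a b F1 F2) z 0.
  by move=> Gz; exact: (winding_zero ab l1 L0 l2 B1 B2 D2 e1 e2 FG C2G mom Gz).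
have [_ triG _] := C2G; have [mG G0] := triangulable_null triG.
have cG : closed G by apply: compact_closed; [exact: norm_hausdorff|case: triG].
have mF1 : measurable_fun setT F1 by apply: continuous_measurable_fun; exact: lip_continuous l1.
have mF2 : measurable_fun setT F2 by apply: continuous_measurable_fun; exact: lip_continuous l2.
have [mg1 bg1 _ _] := D1; have [mg2 bg2 _ _] := D2.
have q2 := quadrant_zero ab L0 (lip_continuous l1) l2 B2 D2 e1 e2 cG (null_slices mG G0) FG w0.
have q1 := @quadrant_zero R a b F2 F1 g1 L B [set z : R * R | G (z.2, z.1)] ab L0
  (lip_continuous l2) l1 B1 D1 e2 e1 (closed_swap cG) (null_slices_swap mG G0) FG.
split; last exact: (quadrants_generate mF1 mF2 mg2 B1 B2 bg2 q2 mA).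
apply: (quadrants_generate mF1 mF2 mg1 B1 B2 bg1 _ mA) => c c'.
rewrite -[RHS](q1 _ c' c).
  by apply: eq_Rintegral => t _; rewrite mulrCA.
by move=> [x y] /= nG; have := winds_swap (w0 (y, x) nG); rewrite oppr0.
Qed.

End NullMoments.

(** * The equivalence for Abel equations *)

Theorem theorem4p5 (R : realType) (d : nat) (a b : R) (f1 f2 : R -> R)
  (ab : a < b)
  (f1_lip : [lipschitz f1 t | t in `[a, b]])
  (f2_lip : [lipschitz f2 t | t in `[a, b]])
  (f1_nonconst : exists t u, [/\ t \in `[a, b], u \in `[a, b] & f1 t <> f1 u])
  (f2_nonconst : exists t u, [/\ t \in `[a, b], u \in `[a, b] & f2 t <> f2 u])
  (f1a : f1 a = 0) (f2a : f2 a = 0)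
  (F_triangulable :
     lipschitz_triangulable ((fun t => (f1 t, f2 t)) @` `[a, b]))
  (F_P2 : P2 d a b (fun t => (f1 t, f2 t))) :
  universal_center a b f1 f2 <->
  (forall d1 d2 : nat, (maxn (d1 - 1) d2 <= d)%N -> moment a b f1 f2 d1 d2 = 0).
Proof.
have abW := ltW ab.
have [L1 L1_ge0 [l1 B1]] := clamp_lip abW f1_lip f1a.
have [L2 L2_ge0 [l2 B2]] := clamp_lip abW f2_lip f2a.
pose L := L1 + L2; pose B := L * (b - a).
have L0 : 0 <= L by exact: addr_ge0.
have ba0 : 0 <= b - a by rewrite subr_ge0.
have le1 : L1 <= L by rewrite lerDl.
have le2 : L2 <= L by rewrite lerDr.
pose f (i : 'I_2) := if i == ord0 then f1 else f2.
pose F i := f i \o clamp a b.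
have lF i : lip L (F i).
  by rewrite /F /f; case: ifP => _ x y;
    [apply: le_trans (l1 x y) _ | apply: le_trans (l2 x y) _]; rewrite ler_wpM2r.
have FB i t : `|F i t| <= B.
  by rewrite /F /f; case: ifP => _;
    [apply: le_trans (B1 t) _ | apply: le_trans (B2 t) _]; rewrite ler_wpM2r.
have [g DF] : exists g, forall i, density a b (F i) (g i) L.
  exists (fun i => projT1 (cid (lip_density abW L0 (lF i)))) => i.
  exact: projT2 (cid (lip_density abW L0 (lF i))).
have fF i t : a <= t <= b -> f i t = F i t by move=> tab; rewrite /F /= clamp_id.
have aab : a <= a <= b by rewrite lexx.
have bab : a <= b <= b by rewrite lexx abW.
have Fa i : F i a = 0 by rewrite -fF// /f; case: ifP.
have ae_g i := derive_clamp_ae (DF i).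
have iterE w : iterated_integral f b w a = iterg g b w a.
  exact: iterated_integralE.
have momentE i j : moment a b f1 f2 i j =
    \int[lebesgue_measure]_(t in `[a, b]) (F ord0 t ^+ i * F ord_max t ^+ j * g ord_max t).
  apply: (Rintegral_ae _ (lexx a) (lexx b)).
  apply: ae_imply (ae_g ord_max) => t gE at_ tb; rewrite -gE//.
  by rewrite -!fF ?(ltW at_) ?(ltW tb).
split=> [center i j _|moments w w0].
  rewrite momentE; apply: (iterg_moment abW L0 lF FB DF) => // w w0.
  by rewrite -iterE; exact: center.
rewrite iterE; have [G C2G [_ Fab FG [X [I [gamma [_ trail [delta [cdelta deltaI Fdelta]]]]]]]] := F_P2.
have [_ [[al [be [_ IE]]] _] _ [P0 finP0 injP0] _] := trail.
have ctab t : a <= clamp a b t <= b by exact: clamp_itv.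
have ctI t : `[a, b]%classic (clamp a b t) by rewrite /= in_itv/=.
have FE t : (F ord0 t, F ord_max t) = gamma (delta (clamp a b t)).
  by rewrite -Fdelta.
have deltaIc t : I (delta (clamp a b t)) by apply: deltaI; exists (clamp a b t).
have circ t : unit_circle ((delta \o clamp a b) t).
  have := deltaIc t; rewrite IE => -[s _ /= <-]; exact: cos2Dsin2.
have [th cth thE] := circle_lift ab (continuous_within_clamp1 abW cdelta) circ.
have thI t : I (on_circle (th (clamp a b t))).
  by rewrite -thE//= clamp_idem.
(* The trail is injective off [P0] only, so a point off [P0] may share its image with a point of
   [P0]; there are finitely many such points, and they are excluded too. *)
pose bad := P0 `|` (I `\` P0) `&` gamma @^-1` (gamma @` P0).
have finbad : finite_set bad.
  rewrite finite_setU; split=> //; apply: finite_inj_preimage => //.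
  exact: finite_image.
have Fth t : (F ord0 t, F ord_max t) = gamma (on_circle (th (clamp a b t))).
  by rewrite FE -thE//= clamp_idem.
have cth' : continuous (th \o clamp a b).
  move=> x; apply: continuous_comp; first exact: (lip_continuous (lip_clamp a b)).
  exact: cth.
have Fclosed i : F i a = F i b.
  rewrite /F /= !clamp_id// /f.
  by case: ifP => _; [exact: (congr1 fst Fab)|exact: (congr1 snd Fab)].
have GF t : G (F ord0 t, F ord_max t) by apply: FG; exists (clamp a b t).
have mom i j : (i < d.+2)%N -> (j < d.+1)%N ->
    \int[lebesgue_measure]_(t in `[a, b]) (F ord0 t ^+ i * (F ord_max t ^+ j * g ord_max t)) = 0.
  (* Subtraction of natural numbers is truncated, so the bound on [i - 1] says i <= d + 1, including
     i = 0. *)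
  move=> id_ jd; have dij : (maxn (i - 1) j <= d)%N
    by rewrite geq_max leq_subLR add1n; exact/andP.
  apply: etrans (moments i j dij); rewrite momentE.
  by apply: eq_Rintegral => t _; rewrite mulrA.
have null := moments_null ab L0 (lF ord0) (lF ord_max) (FB ord0) (FB ord_max)
    (DF ord0) (DF ord_max) (Fclosed ord0) (Fclosed ord_max) GF C2G mom.
have ends : (th \o clamp a b) a = (th \o clamp a b) b.
  apply: (@trail_ends R a b (th \o clamp a b) (F ord0) (F ord_max) (g ord0) (g ord_max) L B
    (gamma \o on_circle) bad) => //.
  - by move=> s n; rewrite /= on_circle_turn.
  - move=> t t' tab t'ab nbad gE.
    have nP0 : ~ P0 (on_circle (th (clamp a b t'))) by move=> p; apply: nbad; left.
    have gE' : gamma (on_circle (th (clamp a b t))) = gamma (on_circle (th (clamp a b t'))).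
      by rewrite -!Fth.
    apply: injP0; last exact: gE'.
    + apply/mem_set; split=> [|p]; first exact: thI.
      apply: nbad; right; split; first by split=> //; exact: thI.
      by exists (on_circle (th (clamp a b t))).
    + by apply/mem_set; split=> //; exact: thI.
  - by move=> A /null[].
  - by move=> A /null[].
apply: (@iterg_closed R a b L B F g abW L0 lF FB DF (th \o clamp a b)
  (fun i s => let z := gamma (on_circle s) in if i == ord0 then z.1 else z.2)) => // i t.
by rewrite /= -Fth/= /F /f; case: ifP.
Qed.
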